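(* Let $A:=(V,m_2,\omega)$ be a strictly graded commutative Frobenius algebra. For all $n\ge3$ the assignment sending a minimal symplectic $C_n$-structure $m=m_2+\dots+m_{n-1}$ to the 0-form $$\mathrm{Obs}(m):=\tfrac12\Upsilon_{\mathrm{Lie}}^{-1}\Big(\sum_{i+j=n+2,\ 3\le i,j\le n-1}[m_i,m_j]\Big)$$ induces a map $$\mathrm{Obs}_n:\mathcal{SC}_n(A)\to HC^{n+2,1+|\omega|}_{\mathrm{Harr}}(A),\qquad m\mapsto\mathrm{Obs}(m).$$ The kernel of this map (the preimage of $0$) consists of precisely those symplectic $C_n$-structures which are extendable: $$\{m\in\mathcal{SC}_n(A):m\text{ is extendable}\}=\ker(\mathrm{Obs}_n).$$
   Context: Conventions. $\mathbb K$ is an evenly graded commutative ring containing $\mathbb Q$; modules are graded $\mathbb K$-modules, cohomologically graded, with the Koszul sign rule. $(\Sigma V)^i=V^{i+1}$, $(\Sigma^{-1}V)^i=V^{i-1}$; $\Sigma V^*$ means $\mathrm{Hom}_{\mathbb K}(\Sigma V,\mathbb K)$. Profinite modules are inverse limits of free modules of finite rank. For $W$ profinite, $\widehat TW=\prod_{i\ge0}W^{\hat\otimes i}$ and $\widehat LW\subset\widehat TW$ is the Lie subalgebra of convergent (possibly infinite) linear combinations of Lie monomials. Vector field = continuous derivation; diffeomorphism = invertible continuous homomorphism; $\mathrm{Der}(X)$, $\mathrm{Aut}(X)$ are the Lie algebra and group of these. Elements of $W^{\hat\otimes n}$ have order $n$; an endomorphism of $\widehat LW$ has order $n$ if it takes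 elements of order $i$ to elements of order $i+n-1$. $(n)$ denotes the module of continuous endomorphisms of $\widehat L\Sigma V^*$ of order $\ge n$. A diffeomorphism is pointed if it is of the form $\mathrm{id}+\phi_2+\phi_3+\cdots$ with $\phi_i$ an endomorphism of order $i$. Lie de Rham complex. For $g=\widehat LW$ with $\widehat{\mathcal U}(g)=\widehat TW$: $\Omega^1_{\mathrm{Lie}}(g)$ is the quotient of $\widehat{\mathcal U}(g)\hat\otimes g$ (elements written $x\otimes dy$) by $x\otimes d[y,z]=xy\otimes dz-(-1)^{|z||y|}xz\otimes dy$, with $g$ acting by left multiplication. $\Omega^\bullet_{\mathrm{Lie}}(g)=g\ltimes\widehat L(\Sigma^{-1}\Omega^1_{\mathrm{Lie}}(g))$ with the unique differential $d$ extending $y\mapsto dy=1\otimes dy$ to a differential graded Lie algebra structure. $DR^\bullet_{\mathrm{Lie}}(g)$ is the quotient of $\Omega^\bullet_{\mathrm{Lie}}(g)\hat\otimes\Omega^\bullet_{\mathrm{Lie}}(g)$ by $x\otimes y=(-1)^{|x||y|}y\otimes x$ and $x\otimes[y,z]=[x,y]\otimes z$, with $d(x\otimes y)=dx\otimes y+(-1)^{|x|}x\otimes dy$. $i$-forms $DR^i$ are the $i$-fold suspension of the part of form-degree $i$ (so the degree of $dx\otimes dy\in DR^2$ is $|x|+|y|$). The order of a form is its tensor degree in $W$ minus its form degree. For a vector field $\xi$, $L_\xi$ and $i_\xi$ are the derivations of $\Omega^\bullet_{\mathrm{Lie}}(g)$ with $L_\xi(x)=\xi(x)$, $L_\xi(dx)=(-1)^{|\xi|}d(\xi(x))$,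 $i_\xi(x)=0$, $i_\xi(dx)=\xi(x)$; they induce operators on $DR^\bullet_{\mathrm{Lie}}(g)$ by the Leibniz rule. A diffeomorphism $\phi$ induces $\phi^*$ on forms. A homogeneous 2-form $\omega$ is symplectic if $d\omega=0$ and $\Phi:\mathrm{Der}(g)\to DR^1_{\mathrm{Lie}}(g)$, $\Phi(\xi)=i_\xi(\omega)$, is bijective. $\xi$ is symplectic if $L_\xi\omega=0$; $\phi$ is a symplectomorphism if $\phi^*\omega=\omega$. Frobenius algebras and cyclic Harrison cohomology. A strictly graded commutative Frobenius algebra $A=(V,m_2,\omega)$ consists of a free graded module $V$ of finite rank, a symplectic form $\omega\in DR^2_{\mathrm{Lie}}(\widehat L\Sigma V^* )$ of order zero and a symplectic vector field $m_2$ on $\widehat L\Sigma V^*$ of order 2 and degree one with $m_2^2=0$. $CC^\bullet_{\mathrm{Harr}}(A)=\Sigma DR^0_{\mathrm{Lie}}(\widehat L\Sigma V^* )$ with differential $L_{m_2}$; a 0-form has bidegree $(i,j)$ if it has order $i$ and degree $j$ in $\Sigma DR^0_{\mathrm{Lie}}$ (i.e. degree $j+1$ as a 0-form); $HC^{ij}_{\mathrm{Harr}}(A)$ is the bigraded cohomology. $\Upsilon_{\mathrm{Lie}}(\alpha):=(-1)^{|\alpha|}\Phi^{-1}(d\alpha)$ is an isomorphism from $CC^\bullet_{\mathrm{Harr}}(A)$ (suitably shifted by $|\omega|-2$) onto the complex of symplectic vector fields (with differential $[m_2,-]$, inside $\Sigma^{-1}\mathrm{Der}(\widehat L\Sigma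 V^* )$). Minimal symplectic $C_n$-structures ($n\ge3$). With $V$ free of finite rank and $\omega$ symplectic of order zero, these are symplectic vector fields $m=m_2+\dots+m_{n-1}$ on $\widehat L\Sigma V^*$ of degree one, $m_i$ of order $i$, with $m^2=0\mod(n+1)$. Two such $m,m'$ are equivalent if $\phi\circ m\circ\phi^{-1}=m'\mod(n)$ for a pointed symplectomorphism $\phi$ of degree zero. $\mathcal{SC}_n(A)$ is the set of minimal symplectic $C_n$-structures (with respect to $\omega$) with quadratic part the given $m_2$, modulo equivalence. $m$ is extendable if there is a symplectic vector field $m_n$ of order $n$ such that $m+m_n$ is a minimal symplectic $C_{n+1}$-structure. *)

(* Defs.v *)
From HB Require Import structures.
From mathcomp Require Import all_boot all_order all_algebra.
From mathcomp Require Import boolp classical_sets functions.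

Set Implicit Arguments.
Unset Strict Implicit.
Unset Printing Implicit Defensive.

Import Order.TTheory GRing.Theory Num.Theory.
Local Open Scope ring_scope.
Local Open Scope classical_set_scope.
Local Open Scope quotient_scope.

(** * The ground ring *)

Record evenRing := EvenRing {
  er_ring :> comAlgType rat;
  er_gr : int -> set er_ring;
  er_sub : forall i, er_gr i 0 /\
             forall x y, er_gr i x -> er_gr i y -> er_gr i (x - y);
  er_one : er_gr 0 1;
  er_mul : forall i j x y, er_gr i x -> er_gr j y -> er_gr (i + j) (x * y);
  er_span : forall x, exists (s : seq int) (c : int -> er_ring),
              (forall i, er_gr i (c i)) /\ x = \sum_(i <- s) c i;
  er_direct : forall (s : seq int) (c : int -> er_ring), uniq s ->
              (forall i, er_gr i (c i)) -> \sum_(i <- s) c i = 0 ->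
              forall i, i \in s -> c i = 0;
  er_even : forall i x, odd `|i|%N -> er_gr i x -> x = 0 }.

(** * Formal series on a graded set

   A graded set carries, for each element, its cohomological degree, its
   tensor degree in the generators, and its form degree.  The profinite
   module topologically spanned by [B] is the module [series B] of all
   functions [B -> K]; its topology is that of pointwise convergence. *)

Record gset := GSet {
  gcar :> choiceType;
  gdeg : gcar -> int;
  gwt : gcar -> nat;
  gfd : gcar -> nat }.

Definition words (B : gset) : gset :=
  @GSet (seq B) (fun w => \sum_(b <- w) gdeg b)
    (fun w => \sum_(b <- w) gwt b)%N (fun w => \sum_(b <- w) gfd b)%N.

Definition pairs (B C : gset) : gset :=
  @GSet (B * C)%type (fun p => gdeg p.1 + gdeg p.2)
    (fun p => gwt p.1 + gwt p.2)%N (fun p => gfd p.1 + gfd p.2)%N.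

Definition sums (B C : gset) : gset :=
  @GSet (B + C)%type
    (fun p => match p with inl b => gdeg b | inr c => gdeg c end)
    (fun p => match p with inl b => gwt b | inr c => gwt c end)
    (fun p => match p with inl b => gfd b | inr c => gfd c end).

(* (Sigma^-1 M)^i = M^(i-1); in the Lie de Rham complex the desuspension is
   applied to 1-forms, so the same shift counts the form degree. *)
Definition desusp (B : gset) : gset :=
  @GSet (gcar B) (fun b => gdeg b + 1) (@gwt B) (fun b => (gfd b).+1).

Section Series.
Variable K : evenRing.

Definition series (B : gset) : lmodType K := (gcar B -> (K : comAlgType rat)^o).

(* The Koszul sign (-1)^k. *)
Definition ksign (k : int) : K := (-1) ^+ `|k|%N.

Definition shomog (B : gset) (k : int) (x : series B) :=
  forall b, er_gr (k - gdeg b) (x b).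

Definition submod (M : lmodType K) (S : set M) :=
  S 0 /\ forall (a : K) x y, S x -> S y -> S (a *: x + y).

Definition sclosed (B : gset) (S : set (series B)) :=
  forall x, (forall F : seq B, exists2 y, S y & {in F, y =1 x}) -> S x.

(* The closed submodule spanned by [S], i.e. the set of all convergent
   linear combinations of elements of [S]. *)
Definition hspan (B : gset) (S : set (series B)) : set (series B) :=
  smallest (fun A => submod A /\ sclosed A) S.

Lemma hspan_submod (B : gset) (S : set (series B)) : submod (hspan S).
Proof.
split=> [A [[[A0 _] _] _]|a x y Sx Sy A HA]; first exact: A0.
by have [[[_ Al] _] _] := HA; apply: Al; [exact: Sx | exact: Sy].
Qed.

(** * Profinite modules

   A profinite module is presented as the quotient [pmem / prel] of a
   submodule of a module of series; [el P] is the quotient module. *)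

Record pmod := PMod {
  pidx : gset;
  pmem : set (series pidx);
  prel : set (series pidx);
  pmem_submod : submod pmem;
  prel_submod : submod prel }.

Section Elements.
Variable P : pmod.

Definition pmemb : {pred series (pidx P)} := fun x => `[< pmem x >].

Lemma pmemb_closed : submod_closed pmemb.
Proof.
have [m0 ml] := pmem_submod P; split; first exact/asboolP.
by move=> a x y /asboolP hx /asboolP hy; apply/asboolP; exact: ml.
Qed.

HB.instance Definition _ :=
  GRing.isSubmodClosed.Build K (series (pidx P)) pmemb pmemb_closed.

Record psub := PSub { psval : series (pidx P); _ : psval \in pmemb }.
HB.instance Definition _ := [isSub for psval].
HB.instance Definition _ := [Choice of psub by <:].
HB.instance Definition _ := [SubChoice_isSubLmodule of psub by <:].

Definition prelb : {pred psub} := fun x => `[< prel (val x) >].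

Lemma prelb_closed : submod_closed prelb.
Proof.
have [m0 ml] := prel_submod P; split; first exact/asboolP.
by move=> a x y /asboolP hx /asboolP hy; apply/asboolP; exact: ml.
Qed.

HB.instance Definition _ :=
  GRing.isSubmodClosed.Build K psub prelb prelb_closed.

Definition el : Type := (Quotient.quot prelb).
HB.instance Definition _ := GRing.Zmodule.on el.

Definition el_scale (a : K) (x : el) : el := \pi_(Quotient.quot prelb) (a *: repr x).

Lemma el_scale_pi (a : K) (x : psub) :
  el_scale a (\pi_(Quotient.quot prelb) x) = \pi_(Quotient.quot prelb) (a *: x).
Proof.
apply/eqP; rewrite /el_scale -Quotient.idealrBE -scalerBr rpredZ //.
by rewrite Quotient.idealrBE reprK.
Qed.

Lemma el_scalerA a b x : el_scale a (el_scale b x) = el_scale (a * b) x.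
Proof. by rewrite {2}/el_scale el_scale_pi scalerA. Qed.

Lemma el_scale1r x : el_scale 1 x = x.
Proof. by rewrite /el_scale scale1r reprK. Qed.

Lemma el_scalerDr : right_distributive el_scale +%R.
Proof.
move=> a x y; rewrite -[x]reprK -[y]reprK -[X in el_scale a X]raddfD.
by rewrite !el_scale_pi scalerDr raddfD.
Qed.

Lemma el_scalerDl x : {morph el_scale^~ x : a b / a + b}.
Proof. by move=> a b; rewrite /el_scale scalerDl raddfD. Qed.

HB.instance Definition _ := GRing.Zmodule_isLmodule.Build K el
  el_scalerA el_scale1r el_scalerDr el_scalerDl.

End Elements.
End Series.

Section Operations.
Variable K : evenRing.
Implicit Types P Q : pmod K.

(* [cls x] is the class of the series [x] (the class of 0 if [x] is not in
   [pmem P]); [rep x] is some series representing [x]. *)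
Definition cls (P : pmod K) (x : series K (pidx P)) : el P :=
  \pi_(Quotient.quot (@prelb K P)) (insubd (0 : psub P) x).
Arguments cls P x : clear implicits.

Definition rep P (x : el P) : series K (pidx P) := val (repr x).

Definition represents P (r : series K (pidx P)) (x : el P) :=
  pmem r /\ cls P r = x.

(* Homogeneous elements of cohomological degree [k].  As K has no elements of
   odd degree, these are supported on basis elements of the parity of [k]. *)
Definition homog P (k : int) (x : el P) :=
  exists2 r, represents r x & shomog k r.

Definition supported P (p : pred (pidx P)) (x : el P) :=
  exists2 r, represents r x & forall b, r b != 0 -> p b.

(* The image in [el P] of the basic neighbourhood of 0 given by [F]. *)
Definition near_zero P (F : seq (pidx P)) (x : el P) :=
  exists2 r, represents r x & {in F, forall b, r b = 0}.

Definition continuous_linear P Q (f : el P -> el Q) :=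
  linear f /\ forall F, exists F', forall x, near_zero F' x -> near_zero F (f x).

Definition has_degree P Q (k : int) (f : el P -> el Q) :=
  forall i x, homog i x -> homog (i + k) (f x).

(** * Tensor algebras and Lie algebras of profinite modules *)

Definition tens (B C : gset) (x : series K B) (y : series K C) :
  series K (pairs B C) := fun b => x b.1 * y b.2.

Definition pure (B : gset) (xs : seq (series K B)) : series K (words B) :=
  fun w => if size w == size xs then \prod_(p <- zip xs w) p.1 p.2 else 0.

Definition tmul (B : gset) (x y : series K (words B)) : series K (words B) :=
  fun w => \sum_(k < (size w).+1) x (take k w) * y (drop k w).

(* The part of even ([p = false]) or odd ([p = true]) degree. *)
Definition ppart (B : gset) (p : bool) (x : series K B) : series K B :=
  fun b => if odd `|gdeg b|%N == p then x b else 0.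

(* [(x, y) |-> (-1)^(|x||y|) f y x], extended bilinearly. *)
Definition gswap (B C D : gset) (f : series K C -> series K B -> series K D)
    (x : series K B) (y : series K C) : series K D :=
  \sum_(p : bool) \sum_(q : bool)
     (-1 : K) ^+ (p && q) *: f (ppart q y) (ppart p x).

Definition tcomm (B : gset) (x y : series K (words B)) : series K (words B) :=
  tmul x y - gswap (@tmul B) x y.

Inductive lie_monomial (B : gset) (S : set (series K B)) :
    series K (words B) -> Prop :=
| lie_gen x of S x : lie_monomial S (pure [:: x])
| lie_br u v of lie_monomial S u & lie_monomial S v :
    lie_monomial S (tcomm u v).

Definition free_pmod (B : gset) : pmod K :=
  @PMod K B (hspan setT) (hspan set0)
    (hspan_submod _) (hspan_submod _).

Definition tens_pmod P Q : pmod K :=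
  @PMod K (pairs (pidx P) (pidx Q))
    (hspan [set t | exists x y, [/\ pmem x, pmem y & t = tens x y]])
    (hspan [set t | exists x y,
        [/\ pmem x, pmem y, prel x \/ prel y & t = tens x y]])
    (hspan_submod _) (hspan_submod _).

Definition tensalg_pmod P : pmod K :=
  @PMod K (words (pidx P))
    (hspan [set t | exists2 xs, {in xs, forall x, pmem x} & t = pure xs])
    (hspan [set t | exists xs, [/\ {in xs, forall x, pmem x},
        exists2 x, x \in xs & prel x & t = pure xs]])
    (hspan_submod _) (hspan_submod _).

Lemma submodI (M : lmodType K) (S T : set M) :
  submod S -> submod T -> submod (S `&` T).
Proof.
move=> [S0 Sl] [T0 Tl]; split=> // a x y [Sx Tx] [Sy Ty].
by split; [exact: Sl | exact: Tl].
Qed.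

Definition lie_pmod P : pmod K :=
  @PMod K (words (pidx P))
    (hspan (lie_monomial (@pmem K P)))
    (hspan (lie_monomial (@pmem K P)) `&` @prel K (tensalg_pmod P))
    (hspan_submod _)
    (submodI (hspan_submod _) (@prel_submod K (tensalg_pmod P))).

Definition quot_pmod P (S : set (series K (pidx P))) : pmod K :=
  @PMod K (pidx P) (@pmem K P) (hspan (@prel K P `|` S))
    (@pmem_submod K P) (hspan_submod _).

Definition desusp_pmod P : pmod K :=
  @PMod K (desusp (pidx P)) (@pmem K P) (@prel K P)
    (@pmem_submod K P) (@prel_submod K P).

Definition linl (B C : gset) (x : series K (sums B C)) : series K B :=
  fun b => x (inl b).
Definition linr (B C : gset) (x : series K (sums B C)) : series K C :=
  fun c => x (inr c).
Definition copair (B C : gset) (x : series K B) (y : series K C) :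
  series K (sums B C) := fun b => match b with inl b => x b | inr c => y c end.

Definition both (B C : gset) (S : set (series K B)) (T : set (series K C)) :
  set (series K (sums B C)) := [set x | S (linl x) /\ T (linr x)].

Lemma both_submod (B C : gset) (S : set (series K B)) (T : set (series K C)) :
  submod S -> submod T -> submod (both S T).
Proof.
move=> [S0 Sl] [T0 Tl]; split=> [|a x y [Sx Tx] [Sy Ty]]; first by split.
by split; [exact: Sl | exact: Tl].
Qed.

Definition sum_pmod P Q : pmod K :=
  @PMod K (sums (pidx P) (pidx Q)) (both (@pmem K P) (@pmem K Q))
    (both (@prel K P) (@prel K Q))
    (both_submod (@pmem_submod K P) (@pmem_submod K Q))
    (both_submod (@prel_submod K P) (@prel_submod K Q)).

End Operations.
Arguments cls {K} P x.

(** * Graded Lie algebras, derivations and homomorphisms *)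

Record glie (K : evenRing) := GLie {
  gl_mod :> pmod K;
  gl_br : el gl_mod -> el gl_mod -> el gl_mod }.

Section LieMaps.
Variable K : evenRing.

Definition is_derivation (L : glie K) (k : int) (D : el L -> el L) :=
  [/\ continuous_linear D, has_degree k D &
      forall i x y, homog i x ->
        D (gl_br x y) = gl_br (D x) y + ksign K (k * i) *: gl_br x (D y)].

Definition lie_hom (L L' : glie K) (f : el L -> el L') :=
  continuous_linear f /\ forall x y, f (gl_br x y) = gl_br (f x) (f y).

End LieMaps.

(** * The Lie de Rham complex of the free Lie algebra on Sigma V^* *)

(* A free graded module of finite rank, given by the degrees of the elements
   of a homogeneous basis. *)
Record fgmod := FGMod { rk : nat; bdeg : 'I_rk -> int }.

(* (Sigma V)^i = V^(i+1). *)
Definition suspV (V : fgmod) := @FGMod (rk V) (fun i => bdeg i - 1).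
Definition dualV (V : fgmod) := @FGMod (rk V) (fun i => - bdeg i).

Definition basisV (V : fgmod) : gset :=
  @GSet 'I_(rk V) (@bdeg V) (fun=> 1%N) (fun=> 0%N).

Section DeRham.
Variables (K : evenRing) (V : fgmod).

Definition Wmod : pmod K := free_pmod K (basisV (dualV (suspV V))).

Definition Umod : pmod K := tensalg_pmod Wmod.

Definition gLie : glie K :=
  @GLie K (lie_pmod Wmod) (fun x y => cls (lie_pmod Wmod) (tcomm (rep x) (rep y))).

Notation g := (el gLie).

(* [tens x y] stands for [x (x) dy]. *)
Definition Omega1 : pmod K :=
  @quot_pmod K (tens_pmod Umod gLie)
    [set t | exists i j x y z,
       [/\ @pmem K Umod x, @pmem K gLie y /\ shomog i y,
           @pmem K gLie z /\ shomog j z &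
           t = tens x (tcomm y z) - tens (tmul x y) z
               + ksign K (i * j) *: tens (tmul x z) y]].

Definition LOmega1 : pmod K := lie_pmod (desusp_pmod Omega1).

(* The action of [y] in [g] on the tensor algebra of Sigma^-1 Omega^1 by
   derivations extending left multiplication on Omega^1: the summand
   (j, k) is the one in which the word [take k u] is multiplied onto
   the j-th factor s^-1(drop k u (x) dv).  The sign comes from moving that word
   past s^-1 (whence the [1 +]) and past the factors before the j-th one. *)
Definition lact (y : series K (pidx Umod)) (F : series K (pidx LOmega1)) :
  series K (pidx LOmega1) :=
  fun s => \sum_(j < size s)
    let: (u, v) := nth ([::], [::]) s j in
    \sum_(k < (size u).+1)
      ksign K (@gdeg (pidx Umod) (take k u)
               * (1 + @gdeg (pidx LOmega1) (take j s)))
      * y (take k u) * F (set_nth ([::], [::]) s j (drop k u, v)).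

(* The bracket of the semidirect product. *)
Definition Obr (x y : series K (pidx (sum_pmod gLie LOmega1))) :
  series K (pidx (sum_pmod gLie LOmega1)) :=
  copair (tcomm (linl x) (linl y))
    (tcomm (linr x) (linr y) + lact (linl x) (linr y)
     - gswap lact (linr x) (linl y)).

Definition Omega : glie K :=
  @GLie K (sum_pmod gLie LOmega1) (fun x y => cls (sum_pmod gLie LOmega1) (Obr (rep x) (rep y))).

Definition inO (y : g) : el Omega := cls Omega (copair (rep y) 0).

(* The 1-form 1 (x) dy. *)
Definition oneform (y : g) : el Omega :=
  cls Omega (copair 0
    (@pure K (pidx (desusp_pmod Omega1)) [:: tens (pure [::]) (rep y)])).

(* [xget] selects the unique operator with the stated defining properties; the
   same device defines the operators below. *)
Definition dO : el Omega -> el Omega :=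
  xget (fun=> 0) [set D | [/\ is_derivation (L := Omega) 1 D,
    forall y, D (inO y) = oneform y & forall x, D (D x) = 0]].

Definition LO (k : int) (xi : g -> g) : el Omega -> el Omega :=
  xget (fun=> 0) [set D | [/\ is_derivation (L := Omega) k D,
    forall x, D (inO x) = inO (xi x) &
    forall x, D (dO (inO x)) = ksign K k *: dO (inO (xi x))]].

Definition iO (k : int) (xi : g -> g) : el Omega -> el Omega :=
  xget (fun=> 0) [set D | [/\ is_derivation (L := Omega) (k - 1) D,
    forall x, D (inO x) = 0 & forall x, D (dO (inO x)) = inO (xi x)]].

Definition pullO (phi : g -> g) : el Omega -> el Omega :=
  xget (fun=> 0) [set f | [/\ lie_hom (L := Omega) (L' := Omega) f,
    forall x, f (inO x) = inO (phi x) & forall x, f (dO x) = dO (f x)]].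

Definition DRmod : pmod K :=
  @quot_pmod K (tens_pmod Omega Omega)
    ([set t | exists i j x y,
       [/\ @pmem K Omega x /\ shomog i x, @pmem K Omega y /\ shomog j y &
           t = tens x y - ksign K (i * j) *: tens y x]] `|`
     [set t | exists x y z,
       [/\ @pmem K Omega x, @pmem K Omega y, @pmem K Omega z &
           t = tens x (Obr y z) - tens (Obr x y) z]]).

Definition DR : lmodType K := el DRmod.

Definition drpair (x y : el Omega) : DR := cls DRmod (tens (rep x) (rep y)).

(* The operator on DR induced by a derivation of degree [k] of Omega. *)
Definition der_DR (k : int) (D : el Omega -> el Omega) : DR -> DR :=
  xget (fun=> 0) [set E | @continuous_linear K DRmod DRmod E /\
    forall i x y, homog i x ->
      E (drpair x y) = drpair (D x) y + ksign K (k * i) *: drpair x (D y)].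

Definition dDR : DR -> DR := der_DR 1 dO.
Definition LDR k xi : DR -> DR := der_DR k (LO k xi).
Definition iDR k xi : DR -> DR := der_DR (k - 1) (iO k xi).

Definition pullDR (phi : g -> g) : DR -> DR :=
  xget (fun=> 0) [set E | @continuous_linear K DRmod DRmod E /\
    forall x y, E (drpair x y) = drpair (pullO phi x) (pullO phi y)].

(* [form i k a]: [a] is an i-form of degree [k].  DR^i is the i-fold
   suspension of the part of form degree i, so that its elements of degree
   [k] have degree [k + i] in [DR]. *)
Definition is_form (i : nat) (k : int) (a : DR) :=
  @supported K DRmod (fun b => gfd b == i) a /\ @homog K DRmod (k + i%:Z) a.

(* The i-form [a] has order [o]. *)
Definition form_order (i o : nat) (a : DR) :=
  @supported K DRmod (fun b => gwt b == o + i)%N a.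

(** * Vector fields, diffeomorphisms and symplectic forms *)

Definition vfield (k : int) (xi : g -> g) := is_derivation (L := gLie) k xi.

Definition el_order (i : nat) (x : g) :=
  @supported K gLie (fun b => gwt b == i) x.

Definition has_order (n : nat) (f : g -> g) :=
  forall i j x, (j + 1 = i + n)%N -> el_order i x -> el_order j (f x).

(* The module (n) of continuous endomorphisms of order at least [n]. *)
Definition order_ge (n : nat) (f : g -> g) :=
  @continuous_linear K gLie gLie f /\
  forall i x, el_order i x ->
    @supported K gLie (fun b => i + n <= gwt b + 1)%N (f x).

Definition vcomm (k l : int) (xi eta : g -> g) : g -> g :=
  (xi \o eta) - ksign K (k * l) *: (eta \o xi).

Definition inverse_diffeos (phi psi : g -> g) :=
  [/\ lie_hom (L := gLie) (L' := gLie) phi,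
      lie_hom (L := gLie) (L' := gLie) psi, cancel phi psi & cancel psi phi].

Definition pointed (phi : g -> g) :=
  exists f : nat -> g -> g,
    (forall i, (2 <= i)%N ->
       @continuous_linear K gLie gLie (f i) /\ has_order i (f i)) /\
    forall (F : seq (pidx gLie)) x, exists N, forall M, (N <= M)%N ->
      @near_zero K gLie F (phi x - (x + \sum_(2 <= i < M) f i x)).

Definition symplectic_form (N : int) (om : DR) :=
  [/\ is_form 2 N om, dDR om = 0 &
      forall k, set_bij [set xi | vfield k xi] [set b | is_form 1 (k + N) b]
                        (fun xi => iDR k xi om)].

End DeRham.

(** * Frobenius algebras and cyclic Harrison cohomology *)

Record frobAlg (K : evenRing) := FrobAlg {
  fV : fgmod;
  fN : int; (* the degree of the form [fom] *)
  fom : DR K fV;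
  fm2 : el (gLie K fV) -> el (gLie K fV);
  fom_symplectic : symplectic_form fN fom;
  fom_order : form_order 2 0 fom;
  fm2_vfield : vfield 1 fm2;
  fm2_order : has_order 2 fm2;
  fm2_symplectic : LDR 1 fm2 fom = 0;
  fm2_square : forall x, fm2 (fm2 x) = 0 }.
Arguments fm2 {K} f _.

Section Obstruction.
Variables (K : evenRing) (A : frobAlg K).

Notation V := (fV A).
Notation g := (el (gLie K V)).
Notation vmap := (g -> g).
Notation N := (fN A).
Notation om := (fom A).

Definition symplectic_vfield (k : int) (xi : vmap) :=
  vfield k xi /\ LDR k xi om = 0.

Definition symplectic_map (phi : vmap) := pullDR phi om = om.

(* The inverse of Phi on 1-forms of degree [k + |om|]. *)
Definition Phi_inv (k : int) (b : DR K V) : vmap :=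
  xget (fun=> 0) [set xi | vfield k xi /\ iDR k xi om = b].

(* Upsilon on 0-forms of degree [k + |om|], with values in the vector fields
   of degree [k]; |a| is the degree of [a] as a 0-form. *)
Definition Upsilon (k : int) (a : DR K V) : vmap :=
  ksign K (k + N) *: Phi_inv k (dDR a).

Definition Upsilon_inv (k : int) (xi : vmap) : DR K V :=
  xget 0 [set a | is_form 0 (k + N) a /\ Upsilon k a = xi].

(* Cochains, cocycles and coboundaries of bidegree (i, j); the cyclic
   Harrison complex is the suspension of DR^0, whence the [j + 1]. *)
Definition CC (i : nat) (j : int) : set (DR K V) :=
  [set a | is_form 0 (j + 1) a /\ form_order 0 i a].

Definition HCocycle (i : nat) (j : int) : set (DR K V) :=
  [set a | CC i j a /\ LDR 1 (fm2 A) a = 0].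

Definition HCob (i : nat) (j : int) : set (DR K V) :=
  [set a | exists i' b, [/\ i = i'.+1, CC i' (j - 1) b &
                            LDR 1 (fm2 A) b = a]].

Definition hclass (i : nat) (j : int) (a : DR K V) : set (DR K V) :=
  [set a' | HCocycle i j a' /\ HCob i j (a' - a)].

Definition HC (i : nat) (j : int) : set (set (DR K V)) := hclass i j @` HCocycle i j.

(** * Minimal symplectic C_n-structures *)

(* A structure m = m_2 + ... + m_(n-1) is given by its components [m i]; the
   values of [m] outside 2 <= i < n play no role. *)
Definition cstr := nat -> vmap.

Definition csum (n : nat) (m : cstr) : vmap := \sum_(2 <= i < n) m i.

Definition Cn_structure (n : nat) (m : cstr) :=
  [/\ forall i, (2 <= i < n)%N -> vfield 1 (m i) /\ has_order i (m i),
      symplectic_vfield 1 (csum n m) &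
      order_ge n.+1 (csum n m \o csum n m)].

Definition Cn_equiv (n : nat) (m m' : cstr) :=
  exists phi psi : vmap,
    [/\ inverse_diffeos phi psi, pointed phi, symplectic_map phi,
        has_degree (P := gLie K V) (Q := gLie K V) 0 phi &
        order_ge n ((phi \o csum n m \o psi) - csum n m')].

(* The minimal symplectic C_n-structures with quadratic part that of [A]. *)
Definition Cn_over (n : nat) (m : cstr) := Cn_structure n m /\ m 2 = fm2 A.

Definition scclass (n : nat) (m : cstr) : set cstr :=
  [set m' | Cn_over n m' /\ Cn_equiv n m m'].

Definition SC (n : nat) : set (set cstr) := scclass n @` [set m | Cn_over n m].

Definition extend (n : nat) (m : cstr) (mn : vmap) : cstr :=
  fun i => if i == n then mn else m i.

Definition extendable (n : nat) (m : cstr) :=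
  exists mn : vmap, [/\ symplectic_vfield 1 mn, has_order n mn &
                        Cn_structure n.+1 (extend n m mn)].

Definition obs_field (n : nat) (m : cstr) : vmap :=
  \sum_(3 <= i < n) \sum_(3 <= j < n | (i + j == n + 2)%N)
     vcomm 1 1 (m i) (m j).

Definition Obs (n : nat) (m : cstr) : DR K V :=
  ((2^-1 : rat)%:A : K) *: Upsilon_inv 2 (obs_field n m).

End Obstruction.

Arguments CC {K} A _ _ _.
Arguments HCocycle {K} A _ _ _.
Arguments HCob {K} A _ _ _.
Arguments hclass {K} A _ _ _ _.
Arguments HC {K} A _ _ _.
Arguments SC {K} A _ _.
Arguments cstr {K} A.

(* Main.v *)
(** Grade everything by tensor weight.  As [om] has order zero and K contains
    the rationals, a vector field [xi] has order n exactly when the 1-form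
    i_xi(om) has weight n + 1, and it is symplectic exactly when this form is
    closed, hence (contract with the Euler field) the differential of a unique
    0-form.  For a C_n-structure m the lowest part of m o m, of order n + 1, is
    half the obstruction field; comparing m o (m o m) with (m o m) o m one
    weight further shows that it commutes with m_2, so that Obs(m) is a cocycle.
    Adding a component m_n changes this part by [m_2, m_n], whence the
    characterization of extendability.  If m'' is the conjugate of m by a pointed
    symplectomorphism and m'' = m' + u with u of order at least n, then m'' o m''
    and m o m have the same lowest part, while the lowest parts of m'' o m'' and
    m' o m' contract [om] to 1-forms whose difference is twice the Lie derivative
    along m_2 of the component of weight n + 1 of the closed form i_u(om).

    Weight, form degree and cohomological degree are all handled as eigenvalues of
    automorphisms which rescale the basis elements by powers of 2.  The operators
    on the de Rham complex are given by descriptions, with value 0 when nothing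
    fits; since Phi is injective, an operator for which this happened would force
    the Lie algebra to vanish.  Only the differential of DR is constructed, from a
    universal property of the completed tensor product. *)

Require Import Defs.
From HB Require Import structures.
From mathcomp Require Import all_boot all_order all_algebra.
From mathcomp Require Import ring zify.
From mathcomp Require Import boolp classical_sets functions.

Set Implicit Arguments.
Unset Strict Implicit.
Unset Printing Implicit Defensive.

Import Order.TTheory GRing.Theory Num.Theory.
Local Open Scope ring_scope.
Local Open Scope classical_set_scope.
Local Open Scope quotient_scope.

(** * The ground ring *)

(** Every module is a quotient of a space of series, so a class has no preferred representative
    adapted to a grading, and K is a general commutative rational algebra, over which bases cannot
    simply be chosen. Gradings are therefore read off from operators that descend to the quotient.
    Near 0 a spectral projection of such an operator is a polynomial in it, by rational
    interpolation at the finitely many eigenvalues involved; it respects the relations because these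
    are closed. Powers of 2 serve because they are pairwise distinct. Identities pass from
    homogeneous elements to all elements by density, which requires the Koszul sign itself to be a
    continuous operator; as K is even, the parity of a homogeneous element is visible on the basis.
    A contraction is never built: where its description failed, the default 0 would give i_xi(om) =
    0 = i_0(om), so xi = 0, and the zero field does have a contraction. Phi does not involve the
    differential of DR, so its injectivity says nothing about that operator, which has to be
    constructed; the construction needs generators with rational coefficients, finitely many
    coordinates in each weight. *)

Section GroundRing.
Variable K : evenRing.
Implicit Types (x y : K) (i j : int) (q : rat).

Definition qk : rat -> K := GRing.in_alg K.
HB.instance Definition _ := GRing.RMorphism.on qk.

Lemma qkVK q x : q != 0 -> qk q^-1 * (qk q * x) = x.
Proof. by move=> q0; rewrite mulrA -rmorphM /= mulVf // rmorph1 mul1r. Qed.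

Lemma er_gr0 i : er_gr i (0 : K).
Proof. by case: (er_sub K i). Qed.

Lemma er_grB i x y : er_gr i x -> er_gr i y -> er_gr i (x - y).
Proof. by case: (er_sub K i) => _; apply. Qed.

Lemma er_grN i x : er_gr i x -> er_gr i (- x).
Proof. by move=> h; rewrite -sub0r; apply: er_grB => //; exact: er_gr0. Qed.

Lemma er_grD i x y : er_gr i x -> er_gr i y -> er_gr i (x + y).
Proof. by move=> hx hy; rewrite -[y]opprK; apply: er_grB => //; exact: er_grN. Qed.

Lemma er_gr_sum i (I : Type) (r : seq I) (P : pred I) (F : I -> K) :
  (forall k, P k -> er_gr i (F k)) -> er_gr i (\sum_(k <- r | P k) F k).
Proof. by move=> h; elim/big_ind: _ => //; [exact: er_gr0 | exact: er_grD]. Qed.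

Lemma kdec x : exists f : int -> K, exists s : seq int,
  [/\ uniq s, forall i, er_gr i (f i), forall i, i \notin s -> f i = 0 &
      x = \sum_(i <- s) f i].
Proof.
have [s [c [hc ->]]] := er_span x.
(* The spanning axiom allows the same degree to occur several times in [s]; equal degrees are
   collected into one component. *)
exists (fun i => \sum_(j <- s | j == i) c j), (undup s); split.
- exact: undup_uniq.
- by move=> i; apply: er_gr_sum => k /eqP ->.
- move=> i; rewrite mem_undup => his; apply: big1_seq => j /andP[/eqP -> hj].
  by rewrite hj in his.
- rewrite (exchange_big_dep xpredT) //= big_seq [RHS]big_seq.
  apply: eq_bigr => j js; rewrite (eq_bigl (pred1 j)) => [|k]; last exact: eq_sym.
  by rewrite -big_filter filter_pred1_uniq ?undup_uniq ?mem_undup // big_seq1.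
Qed.

Lemma big_extend (s t : seq int) (f : int -> K) :
  uniq s -> uniq t -> {subset s <= t} -> (forall i, i \notin s -> f i = 0) ->
  \sum_(i <- s) f i = \sum_(i <- t) f i.
Proof.
move=> us ut st f0; rewrite [RHS](bigID (mem s)) /= [X in _ + X]big1 ?addr0; last first.
  by move=> i; exact: f0.
rewrite -[RHS]big_filter; apply: perm_big; apply: uniq_perm => //; first exact: filter_uniq.
move=> i; rewrite mem_filter /=; case: (boolP (i \in s)) => //= h.
by rewrite st.
Qed.

Lemma kdec_uniq (f f' : int -> K) (s s' : seq int) :
  uniq s -> uniq s' ->
  (forall i, er_gr i (f i)) -> (forall i, er_gr i (f' i)) ->
  (forall i, i \notin s -> f i = 0) -> (forall i, i \notin s' -> f' i = 0) ->
  \sum_(i <- s) f i = \sum_(i <- s') f' i -> f = f'.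
Proof.
move=> us us' gf gf' f0 f0' e; apply: funext => i; apply/eqP; rewrite -subr_eq0; apply/eqP.
set t := undup (s ++ s').
have ut : uniq t by exact: undup_uniq.
have e1 : \sum_(j <- t) (f j - f' j) = 0.
  rewrite big_split /= sumrN -(big_extend us ut) //; last first.
    by move=> j js; rewrite mem_undup mem_cat js.
  rewrite -(big_extend us' ut) //; last by move=> j js; rewrite mem_undup mem_cat js orbT.
  by rewrite e subrr.
have [it|] := boolP (i \in t).
  apply: (er_direct ut _ e1 it) => j; exact: er_grB.
rewrite mem_undup mem_cat negb_or => /andP[h1 h2].
by rewrite f0 // f0' // subrr.
Qed.

Definition kcomp x : int -> K := projT1 (cid (kdec x)).
Definition ksupp x : seq int := projT1 (cid (projT2 (cid (kdec x)))).

Lemma kcompP x : [/\ uniq (ksupp x), forall i, er_gr i (kcomp x i),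
  forall i, i \notin ksupp x -> kcomp x i = 0 &
  x = \sum_(i <- ksupp x) kcomp x i].
Proof. exact: (projT2 (cid (projT2 (cid (kdec x))))). Qed.

Lemma kcomp_eq x (f : int -> K) s : uniq s -> (forall i, er_gr i (f i)) ->
  (forall i, i \notin s -> f i = 0) -> x = \sum_(i <- s) f i -> kcomp x = f.
Proof.
move=> us gf f0 e; have [u1 u2 u3 u4] := kcompP x.
by apply: (kdec_uniq u1 us) => //; rewrite -u4.
Qed.

Lemma kcomp_homog i x : er_gr i x -> kcomp x = fun j => if j == i then x else 0.
Proof.
move=> gx; apply: (@kcomp_eq _ _ [:: i]) => //.
- by move=> j; case: eqP => [->|_] //; exact: er_gr0.
- by move=> j; rewrite inE => /negbTE ->.
- by rewrite big_seq1 eqxx.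
Qed.

Lemma kcompD x y i : kcomp (x + y) i = kcomp x i + kcomp y i.
Proof.
have [u1 u2 u3 u4] := kcompP x; have [v1 v2 v3 v4] := kcompP y.
set t := undup (ksupp x ++ ksupp y).
have ut : uniq t by exact: undup_uniq.
rewrite (@kcomp_eq _ (fun i => kcomp x i + kcomp y i) t) //.
- by move=> j; exact: er_grD.
- by move=> j; rewrite mem_undup mem_cat negb_or => /andP[h1 h2]; rewrite u3 // v3 // addr0.
- rewrite big_split /= -(big_extend u1 ut) //; last first.
    by move=> j js; rewrite mem_undup mem_cat js.
  rewrite -(big_extend v1 ut) //; last by move=> j js; rewrite mem_undup mem_cat js orbT.
  by rewrite -u4 -v4.
Qed.

Lemma kcomp0 i : kcomp 0 i = 0.
Proof. by rewrite (kcomp_homog (er_gr0 i)); case: ifP. Qed.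

Lemma kcompN x i : kcomp (- x) i = - kcomp x i.
Proof. by apply: (addrI (kcomp x i)); rewrite -kcompD !subrr kcomp0. Qed.

Lemma kcompB x y i : kcomp (x - y) i = kcomp x i - kcomp y i.
Proof. by rewrite kcompD kcompN. Qed.

Lemma kcompZ i q x : kcomp (qk q * x) i = qk q * kcomp x i.
Proof.
have e (z : K) : qk q * z = q *: z by rewrite /qk /GRing.in_alg /= mulr_algl.
rewrite !e.
exact: (@rat_linear K K (fun z => kcomp z i) (fun a b => kcompB a b i)).
Qed.

Lemma er_gr_kcomp i x : er_gr i x <-> kcomp x i = x.
Proof.
split=> [h|<-]; first by rewrite (kcomp_homog h) eqxx.
by have [_ h _ _] := kcompP x.
Qed.

Lemma er_gr_qk i q x : er_gr i x -> er_gr i (qk q * x).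
Proof. by rewrite !er_gr_kcomp kcompZ => ->. Qed.

Lemma er_gr_odd i x : er_gr i x -> x != 0 -> odd `|i|%N = false.
Proof.
move=> h; apply: contra_neqF => oi; exact: er_even oi h.
Qed.

(** The ring endomorphism of K whose eigenspaces are the graded pieces, with eigenvalue 2^i in
    degree i. It is the coefficient part of the rescaling that detects cohomological degree. *)
Definition ktau x : K := \sum_(i <- ksupp x) qk (2%:R ^ i) * kcomp x i.

Lemma ktauE x s : uniq s -> (forall i, i \notin s -> kcomp x i = 0) ->
  ktau x = \sum_(i <- s) qk (2%:R ^ i) * kcomp x i.
Proof.
move=> us s0; have [u1 u2 u3 u4] := kcompP x.
set t := undup (ksupp x ++ s); have ut : uniq t by exact: undup_uniq.
rewrite /ktau (big_extend u1 ut) => [|j js|i /u3 ->]; last by rewrite mulr0.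
  rewrite (big_extend us ut) // => [j js|i /s0 ->]; last by rewrite mulr0.
  by rewrite mem_undup mem_cat js orbT.
by rewrite mem_undup mem_cat js.
Qed.

Lemma ktau_homog i x : er_gr i x -> ktau x = qk (2%:R ^ i) * x.
Proof.
move=> gx; rewrite (@ktauE _ [:: i]) //.
  by rewrite big_seq1 (kcomp_homog gx) eqxx.
by move=> j; rewrite inE (kcomp_homog gx) => /negbTE ->.
Qed.

Lemma ktau_zmod : zmod_morphism ktau.
Proof.
move=> x y; have [u1 u2 u3 u4] := kcompP x; have [v1 v2 v3 v4] := kcompP y.
set t := undup (ksupp x ++ ksupp y).
have ut : uniq t by exact: undup_uniq.
have tx i : i \notin t -> kcomp x i = 0.
  by rewrite mem_undup mem_cat negb_or => /andP[h1 h2]; rewrite u3.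
have ty i : i \notin t -> kcomp y i = 0.
  by rewrite mem_undup mem_cat negb_or => /andP[h1 h2]; rewrite v3.
rewrite (ktauE ut tx) (ktauE ut ty) (@ktauE _ t) //.
  by rewrite -sumrB; apply: eq_bigr => i _; rewrite kcompB mulrBr.
by move=> i it; rewrite kcompB tx // ty // subrr.
Qed.

HB.instance Definition _ := GRing.isZmodMorphism.Build K K ktau ktau_zmod.

Lemma ktau_monoid : monoid_morphism ktau.
Proof.
split; first by rewrite (ktau_homog (@er_one K)) expr0z rmorph1 mul1r.
move=> x y; have [_ u2 _ ->] := kcompP x; have [_ v2 _ ->] := kcompP y.
rewrite mulr_suml !raddf_sum /= mulr_suml; apply: eq_bigr => i _.
rewrite mulr_sumr !raddf_sum /= mulr_sumr; apply: eq_bigr => j _.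
rewrite (ktau_homog (er_mul (u2 i) (v2 j))) (ktau_homog (u2 i)) (ktau_homog (v2 j)).
by rewrite expfzDr // rmorphM /= mulrACA.
Qed.

HB.instance Definition _ := GRing.isMonoidMorphism.Build K K ktau ktau_monoid.

End GroundRing.

(** * Row-finite maps and closed submodules *)

Section RowFinite.
Variable K : evenRing.
Implicit Types B C D : gset.

(** The continuous linear functionals on [series K B] for pointwise convergence and discrete K.
    Accordingly [rfin] describes the continuous linear maps of series and [bifin] the separately
    continuous bilinear ones. *)
Definition ffl B (phi : series K B -> K) :=
  (forall a x y, phi (a *: x + y) = a * phi x + phi y) /\
  exists F : seq B, forall x, {in F, forall b, x b = 0} -> phi x = 0.

Definition rfin B C (f : series K B -> series K C) :=
  forall c, ffl (fun x => f x c).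

Definition bifin B C D (m : series K B -> series K C -> series K D) :=
  (forall x, rfin (m x)) /\ (forall y, rfin (m^~ y)).

Lemma ffl_ev B (b : B) : ffl (fun x : series K B => x b).
Proof. by split=> //; exists [:: b] => x h; apply: h; rewrite inE. Qed.

Lemma ffl_mull B (k : K) phi : @ffl B phi -> ffl (fun x => k * phi x).
Proof.
move=> [l [F hF]]; split; last by exists F => x /hF ->; rewrite mulr0.
by move=> a x y; rewrite l mulrDr mulrCA.
Qed.

Lemma ffl_mulr B (k : K) phi : @ffl B phi -> ffl (fun x => phi x * k).
Proof.
move=> [l [F hF]]; split; last by exists F => x /hF ->; rewrite mul0r.
by move=> a x y; rewrite l mulrDl mulrA.
Qed.

Lemma ffl_cst0 B : @ffl B (fun=> 0).
Proof. by split=> [a x y|]; [rewrite mulr0 addr0 | exists [::]]. Qed.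

Lemma ffl_add B phi psi : @ffl B phi -> ffl psi -> ffl (fun x => phi x + psi x).
Proof.
move=> [l [F hF]] [l' [F' hF']]; split=> [a x y|].
  by rewrite l l' mulrDr addrACA.
exists (F ++ F') => x h; rewrite hF ?hF' ?addr0 // => b bF; apply: h;
  by rewrite mem_cat bF ?orbT.
Qed.

Lemma ffl_opp B phi : @ffl B phi -> ffl (fun x => - phi x).
Proof.
move=> h; have /= := ffl_mull (-1) h.
by congr ffl; apply: funext => x; rewrite mulN1r.
Qed.

Lemma ffl_sum B (I : Type) (r : seq I) (P : pred I) (phi : I -> series K B -> K) :
  (forall i, P i -> ffl (phi i)) -> ffl (fun x => \sum_(i <- r | P i) phi i x).
Proof.
move=> h; elim: r => [|i r IH].
  by rewrite [X in ffl X](_ : _ = fun=> 0); [exact: ffl_cst0 | apply: funext => x; rewrite big_nil].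
case: (boolP (P i)) => Pi.
  rewrite [X in ffl X](_ : _ = fun x => phi i x + \sum_(j <- r | P j) phi j x).
    by apply: ffl_add => //; exact: h.
  by apply: funext => x; rewrite big_cons Pi.
rewrite [X in ffl X](_ : _ = fun x => \sum_(j <- r | P j) phi j x) //.
by apply: funext => x; rewrite big_cons (negbTE Pi).
Qed.

Lemma ffl_if B (b : bool) phi psi : @ffl B phi -> ffl psi ->
  ffl (fun x => if b then phi x else psi x).
Proof. by case: b. Qed.

Section RfinSeq.
Variables (B C : gset) (f : series K B -> series K C).
Hypothesis hf : rfin f.

Lemma rfin_lin : linear f.
Proof. by move=> a x y; apply: funext => c; case: (hf c) => ->. Qed.

Lemma rfin_nbhs (G : seq C) : exists F : seq B, forall x,
  {in F, forall b, x b = 0} -> {in G, forall c, f x c = 0}.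
Proof.
elim: G => [|c G [F hF]]; first by exists [::].
have [_ [F' hF']] := hf c; exists (F' ++ F) => x h c'.
rewrite inE => /predU1P[->|cG].
  by apply: hF' => b bF; apply: h; rewrite mem_cat bF.
by apply: hF cG => b bF; apply: h; rewrite mem_cat bF orbT.
Qed.

Lemma rfinD x y : f (x + y) = f x + f y.
Proof. by rewrite -[x]scale1r rfin_lin !scale1r. Qed.
Lemma rfin0 : f 0 = 0.
Proof. by apply: (addIr (f 0)); rewrite -rfinD !add0r. Qed.
Lemma rfinZ a x : f (a *: x) = a *: f x.
Proof. by rewrite -[a *: x]addr0 rfin_lin rfin0 addr0. Qed.
Lemma rfinN x : f (- x) = - f x.
Proof. by rewrite -scaleN1r rfinZ scaleN1r. Qed.
Lemma rfinB x y : f (x - y) = f x - f y.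
Proof. by rewrite rfinD rfinN. Qed.
Lemma rfin_sum (I : Type) (r : seq I) (P : pred I) (F : I -> series K B) :
  f (\sum_(i <- r | P i) F i) = \sum_(i <- r | P i) f (F i).
Proof.
elim/big_rec2: _ => [|i x y _ <-]; first exact: rfin0.
by rewrite rfinD.
Qed.

End RfinSeq.

Lemma ffl_comp B C (f : series K B -> series K C) phi :
  rfin f -> ffl phi -> ffl (phi \o f).
Proof.
move=> hf [l [G hG]]; split=> [a x y|] /=; first by rewrite (rfin_lin hf) l.
by have [F hF] := rfin_nbhs hf G; exists F => x /hF/hG.
Qed.

Lemma rfin_comp B C D (f : series K B -> series K C) (h : series K C -> series K D) :
  rfin f -> rfin h -> rfin (h \o f).
Proof. by move=> hf hh d; exact: (ffl_comp hf (hh d)). Qed.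

Lemma rfin_id B : rfin (@id (series K B)).
Proof. by move=> c; exact: ffl_ev. Qed.

Lemma rfin_cst0 B C : rfin (fun _ : series K B => (0 : series K C)).
Proof. by move=> c; exact: ffl_cst0. Qed.

Lemma rfin_add B C (f h : series K B -> series K C) :
  rfin f -> rfin h -> rfin (fun x => f x + h x).
Proof. by move=> hf hh c; apply: ffl_add; [exact: hf | exact: hh]. Qed.

Lemma rfin_opp B C (f : series K B -> series K C) : rfin f -> rfin (fun x => - f x).
Proof. by move=> hf c; apply: ffl_opp; exact: hf. Qed.

Lemma rfin_scale B C (a : K) (f : series K B -> series K C) :
  rfin f -> rfin (fun x => a *: f x).
Proof. by move=> hf c; apply: ffl_mull; exact: hf. Qed.

Lemma rfin_sub B C (f h : series K B -> series K C) :
  rfin f -> rfin h -> rfin (fun x => f x - h x).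
Proof. by move=> hf hh; apply: rfin_add => //; exact: rfin_opp. Qed.

Lemma series_sumE B (I : Type) (r : seq I) (P : pred I) (F : I -> series K B) b :
  (\sum_(i <- r | P i) F i) b = \sum_(i <- r | P i) F i b.
Proof. by elim/big_rec2: _ => [|i x y _ <-] //. Qed.

Lemma rfin_bigsum B C (I : Type) (r : seq I) (P : pred I)
    (f : I -> series K B -> series K C) :
  (forall i, P i -> rfin (f i)) -> rfin (fun x => \sum_(i <- r | P i) f i x).
Proof.
move=> hf c; rewrite [X in ffl X](_ : _ = fun x => \sum_(i <- r | P i) f i x c).
  by apply: ffl_sum => i Pi; exact: hf.
by apply: funext => x; rewrite series_sumE.
Qed.

Lemma bifin_comp2 B C D B' C' (m : series K B -> series K C -> series K D)
    (f : series K B' -> series K B) (h : series K C' -> series K C) :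
  bifin m -> rfin f -> rfin h -> bifin (fun x y => m (f x) (h y)).
Proof.
move=> [m1 m2] hf hh; split=> z.
  exact: (rfin_comp hh (m1 (f z))).
exact: (rfin_comp hf (m2 (h z))).
Qed.

Lemma bifin_add B C D (m m' : series K B -> series K C -> series K D) :
  bifin m -> bifin m' -> bifin (fun x y => m x y + m' x y).
Proof.
by move=> [m1 m2] [n1 n2]; split=> z; apply: rfin_add.
Qed.

Lemma bifin_scale B C D a (m : series K B -> series K C -> series K D) :
  bifin m -> bifin (fun x y => a *: m x y).
Proof. by move=> [m1 m2]; split=> z; apply: rfin_scale. Qed.

Lemma bifin_sub B C D (m m' : series K B -> series K C -> series K D) :
  bifin m -> bifin m' -> bifin (fun x y => m x y - m' x y).
Proof. by move=> [m1 m2] [n1 n2]; split=> z; apply: rfin_sub. Qed.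

Lemma bifin_sum B C D (I : Type) (r : seq I) (P : pred I)
   (m : I -> series K B -> series K C -> series K D) :
  (forall i, bifin (m i)) -> bifin (fun x y => \sum_(i <- r | P i) m i x y).
Proof. by move=> h; split=> z; apply: rfin_bigsum => i _; case: (h i). Qed.

Lemma bifin_swap B C D (m : series K B -> series K C -> series K D) :
  bifin m -> bifin (fun y x => m x y).
Proof. by case. Qed.

Lemma submodD (M : lmodType K) (S : set M) x y : submod S -> S x -> S y -> S (x + y).
Proof. by move=> [_ h] Sx Sy; rewrite -[x]scale1r; exact: h. Qed.
Lemma submodZ (M : lmodType K) (S : set M) a x : submod S -> S x -> S (a *: x).
Proof. by move=> [h0 h] Sx; rewrite -[a *: x]addr0; exact: h. Qed.
Lemma submodN (M : lmodType K) (S : set M) x : submod S -> S x -> S (- x).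
Proof. by move=> h Sx; rewrite -scaleN1r; exact: submodZ. Qed.
Lemma submodB (M : lmodType K) (S : set M) x y : submod S -> S x -> S y -> S (x - y).
Proof. by move=> h Sx Sy; apply: submodD => //; exact: submodN. Qed.
Lemma submod_sum (M : lmodType K) (S : set M) (I : eqType) (r : seq I) (P : pred I) (F : I -> M) :
  submod S -> (forall i, i \in r -> P i -> S (F i)) -> S (\sum_(i <- r | P i) F i).
Proof.
move=> h hF; rewrite big_seq_cond; elim/big_ind: _; first by case: h.
- by move=> *; exact: submodD.
- by move=> i /andP[]; exact: hF.
Qed.

Lemma sub_hspan B (S : set (series K B)) : S `<=` hspan S.
Proof. by move=> x Sx A [_ hA]; exact: hA. Qed.

Lemma hspan_sclosed B (S : set (series K B)) : sclosed (hspan S).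
Proof.
move=> x h A hA; have [[mA cA] SA] := hA; apply: cA => F.
have [y hy e] := h F; exists y => //; exact: (hy A hA).
Qed.

Lemma hspan_min B (S A : set (series K B)) :
  submod A -> sclosed A -> S `<=` A -> hspan S `<=` A.
Proof. by move=> mA cA SA x; apply. Qed.

(** Finitely many coordinates of [f x] depend on finitely many coordinates of [x], so an
    approximation of [x] yields one of [f x]. *)
Lemma sclosed_preim B C (f : series K B -> series K C) H :
  rfin f -> sclosed H -> sclosed [set x | H (f x)].
Proof.
move=> hf cH x h; apply: cH => G; have [F hF] := rfin_nbhs hf G.
have [y Hy e] := h F; exists (f y) => // c cG.
have hyx : {in F, forall b, (y - x) b = 0}.
  by move=> b bF; rewrite -[LHS]/(y b - x b) e // subrr.
have := hF _ hyx c cG; rewrite (rfinB hf) -[LHS]/(f y c - f x c).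
by move/eqP; rewrite subr_eq0 => /eqP.
Qed.

Lemma submod_preim B C (f : series K B -> series K C) H :
  rfin f -> submod H -> submod [set x | H (f x)].
Proof.
move=> hf [H0 Hl]; split=> [|a x y] /=; first by rewrite (rfin0 hf).
by move=> hx hy; rewrite (rfin_lin hf); exact: Hl.
Qed.

Lemma hspan_map B C (f : series K B -> series K C) S H :
  rfin f -> submod H -> sclosed H -> (forall x, S x -> H (f x)) ->
  forall x, hspan S x -> H (f x).
Proof.
move=> hf mH cH SH; apply: (@hspan_min _ S [set x | H (f x)]) => //.
- exact: submod_preim.
- exact: sclosed_preim.
Qed.

(** Separate continuity suffices: one argument is fixed while the other runs through a closed span,
    then the roles are exchanged. *)
Lemma hspan_bilin B C D (m : series K B -> series K C -> series K D) S T H :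
  bifin m -> submod H -> sclosed H -> (forall x y, S x -> T y -> H (m x y)) ->
  forall x y, hspan S x -> hspan T y -> H (m x y).
Proof.
move=> [m1 m2] mH cH h x y hx hy.
apply: (hspan_map (m2 y) mH cH _ hx) => x' Sx'.
by apply: (hspan_map (m1 x') mH cH _ hy) => y' Ty'; exact: h.
Qed.

Lemma sclosedI B (S T : set (series K B)) : sclosed S -> sclosed T -> sclosed (S `&` T).
Proof.
move=> cS cT x h; split; [apply: cS | apply: cT] => F;
  by have [y [Sy Ty] e] := h F; exists y.
Qed.

Lemma hspan0 B (x : series K B) : hspan set0 x -> x = 0.
Proof.
apply: (@hspan_min _ set0 [set x | x = 0]) => //.
- by split=> // a y z -> ->; rewrite scaler0 addr0.
- move=> y h; apply: funext => b; have [z -> e] := h [:: b].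
  by rewrite -e ?inE.
Qed.

Lemma hspan_0 B (S : set (series K B)) : hspan S 0.
Proof. by case: (hspan_submod S). Qed.

Lemma tens_bifin B C : bifin (@tens K B C).
Proof.
split=> z c; rewrite /tens.
  by apply: ffl_mull; exact: ffl_ev.
by apply: ffl_mulr; exact: ffl_ev.
Qed.

Lemma tmul_bifin B : bifin (@tmul K B).
Proof.
split=> z w; rewrite /tmul; apply: ffl_sum => k _.
  by apply: ffl_mull; exact: (@ffl_ev (words B)).
by apply: ffl_mulr; exact: (@ffl_ev (words B)).
Qed.

Lemma ppart_rfin B p : rfin (@ppart K B p).
Proof.
move=> b; rewrite /ppart; apply: ffl_if; [exact: ffl_ev | exact: ffl_cst0].
Qed.

Lemma gswap_bifin B C D (m : series K C -> series K B -> series K D) :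
  bifin m -> bifin (gswap m).
Proof.
move=> hm; apply: bifin_sum => p; apply: bifin_sum => q; apply: bifin_scale.
apply: bifin_swap; apply: bifin_comp2 => //; exact: ppart_rfin.
Qed.

Lemma tcomm_bifin B : bifin (@tcomm K B).
Proof.
by apply: bifin_sub; [exact: tmul_bifin | apply: gswap_bifin; exact: tmul_bifin].
Qed.

Lemma linl_rfin B C : rfin (@linl K B C).
Proof. by move=> b; exact: (@ffl_ev (sums B C)). Qed.
Lemma linr_rfin B C : rfin (@linr K B C).
Proof. by move=> b; exact: (@ffl_ev (sums B C)). Qed.
Lemma copair_l_rfin B C : rfin (fun x : series K B => copair x (0 : series K C)).
Proof. by move=> [b|c] /=; [exact: ffl_ev | exact: ffl_cst0]. Qed.
Lemma copair_r_rfin B C : rfin (fun y : series K C => copair (0 : series K B) y).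
Proof. by move=> [b|c] /=; [exact: ffl_cst0 | exact: ffl_ev]. Qed.

Lemma copairE B C (x : series K B) (y : series K C) :
  copair x y = copair x 0 + copair 0 y.
Proof. by apply: funext => -[b|c]; rewrite -[RHS]/(_ + _) /= ?addr0 ?add0r. Qed.

Lemma linK B C (x : series K (sums B C)) : copair (linl x) (linr x) = x.
Proof. by apply: funext => -[b|c]. Qed.

(** Left tensoring by a single factor. It gives [pure] a recursive form, so that statements on the
    completed tensor algebra can be proved by induction on the list of factors. *)
Definition tcons B (x : series K B) (F : series K (words B)) : series K (words B) :=
  fun w => if w is b :: w' then x b * F w' else 0.

Lemma tcons_bifin B : bifin (@tcons B).
Proof.
split=> z [|b w] /=; try exact: ffl_cst0.
  by apply: ffl_mull; exact: (@ffl_ev (words B)).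
by apply: ffl_mulr; exact: ffl_ev.
Qed.

Lemma pure_nil B (w : seq B) : (pure [::] : series K (words B)) w = (w == [::])%:R.
Proof. by rewrite /pure; case: w => //=; rewrite big_nil. Qed.

Lemma pure_cons B (x : series K B) xs : pure (x :: xs) = tcons x (pure xs).
Proof.
apply: funext => -[|b w] //; rewrite /pure /= eqSS; case: ifP => // _.
  by rewrite big_cons.
by rewrite mulr0.
Qed.

Lemma tmul_one B (x : series K (words B)) : tmul (pure [::]) x = x.
Proof.
apply: funext => w; rewrite /tmul big_ord_recl /= take0 drop0 pure_nil eqxx mul1r.
rewrite big1 ?addr0 // => i _; rewrite pure_nil; case: w i => [[]//|b w i] /=.
by rewrite mul0r.
Qed.

Lemma tmul_cons B (x : series K B) F G : tmul (tcons x F) G = tcons x (tmul F G).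
Proof.
apply: funext => -[|b w]; rewrite /tmul.
  by rewrite big_ord1 mul0r.
rewrite big_ord_recl /= mul0r add0r mulr_sumr; apply: eq_bigr => i _.
by rewrite mulrA.
Qed.

Lemma tmul_pure B (xs ys : seq (series K B)) :
  tmul (pure xs) (pure ys) = pure (xs ++ ys).
Proof.
elim: xs => [|x xs IH] /=; first exact: tmul_one.
by rewrite !pure_cons tmul_cons IH.
Qed.

End RowFinite.

(** * The topology of quotient modules *)

Section Elements.
Variable K : evenRing.
Implicit Types P Q R : pmod K.

Lemma val_insub P (x : series K (pidx P)) : pmem x ->
  val (insubd (0 : psub P) x) = x.
Proof. by move=> hx; rewrite insubdK //; apply/asboolP. Qed.

Lemma cls_eq P (x y : series K (pidx P)) : pmem x -> pmem y ->
  (cls P x = cls P y <-> prel (x - y)).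
Proof.
move=> hx hy; rewrite /cls; split.
  move/eqP; rewrite -Quotient.idealrBE => /asboolP.
  by rewrite raddfB /= !val_insub.
move=> h; apply/eqP; rewrite -Quotient.idealrBE; apply/asboolP.
by rewrite raddfB /= !val_insub.
Qed.

Lemma cls_lin P a (x y : series K (pidx P)) : pmem x -> pmem y ->
  cls P (a *: x + y) = a *: cls P x + cls P y.
Proof.
move=> hx hy; have hxy : pmem (a *: x + y) by case: (pmem_submod P) => _; apply.
have e u : a *: (\pi_(Quotient.quot (@prelb K P)) u : el P) =
    \pi_(Quotient.quot (@prelb K P)) (a *: u) by exact: el_scale_pi.
rewrite /cls e -[RHS]raddfD; congr (\pi_ _ _); apply: val_inj => /=.
by rewrite !val_insub.
Qed.

Lemma rep_mem P (x : el P) : pmem (rep x).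
Proof. by apply/asboolP; exact: (valP (repr x)). Qed.

Lemma repK P (x : el P) : cls P (rep x) = x.
Proof.
rewrite /cls /rep -[RHS]reprK; congr (\pi_ _ _); apply: val_inj.
by rewrite val_insub //; exact: rep_mem.
Qed.

Lemma elP P (x : el P) : exists2 r, pmem r & x = cls P r.
Proof. by exists (rep x); [exact: rep_mem | rewrite repK]. Qed.

Lemma pmem0 P : @pmem K P 0.
Proof. by case: (pmem_submod P). Qed.
Lemma prel0 P : @prel K P 0.
Proof. by case: (prel_submod P). Qed.
Hint Resolve pmem0 prel0 : core.

Lemma cls0 P : cls P 0 = 0.
Proof.
have := @cls_lin P 1 0 0 (pmem0 P) (pmem0 P); rewrite scaler0 addr0 scale1r.
by move/(congr1 (fun z => z - cls P 0)); rewrite addrK subrr => <-.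
Qed.

Lemma clsD P (x y : series K (pidx P)) : pmem x -> pmem y ->
  cls P (x + y) = cls P x + cls P y.
Proof. by move=> hx hy; rewrite -[x]scale1r cls_lin // !scale1r. Qed.
Lemma clsZ P a (x : series K (pidx P)) : pmem x -> cls P (a *: x) = a *: cls P x.
Proof. by move=> hx; rewrite -[a *: x]addr0 cls_lin // cls0 addr0. Qed.
Lemma clsN P (x : series K (pidx P)) : pmem x -> cls P (- x) = - cls P x.
Proof. by move=> hx; rewrite -scaleN1r clsZ // scaleN1r. Qed.
Lemma clsB P (x y : series K (pidx P)) : pmem x -> pmem y ->
  cls P (x - y) = cls P x - cls P y.
Proof.
by move=> hx hy; rewrite clsD ?clsN //; apply: submodN => //; exact: pmem_submod.
Qed.

Lemma cls_sum P (I : eqType) (r : seq I) (p : pred I) (F : I -> series K (pidx P)) :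
  (forall i, p i -> pmem (F i)) ->
  cls P (\sum_(i <- r | p i) F i) = \sum_(i <- r | p i) cls P (F i).
Proof.
move=> h; elim: r => [|i r IH]; first by rewrite !big_nil cls0.
rewrite !big_cons; case: ifP => // pi.
rewrite clsD ?IH //; first exact: h.
by apply: submod_sum => [|j _]; [exact: pmem_submod | exact: h].
Qed.

Lemma cls_eq0 P (x : series K (pidx P)) : pmem x -> (cls P x = 0 <-> prel x).
Proof. by move=> hx; rewrite -cls0 cls_eq // subr0. Qed.

Lemma rep_cls P (x : series K (pidx P)) : pmem x -> prel (rep (cls P x) - x).
Proof. by move=> hx; apply/cls_eq; rewrite ?repK //; exact: rep_mem. Qed.

Definition pclosed P := sclosed (@pmem K P) /\ sclosed (@prel K P).

Definition eclosed P (A : set (el P)) :=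
  forall x, (forall F, exists2 y, A y & near_zero F (x - y)) -> A x.

Lemma nz_cls P F (r : series K (pidx P)) : pmem r ->
  {in F, forall b, r b = 0} -> near_zero F (cls P r).
Proof. by move=> hr h; exists r. Qed.

Lemma nzD P F (x y : el P) : near_zero F x -> near_zero F y -> near_zero F (x + y).
Proof.
move=> [r [hr <-] r0] [s [hs <-] s0]; exists (r + s).
  by split; [apply: submodD => //; exact: pmem_submod | rewrite clsD].
by move=> b bF; rewrite -[LHS]/(r b + s b) r0 // s0 // addr0.
Qed.

Lemma nzZ P F a (x : el P) : near_zero F x -> near_zero F (a *: x).
Proof.
move=> [r [hr <-] r0]; exists (a *: r).
  by split; [apply: submodZ => //; exact: pmem_submod | rewrite clsZ].
by move=> b bF; rewrite -[LHS]/(a * r b) r0 // mulr0.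
Qed.

Lemma nzN P F (x : el P) : near_zero F x -> near_zero F (- x).
Proof. by move=> h; rewrite -scaleN1r; exact: nzZ. Qed.
Lemma nzB P F (x y : el P) : near_zero F x -> near_zero F y -> near_zero F (x - y).
Proof. by move=> hx hy; apply: nzD => //; exact: nzN. Qed.
Lemma nz0 P F : near_zero F (0 : el P).
Proof. by rewrite -cls0; apply: nz_cls. Qed.

Lemma nzS P (F G : seq (pidx P)) (x : el P) :
  {subset F <= G} -> near_zero G x -> near_zero F x.
Proof. by move=> FG [r hr r0]; exists r => // b /FG; exact: r0. Qed.

(** The quotient is Hausdorff because the relations are closed: [x] near 0 for every [F] means that
    its representative is a limit of relations. *)
Lemma haus P (x : el P) : pclosed P -> (forall F, near_zero F x) -> x = 0.
Proof.
move=> [_ cr] h; have hr := rep_mem x; rewrite -(repK x); apply/cls_eq0 => //.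
apply: cr => F; have [s [hs e] s0] := h F.
exists (rep x - s); first by apply: (proj1 (cls_eq hr hs)); rewrite repK e.
by move=> b bF; rewrite -[LHS]/(rep x b - s b) s0 // subr0.
Qed.

(** Additive rather than linear, because the rescaling that detects cohomological degree also moves
    the coefficients and is only semilinear. *)
Definition cadd P Q (f : el P -> el Q) :=
  zmod_morphism f /\ forall F, exists F', forall x, near_zero F' x -> near_zero F (f x).

Section Cadd.
Variables (P Q : pmod K) (f : el P -> el Q).
Hypothesis hf : cadd f.
Lemma caddB x y : f (x - y) = f x - f y. Proof. by case: hf => h _; exact: h. Qed.
Lemma cadd0 : f 0 = 0. Proof. by rewrite -[X in f X](subrr 0) caddB subrr. Qed.
Lemma caddN x : f (- x) = - f x. Proof. by rewrite -sub0r caddB cadd0 sub0r. Qed.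
Lemma caddD x y : f (x + y) = f x + f y.
Proof. by rewrite -{1}[y]opprK caddB caddN opprK. Qed.
Lemma cadd_sum (I : Type) (r : seq I) (p : pred I) (F : I -> el P) :
  f (\sum_(i <- r | p i) F i) = \sum_(i <- r | p i) f (F i).
Proof.
elim/big_rec2: _ => [|i x y _ <-]; first exact: cadd0.
by rewrite caddD.
Qed.
End Cadd.

Lemma clin_cadd P Q (f : el P -> el Q) : continuous_linear f -> cadd f.
Proof.
move=> [l c]; split=> // x y.
by rewrite -[- y]scaleN1r addrC l scaleN1r addrC.
Qed.

Lemma clinZ P Q (f : el P -> el Q) a x : continuous_linear f -> f (a *: x) = a *: f x.
Proof.
by move=> h; rewrite -[a *: x]addr0 (proj1 h) (cadd0 (clin_cadd h)) addr0.
Qed.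

Lemma caddZ_clin P Q (f : el P -> el Q) : cadd f -> (forall a x, f (a *: x) = a *: f x) ->
  continuous_linear f.
Proof. by move=> h z; split=> [a x y|]; [rewrite (caddD h) z | case: h]. Qed.

Lemma cadd_comp P Q R (f : el P -> el Q) (h : el Q -> el R) :
  cadd f -> cadd h -> cadd (h \o f).
Proof.
move=> hf hh; split=> [x y|F] /=; first by rewrite (caddB hf) (caddB hh).
have [_ ch] := hh; have [_ cf] := hf.
have [F1 h1] := ch F; have [F2 h2] := cf F1; exists F2 => x /h2/h1 //.
Qed.

Lemma cadd_add P Q (f h : el P -> el Q) : cadd f -> cadd h -> cadd (fun x => f x + h x).
Proof.
move=> hf hh; split=> [x y|F].
  by rewrite (caddB hf) (caddB hh) opprD addrACA.
have [_ ch] := hh; have [_ cf] := hf.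
have [F1 h1] := ch F; have [F2 h2] := cf F.
exists (F1 ++ F2) => x hx; apply: nzD; [apply: h2 | apply: h1];
  by apply: nzS hx => b bF; rewrite mem_cat bF ?orbT.
Qed.

Lemma cadd_scale P Q a (f : el P -> el Q) : cadd f -> cadd (fun x => a *: f x).
Proof.
move=> hf; split=> [x y|F]; first by rewrite (caddB hf) scalerBr.
by have [_ cf] := hf; have [F1 h1] := cf F; exists F1 => x /h1; exact: nzZ.
Qed.

Lemma cadd_sub P Q (f h : el P -> el Q) : cadd f -> cadd h -> cadd (fun x => f x - h x).
Proof.
move=> hf hh; have := cadd_add hf (cadd_scale (-1) hh).
by congr cadd; apply: funext => x; rewrite scaleN1r.
Qed.

Lemma cadd_id P : cadd (@id (el P)).
Proof. by split=> // F; exists F. Qed.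

Lemma cadd_cst0 P Q : cadd (fun _ : el P => (0 : el Q)).
Proof. by split=> [x y|F]; [rewrite subrr | exists [::] => x _; exact: nz0]. Qed.

Lemma clin_comp P Q R (f : el P -> el Q) (h : el Q -> el R) :
  continuous_linear f -> continuous_linear h -> continuous_linear (h \o f).
Proof.
move=> hf hh; apply: caddZ_clin; first by apply: cadd_comp; exact: clin_cadd.
by move=> a x /=; rewrite (clinZ _ _ hf) (clinZ _ _ hh).
Qed.

Lemma clin_add P Q (f h : el P -> el Q) : continuous_linear f -> continuous_linear h ->
  continuous_linear (fun x => f x + h x).
Proof.
move=> hf hh; apply: caddZ_clin; first by apply: cadd_add; exact: clin_cadd.
by move=> a x /=; rewrite (clinZ _ _ hf) (clinZ _ _ hh) scalerDr.
Qed.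

Lemma clin_scale P Q a (f : el P -> el Q) : continuous_linear f ->
  continuous_linear (fun x => a *: f x).
Proof.
move=> hf; apply: caddZ_clin; first by apply: cadd_scale; exact: clin_cadd.
by move=> b x /=; rewrite (clinZ _ _ hf) !scalerA mulrC.
Qed.

Lemma clin_sub P Q (f h : el P -> el Q) : continuous_linear f -> continuous_linear h ->
  continuous_linear (fun x => f x - h x).
Proof.
move=> hf hh; apply: caddZ_clin; first by apply: cadd_sub; exact: clin_cadd.
by move=> a x /=; rewrite (clinZ _ _ hf) (clinZ _ _ hh) scalerBr.
Qed.

Lemma clin_id P : continuous_linear (@id (el P)).
Proof. by apply: caddZ_clin => //; exact: cadd_id. Qed.

Lemma clin_cst0 P Q : continuous_linear (fun _ : el P => (0 : el Q)).
Proof. by apply: caddZ_clin => [|a x]; [exact: cadd_cst0 | rewrite scaler0]. Qed.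

Lemma eclosed_eq P Q (f h : el P -> el Q) : pclosed Q -> cadd f -> cadd h ->
  eclosed [set x | f x = h x].
Proof.
move=> cQ hf hh x hx; apply/eqP; rewrite -subr_eq0; apply/eqP; apply: (haus cQ) => F.
have [_ c] := cadd_sub hf hh; have [F' hF'] := c F.
have [y /= fy hy] := hx F'.
have := hF' _ hy; rewrite (caddB hf) (caddB hh) fy.
suff -> : f x - h y - (h x - h y) = f x - h x by [].
by rewrite opprB addrA subrK.
Qed.

Lemma submod_eqs P Q (f h : el P -> el Q) : continuous_linear f -> continuous_linear h ->
  submod [set x | f x = h x].
Proof.
move=> hf hh; split=> [|a x y] /=; first by rewrite !(cadd0 (clin_cadd _)).
by move=> ex ey; rewrite (proj1 hf) (proj1 hh) ex ey.
Qed.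

Lemma eclosed_preim P Q (f : el P -> el Q) (A : set (el Q)) :
  cadd f -> eclosed A -> eclosed [set x | A (f x)].
Proof.
move=> hf cA x hx; apply: cA => F; have [_ c] := hf; have [F' hF'] := c F.
have [y Ay e] := hx F'; exists (f y) => //; rewrite -(caddB hf); exact: hF'.
Qed.

(** The induction principle for topological generators: the series whose class lies in [A] form a
    closed submodule containing [S], hence the whole of its closed span. *)
Lemma el_ind P (S : set (series K (pidx P))) (A : set (el P)) :
  sclosed (@pmem K P) ->
  @pmem K P `<=` hspan S -> S `<=` @pmem K P -> submod A -> eclosed A ->
  (forall s, S s -> A (cls P s)) -> forall x, A x.
Proof.
move=> cP PS SP mA cA SA x.
suff h : hspan S `<=` [set r | pmem r /\ A (cls P r)].
  by have [r hr ->] := elP x; case: (h r (PS _ hr)).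
apply: hspan_min.
- split=> [|a r s [hr Ar] [hs As]]; first by split=> //; rewrite cls0; case: mA.
  split; first by case: (pmem_submod P) => _; apply.
  by rewrite cls_lin //; case: mA => _; apply.
- move=> r h; have pr : pmem r by apply: cP => F; have [y [hy _] e] := h F; exists y.
  split=> //; apply: cA => F; have [y [hy Ay] e] := h F; exists (cls P y) => //.
  rewrite -clsB //; apply: nz_cls; first by apply: submodB => //; exact: pmem_submod.
  by move=> b bF; rewrite -[LHS]/(r b - y b) e // subrr.
- by move=> s Ss; split; [exact: SP | exact: SA].
Qed.

(* For sets that are not K-submodules, such as the fixed points of a semilinear
   map. *)
Lemma el_add_ind P (A : set (el P)) : pclosed P ->
  eclosed A -> (forall r : series K (pidx P), pmem r -> forall F : seq (pidx P),
     exists2 s, pmem s /\ A (cls P s) & {in F, r =1 s}) -> forall x, A x.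
Proof.
move=> cP cA h x; apply: cA => F; have [r hr ->] := elP x.
have [s [hs As] e] := h r hr F; exists (cls P s) => //; rewrite -clsB //.
apply: nz_cls; first by apply: submodB => //; exact: pmem_submod.
by move=> b bF; rewrite -[LHS]/(r b - s b) e // subrr.
Qed.

Definition elmap P Q (f : series K (pidx P) -> series K (pidx Q)) (x : el P) : el Q :=
  cls Q (f (rep x)).

Section Elmap.
Variables (P Q : pmod K) (f : series K (pidx P) -> series K (pidx Q)).
Hypothesis fB : forall x y, f (x - y) = f x - f y.
Hypothesis fmem : forall x, pmem x -> pmem (f x).
Hypothesis frel : forall x, pmem x -> prel x -> prel (f x).

Lemma elmap_cls r : pmem r -> elmap f (cls P r) = cls Q (f r).
Proof.
move=> hr; apply/cls_eq; [exact/fmem/rep_mem | exact: fmem |].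
rewrite -fB; apply: frel; last exact: rep_cls.
by apply: submodB => //; [exact: pmem_submod | exact: rep_mem].
Qed.

Lemma elmap_cadd : (forall G : seq (pidx Q), exists F : seq (pidx P), forall x : series K (pidx P), {in F, forall b, x b = 0} ->
    {in G, forall c, f x c = 0}) -> cadd (elmap f).
Proof.
move=> hf; split=> [x y|G].
  have [r hr ->] := elP x; have [s hs ->] := elP y; rewrite -clsB // !elmap_cls //.
    by rewrite fB clsB //; exact: fmem.
  by apply: submodB => //; exact: pmem_submod.
have [F hF] := hf G; exists F => x [r [hr <-] r0]; rewrite elmap_cls //.
apply: nz_cls; [exact: fmem | exact: hF].
Qed.

Lemma elmap_clin : rfin f -> continuous_linear (elmap f).
Proof.
move=> hf; apply: caddZ_clin; first exact/elmap_cadd/rfin_nbhs.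
move=> a x; have [r hr ->] := elP x; rewrite -clsZ // !elmap_cls //.
  by rewrite (rfinZ hf) clsZ //; exact: fmem.
by apply: submodZ => //; exact: pmem_submod.
Qed.
End Elmap.

Definition elmap2 P Q R (m : series K (pidx P) -> series K (pidx Q) -> series K (pidx R))
  (x : el P) (y : el Q) : el R := cls R (m (rep x) (rep y)).

Section Elmap2.
Variables (P Q R : pmod K)
  (m : series K (pidx P) -> series K (pidx Q) -> series K (pidx R)).
Hypothesis hm : bifin m.
Hypothesis mmem : forall x y, pmem x -> pmem y -> pmem (m x y).
Hypothesis mrell : forall x y, pmem x -> prel x -> pmem y -> prel (m x y).
Hypothesis mrelr : forall x y, pmem x -> pmem y -> prel y -> prel (m x y).

Lemma elmap2_cls r s : pmem r -> pmem s ->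
  elmap2 m (cls P r) (cls Q s) = cls R (m r s).
Proof.
move=> hr hs; apply/cls_eq; [by apply: mmem; exact: rep_mem | exact: mmem |].
have [m1 m2] := hm.
set r' := rep _; set s' := rep _.
have -> : m r' s' - m r s = m (r' - r) s' + m r (s' - s).
  by rewrite (rfinB (m2 _)) (rfinB (m1 _)) addrA subrK.
apply: submodD; first exact: prel_submod.
  by apply: mrell; [apply: submodB => //; [exact: pmem_submod | exact: rep_mem]
                   | exact: rep_cls | exact: rep_mem].
by apply: mrelr => //; [apply: submodB => //; [exact: pmem_submod | exact: rep_mem]
                 | exact: rep_cls].
Qed.

Lemma elmap2_clinr x : continuous_linear (elmap2 m x).
Proof.
have [r hr ->] := elP x; have [m1 m2] := hm.
rewrite (_ : elmap2 m (cls P r) = elmap (m r)); last first.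
  apply: funext => y; have [s hs ->] := elP y; rewrite elmap2_cls // elmap_cls //.
  - exact: (rfinB (m1 r)).
  - by move=> z; exact: mmem.
  - by move=> z; exact: mrelr.
apply: elmap_clin => //.
- exact: (rfinB (m1 r)).
- by move=> z; exact: mmem.
- by move=> z; exact: mrelr.
Qed.

Lemma elmap2_clinl y : continuous_linear (fun x => elmap2 m x y).
Proof.
have [s hs ->] := elP y; have [m1 m2] := hm.
rewrite (_ : (fun x => _) = elmap (m^~ s)); last first.
  apply: funext => x; have [r hr ->] := elP x; rewrite elmap2_cls // elmap_cls //.
  - exact: (rfinB (m2 s)).
  - by move=> z hz; exact: mmem.
  - by move=> z hz raises; exact: mrell.
apply: elmap_clin => //.
- exact: (rfinB (m2 s)).
- by move=> z hz; exact: mmem.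
- by move=> z hz raises; exact: mrell.
Qed.
End Elmap2.

End Elements.
#[export] Hint Resolve pmem0 prel0 : core.

(** * Rescaling automorphisms *)

Section Characters.
Variable K : evenRing.
Implicit Types (B C D : gset) (P Q : pmod K).

(* The operation [sig chi] below rescales a basis element by a character of its
   three gradings and twists the coefficients by [ctau]; it is compatible with
   all the constructions of the de Rham complex. *)
Record chr := Chr {
  ctau : {rmorphism (K : nzRingType) -> (K : nzRingType)};
  ctau_gr : forall i x, er_gr i x -> er_gr i (ctau x);
  cwt : rat; cfd : rat; cdg : rat;
  cnz : [/\ cwt != 0, cfd != 0 & cdg != 0] }.

Implicit Types chi : chr.

Definition lam chi B (b : B) : rat :=
  cwt chi ^+ gwt b * cfd chi ^+ gfd b * cdg chi ^ gdeg b.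

Definition sig chi B (x : series K B) : series K B :=
  fun b => qk K (lam chi b) * ctau chi (x b).

Lemma cdg0 chi : cdg chi != 0. Proof. by case: (cnz chi). Qed.

Lemma lam_pair chi B C (b : B) (c : C) :
  lam chi ((b, c) : pairs B C) = lam chi b * lam chi c.
Proof.
rewrite /lam /= !exprD expfzDr ?cdg0 //.
by rewrite [RHS]mulrACA [X in _ = X * _]mulrACA.
Qed.

Lemma lam_nil chi B : lam chi ([::] : words B) = 1.
Proof. by rewrite /lam /= !big_nil !expr0 expr0z !mulr1. Qed.

Lemma lam_cons chi B (b : B) (w : seq B) :
  lam chi (b :: w : words B) = lam chi b * lam chi (w : words B).
Proof.
rewrite /lam /= !big_cons !exprD expfzDr ?cdg0 //.
by rewrite [RHS]mulrACA [X in _ = X * _]mulrACA.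
Qed.

Lemma lam_cat chi B (u v : seq B) :
  lam chi (u ++ v : words B) = lam chi (u : words B) * lam chi (v : words B).
Proof.
by elim: u => [|b u IH]; rewrite ?lam_nil ?mul1r //= !lam_cons IH mulrA.
Qed.

(** A desuspension adds one to the form degree and one to the cohomological degree. The resulting
    factor reappears in every formula that rescales a differential or a contraction. *)
Lemma lam_desusp chi B (b : B) :
  lam chi (b : desusp B) = cfd chi * cdg chi * lam chi b.
Proof.
rewrite /lam /= exprS expfzDr ?cdg0 // expr1z.
move: (_ ^+ _) (_ ^+ _) (_ ^ _) => u v w.
by ring.
Qed.

Lemma ctau_qk chi q (x : K) : ctau chi (qk K q * x) = qk K q * ctau chi x.
Proof.
have e (z : K) : qk K q * z = q *: z by rewrite /qk /GRing.in_alg /= mulr_algl.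
rewrite !e.
have za : zmod_morphism (ctau chi : (K : comAlgType rat) -> (K : comAlgType rat)).
  by move=> a b; exact: rmorphB.
exact: (rat_linear za).
Qed.

Section Sig.
Variable chi : chr.

Lemma sigB B (x y : series K B) : sig chi (x - y) = sig chi x - sig chi y.
Proof.
apply: funext => b; rewrite -[RHS]/(sig chi x b - sig chi y b) /sig.
by rewrite -[(x - y) b]/(x b - y b) rmorphB mulrBr.
Qed.

Lemma sig0 B : sig chi (0 : series K B) = 0.
Proof. by rewrite -[X in sig _ X](subrr 0) sigB subrr. Qed.
Lemma sigN B (x : series K B) : sig chi (- x) = - sig chi x.
Proof. by rewrite -sub0r sigB sig0 sub0r. Qed.
Lemma sigD B (x y : series K B) : sig chi (x + y) = sig chi x + sig chi y.
Proof. by rewrite -{1}[y]opprK sigB sigN opprK. Qed.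
Lemma sigZ B a (x : series K B) : sig chi (a *: x) = ctau chi a *: sig chi x.
Proof.
apply: funext => b; rewrite -[RHS]/(ctau chi a * sig chi x b) /sig.
by rewrite -[(a *: x) b]/(a * x b) (rmorphM (ctau chi)) [LHS]mulrCA.
Qed.
Lemma sig_sum B (I : Type) (r : seq I) (p : pred I) (F : I -> series K B) :
  sig chi (\sum_(i <- r | p i) F i) = \sum_(i <- r | p i) sig chi (F i).
Proof.
elim/big_rec2: _ => [|i x y _ <-]; first exact: sig0.
exact: sigD.
Qed.

Lemma sig_zero B (x : series K B) b : x b = 0 -> sig chi x b = 0.
Proof. by rewrite /sig => ->; rewrite rmorph0 mulr0. Qed.

Lemma sig_hspan B (S H : set (series K B)) : submod H -> sclosed H ->
  (forall s, S s -> H (sig chi s)) -> forall x, hspan S x -> H (sig chi x).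
Proof.
move=> mH cH SH; apply: (@hspan_min _ _ S [set x | H (sig chi x)]) => //.
  split=> [|a x y] /=; first by rewrite sig0; case: mH.
  by move=> hx hy; rewrite sigD sigZ; case: mH => _; apply.
move=> x h; apply: cH => F; have [y Hy e] := h F; exists (sig chi y) => //.
by move=> b bF; rewrite /sig e.
Qed.

Lemma sig_tens B C (x : series K B) (y : series K C) :
  sig chi (tens x y) = tens (sig chi x) (sig chi y).
Proof.
apply: funext => -[b c]; rewrite /sig /tens /= lam_pair !rmorphM /=.
by rewrite mulrACA.
Qed.

Lemma sig_tmul B (x y : series K (words B)) :
  sig chi (tmul x y) = tmul (sig chi x) (sig chi y).
Proof.
apply: funext => w; rewrite /sig /tmul rmorph_sum mulr_sumr; apply: eq_bigr => k _.
by rewrite -{1}(cat_take_drop k w) lam_cat !rmorphM /= mulrACA.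
Qed.

Lemma sig_tcons B (x : series K B) F : sig chi (tcons x F) = tcons (sig chi x) (sig chi F).
Proof.
apply: funext => -[|b w]; rewrite /sig /=; first by rewrite rmorph0 mulr0.
by rewrite lam_cons !rmorphM /= mulrACA.
Qed.

Lemma sig_pure B (xs : seq (series K B)) :
  sig chi (pure xs) = pure (map (sig chi (B:=B)) xs).
Proof.
elim: xs => [|x xs IH] /=; last by rewrite !pure_cons sig_tcons IH.
apply: funext => w; rewrite /sig pure_nil; case: eqP => [->|_].
  by rewrite lam_nil !rmorph1 mul1r.
by rewrite rmorph0 mulr0.
Qed.

Lemma sig_ppart B p (x : series K B) : sig chi (ppart p x) = ppart p (sig chi x).
Proof.
by apply: funext => b; rewrite /sig /ppart; case: ifP => //; rewrite rmorph0 mulr0.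
Qed.

Lemma sig_gswap B C D (m : series K C -> series K B -> series K D) :
  (forall x y, sig chi (m x y) = m (sig chi x) (sig chi y)) ->
  forall x y, sig chi (gswap m x y) = gswap m (sig chi x) (sig chi y).
Proof.
move=> h x y; rewrite /gswap sig_sum; apply: eq_bigr => p _.
rewrite sig_sum; apply: eq_bigr => q _.
by rewrite sigZ h !sig_ppart rmorphXn rmorphN1.
Qed.

Lemma sig_tcomm B (x y : series K (words B)) :
  sig chi (tcomm x y) = tcomm (sig chi x) (sig chi y).
Proof. by rewrite /tcomm sigB sig_tmul (sig_gswap (@sig_tmul B)). Qed.

Lemma sig_desusp B (x : series K B) :
  sig chi (x : series K (desusp B)) = qk K (cfd chi * cdg chi) *: sig chi x.
Proof.
apply: funext => b; rewrite -[RHS]/(qk K (cfd chi * cdg chi) * sig chi x b) /sig.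
by rewrite lam_desusp rmorphM mulrA.
Qed.

Lemma sig_copair B C (x : series K B) (y : series K C) :
  sig chi (copair x y) = copair (sig chi x) (sig chi y).
Proof. by apply: funext => -[b|c]. Qed.

Lemma shomog_sig B k (x : series K B) : shomog k x -> shomog k (sig chi x).
Proof. by move=> h b; apply/er_gr_qk/ctau_gr/h. Qed.

End Sig.

(** What the quotient needs for the spectral arguments: closedness makes it Hausdorff, and
    invariance lets all rescalings descend to it. *)
Definition good P := pclosed P /\
  forall chi x, (@pmem K P x -> @pmem K P (sig chi x)) /\
                (@prel K P x -> @prel K P (sig chi x)).

Lemma good_free B : good (free_pmod K B).
Proof.
split; first by split; exact: hspan_sclosed.
move=> chi x; split=> h; first exact: sub_hspan.
by rewrite (hspan0 h) sig0; exact: hspan_0.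
Qed.

Lemma good_pmem P chi x : good P -> @pmem K P x -> @pmem K P (sig chi x).
Proof. by move=> [_ h]; case: (h chi x). Qed.
Lemma good_prel P chi x : good P -> @prel K P x -> @prel K P (sig chi x).
Proof. by move=> [_ h]; case: (h chi x). Qed.

Lemma good_tens P Q : good P -> good Q -> good (tens_pmod P Q).
Proof.
move=> gP gQ; split; first by split; exact: hspan_sclosed.
move=> chi x; split; apply: sig_hspan; try exact: hspan_submod; try exact: hspan_sclosed.
  move=> _ [y [z [hy hz ->]]]; apply: sub_hspan; rewrite sig_tens.
  by exists (sig chi y), (sig chi z); split=> //; exact: good_pmem.
move=> _ [y [z [hy hz h ->]]]; apply: sub_hspan; rewrite sig_tens.
exists (sig chi y), (sig chi z); split=> //; try exact: good_pmem.
by case: h => h; [left | right]; exact: good_prel.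
Qed.

Lemma good_tensalg P : good P -> good (tensalg_pmod P).
Proof.
move=> gP; split; first by split; exact: hspan_sclosed.
move=> chi x; split; apply: sig_hspan; try exact: hspan_submod; try exact: hspan_sclosed.
  move=> _ [xs h ->]; apply: sub_hspan; rewrite sig_pure; exists (map (sig chi (B:=_)) xs) => //.
  by move=> _ /mapP[y yxs ->]; apply: good_pmem => //; exact: h.
move=> _ [xs [h [y yxs ry] ->]]; apply: sub_hspan; rewrite sig_pure.
exists (map (sig chi (B:=_)) xs); split=> //.
  by move=> _ /mapP[z zxs ->]; apply: good_pmem => //; exact: h.
by exists (sig chi y); [apply/mapP; exists y | exact: good_prel].
Qed.

Lemma good_lie P : good P -> good (lie_pmod P).
Proof.
move=> gP; have gT := good_tensalg gP.
have hL chi x : hspan (lie_monomial (@pmem K P)) x ->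
    hspan (lie_monomial (@pmem K P)) (sig chi x).
  apply: sig_hspan; try exact: hspan_submod; try exact: hspan_sclosed.
  move=> s Ls; apply: sub_hspan; elim: Ls => [y hy|u v _ IHu _ IHv].
    by rewrite sig_pure; apply: lie_gen; exact: good_pmem.
  by rewrite sig_tcomm; exact: lie_br.
split; first by split; [exact: hspan_sclosed | apply: sclosedI; exact: hspan_sclosed].
move=> chi x; split; first exact: hL.
by move=> [h1 h2]; split; [exact: hL | exact: (good_prel chi gT)].
Qed.

Lemma good_quot P (S : set (series K (pidx P))) : good P ->
  (forall chi s, S s -> S (sig chi s)) -> good (quot_pmod S).
Proof.
move=> gP hS; split; first by split; [case: gP => -[] | exact: hspan_sclosed].
move=> chi x; split; first exact: (good_pmem chi gP).
apply: sig_hspan; try exact: hspan_submod; try exact: hspan_sclosed.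
move=> s [rs|Ss]; apply: sub_hspan; [left; exact: good_prel | right; exact: hS].
Qed.

Lemma good_desusp P : good P -> good (desusp_pmod P).
Proof.
move=> gP; split; first by case: gP.
by move=> chi x; split=> h; rewrite (@sig_desusp chi (pidx P));
  apply: submodZ; first [exact: pmem_submod | exact: prel_submod |
    exact: good_pmem | exact: good_prel].
Qed.

Lemma sclosed_both B C (S : set (series K B)) (T : set (series K C)) :
  sclosed S -> sclosed T -> sclosed (both S T).
Proof.
move=> cS cT x h; split; [apply: cS => F | apply: cT => F].
  have [y [Sy Ty] e] := h [seq inl b | b <- F]; exists (linl y) => // b bF.
  by apply: e; exact: map_f.
have [y [Sy Ty] e] := h [seq inr b | b <- F]; exists (linr y) => // b bF.
by apply: e; exact: map_f.
Qed.

Lemma good_sum P Q : good P -> good Q -> good (sum_pmod P Q).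
Proof.
move=> gP gQ; have [[cP rP] _] := gP; have [[cQ rQ] _] := gQ.
split; first by split; apply: sclosed_both.
move=> chi x; split=> -[h1 h2]; split.
- exact: (good_pmem chi gP h1).
- exact: (good_pmem chi gQ h2).
- exact: (good_prel chi gP h1).
- exact: (good_prel chi gQ h2).
Qed.

End Characters.

(** * Functional calculus of the rescaling operators *)

Lemma interp (l : seq rat) (v : rat -> rat) :
  exists p : {poly rat}, {in l, forall q, p.[q] = v q}.
Proof.
elim: l => [|q l [p hp]]; first by exists 0.
have [ql|ql] := boolP (q \in l).
  by exists p => q'; rewrite inE => /predU1P[->|]; exact: hp.
set w := \prod_(z <- l) ('X - z%:P).
have w0 : w.[q] != 0 by rewrite -/(root w q) root_prod_XsubC.
exists (p + ((v q - p.[q]) / w.[q])%:P * w) => q'.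
rewrite inE hornerD hornerM hornerC => /predU1P[->|ql'].
  by rewrite mulfVK // addrC subrK.
have /rootP -> : root w q' by rewrite root_prod_XsubC.
by rewrite mulr0 addr0 hp.
Qed.

Lemma pow2_inj : injective (fun n : nat => (2%:R : rat) ^+ n).
Proof. exact: ieexprIn. Qed.

Lemma pow2z_inj : injective (fun n : int => (2%:R : rat) ^ n).
Proof. exact: ieexprIz. Qed.

Section Projections.
Variable K : evenRing.
Implicit Types (B : gset) (P Q : pmod K) (chi : chr K) (q : rat).

Definition clinear chi := forall x, ctau chi x = x.

Definition Sg chi P (x : el P) : el P := elmap (P := P) (Q := P) (@sig K chi (pidx P)) x.

Section SgTheory.
Variables (chi : chr K) (P : pmod K).
Hypothesis gP : good P.

Lemma Sg_cls r : pmem r -> Sg chi (cls P r) = cls P (sig chi r).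
Proof.
move=> hr; apply: elmap_cls => //.
- exact: sigB.
- by move=> x; exact: good_pmem.
- by move=> x _; exact: good_prel.
Qed.

Lemma Sg_cadd : cadd (@Sg chi P).
Proof.
apply: elmap_cadd.
- exact: sigB.
- by move=> x; exact: good_pmem.
- by move=> x _; exact: good_prel.
- by move=> G; exists G => x h c cG; apply: sig_zero; exact: h.
Qed.

Lemma SgZ a x : Sg chi (a *: x : el P) = ctau chi a *: Sg chi x.
Proof.
have [r hr ->] := elP x; rewrite -clsZ // !Sg_cls //; last first.
  by apply: submodZ => //; exact: pmem_submod.
by rewrite sigZ clsZ //; exact: good_pmem.
Qed.

Lemma SgZq q x : Sg chi (qk K q *: x : el P) = qk K q *: Sg chi x.
Proof. by rewrite SgZ -[qk K q]mulr1 ctau_qk rmorph1. Qed.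

Lemma Sg_clin : clinear chi -> continuous_linear (@Sg chi P).
Proof.
by move=> h; apply: caddZ_clin => [|a x]; [exact: Sg_cadd | rewrite SgZ h].
Qed.

End SgTheory.

(** The operator p(sig chi). Its coefficients are rational, so that it can be formed even when
    [sig chi] is only semilinear over K. *)
Definition psig chi B (p : {poly rat}) (x : series K B) : series K B :=
  \sum_(i < size p) qk K p`_i *: iter i (@sig K chi B) x.

Lemma psig_mem chi B p (H : set (series K B)) x : submod H ->
  (forall y, H y -> H (sig chi y)) -> H x -> H (psig chi p x).
Proof.
move=> mH hs Hx; apply: submod_sum => // i _ _; apply: submodZ => //.
by elim: (i : nat) => //= k; exact: hs.
Qed.

Lemma iter_sigE chi B (x : series K B) i b :
  iter i (@sig K chi B) x b = qk K (lam chi b ^+ i) * iter i (ctau chi) (x b).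
Proof.
elim: i => [|i IH]; first by rewrite expr0 rmorph1 mul1r.
rewrite !iterS -[LHS]/(qk K (lam chi b) * ctau chi (iter i (@sig K chi B) x b)).
by rewrite IH ctau_qk exprS mulrA -rmorphM.
Qed.

Lemma psigE chi B p (x : series K B) b : clinear chi ->
  psig chi p x b = qk K p.[lam chi b] * x b.
Proof.
move=> h; rewrite /psig series_sumE horner_coef rmorph_sum mulr_suml.
apply: eq_bigr => i _; rewrite -[LHS]/(_ * _) iter_sigE mulrA -rmorphM.
by congr (_ * _); elim: (i : nat) => //= k ->; rewrite h.
Qed.

Lemma eig_psig chi P p r q : good P -> pmem r ->
  Sg chi (cls P r) = qk K q *: cls P r ->
  cls P (psig chi p r) = qk K p.[q] *: cls P r.
Proof.
move=> gP hr e.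
have hi i : pmem (iter i (@sig K chi (pidx P)) r).
  by elim: i => //= i; exact: good_pmem.
have hi' i : cls P (iter i (@sig K chi (pidx P)) r) = qk K (q ^+ i) *: cls P r.
  elim: i => [|i IH] /=; first by rewrite expr0 rmorph1 scale1r.
  by rewrite -Sg_cls // IH SgZq // e scalerA -rmorphM /= exprSr.
rewrite /psig cls_sum; last by move=> i _; apply: submodZ => //; exact: pmem_submod.
rewrite horner_coef rmorph_sum scaler_suml; apply: eq_bigr => i _.
by rewrite clsZ // hi' scalerA -rmorphM.
Qed.

(** Only the class of [r] is an eigenvector, not [r] itself. Each polynomial with p(q) = c changes
    [r] into [c *: r] modulo relations, and the limit [y] inherits this because the relations are
    closed. *)
Lemma eig_limit chi P r q c y : good P -> pmem r ->
  Sg chi (cls P r) = qk K q *: cls P r ->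
  (forall F : seq (pidx P), exists2 p, p.[q] = c & {in F, y =1 psig chi p r}) ->
  cls P y = qk K c *: cls P r.
Proof.
move=> gP hr e h; have [[cP cR] _] := gP.
have hp p : pmem (psig chi p r).
  by apply: psig_mem => //; [exact: pmem_submod | move=> z; exact: good_pmem].
have hy : pmem y.
  by apply: cP => F; have [p _ ep] := h F; exists (psig chi p r) => // b bF; rewrite ep.
have hc : pmem (qk K c *: r) by apply: submodZ => //; exact: pmem_submod.
rewrite -clsZ //; apply/(cls_eq hy hc); apply: cR => F; have [p pq ep] := h F.
exists (psig chi p r - qk K c *: r).
  by apply/(cls_eq (hp p) hc); rewrite (eig_psig p gP hr e) pq clsZ.
by move=> b bF; rewrite -[LHS]/(_ b - _ b) -ep.
Qed.

Lemma limit_mem chi P r y : good P ->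
  (forall F : seq (pidx P), exists p, {in F, y =1 psig chi p r}) ->
  (@pmem K P r -> @pmem K P y) /\ (@prel K P r -> @prel K P y).
Proof.
move=> gP h; have [[cP cR] _] := gP.
split=> hr; [apply: cP => F | apply: cR => F]; have [p ep] := h F;
  exists (psig chi p r); try (by move=> b bF; rewrite ep); apply: psig_mem => //.
- exact: pmem_submod.
- by move=> z; exact: good_pmem.
- exact: prel_submod.
- by move=> z; exact: good_prel.
Qed.

(* Functional calculus: on eigenvectors of [sig chi] of eigenvalue q this is
   multiplication by f q.  Only finitely many eigenvalues matter near 0, so that
   it agrees locally with a polynomial in [sig chi]. *)
Definition kdiag chi (f : rat -> rat) B (x : series K B) : series K B :=
  fun b => qk K (f (lam chi b)) * x b.

Lemma kdiag_rfin chi f B : rfin (@kdiag chi f B).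
Proof. by move=> b; apply: ffl_mull; exact: ffl_ev. Qed.

(** The extra nodes [l] allow the value of [p] to be prescribed at an eigenvalue of the class, which
    need not occur among the basis elements in [F]. *)
Lemma kdiag_psig chi f B (x : series K B) (l : seq rat) (F : seq B) : clinear chi ->
  exists2 p, {in l, forall q, p.[q] = f q} & {in F, kdiag chi f x =1 psig chi p x}.
Proof.
move=> hl; have [p hp] := interp (l ++ [seq lam chi b | b <- F]) f; exists p.
  by move=> q ql; apply: hp; rewrite mem_cat ql.
by move=> b bF; rewrite psigE // hp // mem_cat map_f // orbT.
Qed.

Definition kd chi f P (x : el P) : el P :=
  elmap (P := P) (Q := P) (@kdiag chi f (pidx P)) x.

Section Kd.
Variables (chi : chr K) (f : rat -> rat) (P : pmod K).
Hypotheses (gP : good P) (hl : clinear chi).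

Lemma kdiag_mem r : (@pmem K P r -> @pmem K P (kdiag chi f r)) /\
   (@prel K P r -> @prel K P (kdiag chi f r)).
Proof.
apply: (@limit_mem chi) => // F.
by have [p _ hp] := @kdiag_psig chi f (pidx P) r [::] F hl; exists p.
Qed.

Lemma kd_cls r : pmem r -> kd chi f (cls P r) = cls P (kdiag chi f r).
Proof.
move=> hr; apply: elmap_cls => //.
- by move=> x y; rewrite (rfinB (@kdiag_rfin chi f _)).
- by move=> x; case: (kdiag_mem x).
- by move=> x _; case: (kdiag_mem x).
Qed.

Lemma kd_clin : continuous_linear (@kd chi f P).
Proof.
apply: elmap_clin.
- by move=> x y; rewrite (rfinB (@kdiag_rfin chi f _)).
- by move=> x; case: (kdiag_mem x).
- by move=> x _; case: (kdiag_mem x).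
- exact: kdiag_rfin.
Qed.

Lemma kd_eig q (x : el P) : Sg chi x = qk K q *: x -> kd chi f x = qk K (f q) *: x.
Proof.
have [r hr ->] := elP x => e; rewrite kd_cls //; apply: (eig_limit gP hr e) => F.
have [p hq hp] := @kdiag_psig chi f (pidx P) r [:: q] F hl.
by exists p => //; apply: hq; rewrite inE.
Qed.

Lemma Sg_kd chi' (x : el P) : Sg chi' (kd chi f x) = kd chi f (Sg chi' x).
Proof.
have [r hr ->] := elP x.
have h1 : pmem (kdiag chi f r) by case: (kdiag_mem r) => h _; exact: h.
have h2 : pmem (sig chi' r) by exact: good_pmem.
rewrite kd_cls // !Sg_cls // kd_cls //.
congr (cls P _); apply: funext => b; rewrite /sig /kdiag.
by rewrite ctau_qk mulrCA.
Qed.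

End Kd.

Lemma kd_kd chi f f' P (x : el P) : good P -> clinear chi ->
  kd chi f (kd chi f' x) = kd chi (fun q => f q * f' q) x.
Proof.
move=> gP hl; have [r hr ->] := elP x; rewrite !kd_cls //.
  by congr (cls P _); apply: funext => b; rewrite /kdiag rmorphM mulrA.
by case: (kdiag_mem f' gP hl r) => h _; exact: h.
Qed.

Definition idm : {rmorphism (K : nzRingType) -> (K : nzRingType)} := idfun.

Lemma two_neq0 : (2%:R : rat) != 0. Proof. by []. Qed.

Definition chW : chr K := @Chr K idm (fun i x h => h) 2%:R 1 1
  (And3 two_neq0 (oner_neq0 _) (oner_neq0 _)).
Definition chWV : chr K := @Chr K idm (fun i x h => h) 2%:R^-1 1 1
  (And3 (invr_neq0 two_neq0) (oner_neq0 _) (oner_neq0 _)).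
Definition chF : chr K := @Chr K idm (fun i x h => h) 1 2%:R 1
  (And3 (oner_neq0 _) two_neq0 (oner_neq0 _)).

Lemma signz_neq0 (k : int) : ((-1) ^ k : rat) != 0.
Proof. by rewrite expfz_neq0 // oppr_eq0 oner_eq0. Qed.
(** The Koszul sign operator, multiplying degree i by (-1)^(k i). It uses the degree of the basis
    element alone, which has the right parity since the coefficients are even. *)
Definition chP (k : int) : chr K := @Chr K idm (fun i x h => h) 1 1 ((-1) ^ k)
  (And3 (oner_neq0 _) (oner_neq0 _) (signz_neq0 k)).

Lemma ktau_gr i (x : K) : er_gr i x -> er_gr i (ktau x).
Proof. by move=> h; rewrite (ktau_homog h); exact: er_gr_qk. Qed.

(* The scalar part must be rescaled as well, since K itself is graded: [homog k]
   is the eigenspace of [Sg chD] for 2^k. *)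
Definition chD : chr K := @Chr K (@ktau K) ktau_gr 1 1 2%:R
  (And3 (oner_neq0 _) (oner_neq0 _) two_neq0).

Lemma lamW B (b : B) : lam chW b = 2%:R ^+ gwt b.
Proof. by rewrite /lam /= expr1n exp1rz !mulr1. Qed.
Lemma lamF B (b : B) : lam chF b = 2%:R ^+ gfd b.
Proof. by rewrite /lam /= expr1n exp1rz mul1r mulr1. Qed.
Lemma lamD B (b : B) : lam chD b = 2%:R ^ gdeg b.
Proof. by rewrite /lam /= !expr1n !mul1r. Qed.
Lemma lamP k B (b : B) : lam (chP k) b = (-1) ^ (k * gdeg b).
Proof. by rewrite /lam /= !expr1n !mul1r exprz_exp. Qed.

Definition wp (w : nat) P (x : el P) : el P := kd chW (fun q => (q == 2%:R ^+ w)%:R) x.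

(** The component of total degree k: at [b] the coefficient has to supply the missing degree k -
    gdeg b. *)
Definition dproj k B (x : series K B) : series K B :=
  fun b => kcomp (x b) (k - gdeg b).

Lemma iter_ktau i (x : K) :
  iter i (@ktau K) x = \sum_(j <- ksupp x) qk K ((2%:R ^ j) ^+ i) * kcomp x j.
Proof.
elim: i => [|i IH] /=.
  have [_ _ _ e] := kcompP x; rewrite {1}e; apply: eq_bigr => j _.
  by rewrite expr0 rmorph1 mul1r.
rewrite IH raddf_sum; apply: eq_bigr => j _ /=.
have gj : er_gr j (qk K ((2%:R ^ j) ^+ i) * kcomp x j).
  by apply: er_gr_qk; case: (kcompP x).
by rewrite (ktau_homog gj) mulrA -rmorphM /= exprS.
Qed.

Lemma psigDE B p (x : series K B) b :
  psig chD p x b = \sum_(j <- ksupp (x b)) qk K p.[2%:R ^ (gdeg b + j)] * kcomp (x b) j.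
Proof.
rewrite /psig series_sumE.
have sE (a : K) (y : series K B) : (a *: y) b = a * y b by [].
under eq_bigr => i _ do rewrite sE iter_sigE /= iter_ktau !mulr_sumr.
rewrite exchange_big /=; apply: eq_bigr => j _.
rewrite horner_coef rmorph_sum mulr_suml; apply: eq_bigr => i _.
by rewrite !mulrA -!rmorphM /= lamD expfzDr // exprMn mulrA.
Qed.

Lemma dproj_psig k B (x : series K B) (l : seq int) (F : seq B) :
  exists2 p, {in l, forall m, p.[2%:R ^ m] = (m == k)%:R} &
             {in F, dproj k x =1 psig chD p x}.
Proof.
(* Near [F] the total degrees that occur are those of a basis element plus those of the components
   of its coefficient. The interpolation separates k from all of them and from the prescribed
   degrees [l]. *)
pose l' := l ++ flatten [seq [seq gdeg b + j | j <- ksupp (x b)] | b <- F].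
have [p hp] := interp [seq 2%:R ^ m | m <- l'] (fun q => (q == 2%:R ^ k)%:R).
have hp' m : m \in l' -> p.[2%:R ^ m] = (m == k)%:R.
  move=> ml; rewrite hp ?map_f //; congr (_%:R); congr nat_of_bool.
  by apply/eqP/eqP => [/pow2z_inj | ->].
exists p => [m ml|b bF]; first by apply: hp'; rewrite mem_cat ml.
rewrite psigDE /dproj; have [u1 u2 u3 u4] := kcompP (x b).
rewrite big_seq (eq_bigr (fun j => if j == k - gdeg b then kcomp (x b) j else 0)); last first.
  move=> j js; rewrite hp'; last first.
    rewrite mem_cat; apply/orP; right; apply/flattenP.
    by exists [seq gdeg b + j | j <- ksupp (x b)]; apply: map_f.
  rewrite [j == _]eq_sym subr_eq [_ == k]eq_sym addrC.
  by case: eqP => _; rewrite ?rmorph1 ?mul1r // rmorph0 mul0r.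
rewrite -big_seq -big_mkcond /= -big_filter.
have [h|h] := boolP (k - gdeg b \in ksupp (x b)).
  rewrite [X in \sum_(_ <- X) _](_ : _ = [:: k - gdeg b]) ?big_seq1 //.
  by rewrite -[RHS](filter_pred1_uniq u1 h).
rewrite u3 // big_filter big1_seq // => j /andP[/eqP ->].
by rewrite (negbTE h).
Qed.

(** A homogeneous representative of an eigenvector is the degree k part of any representative: that
    part is a limit of polynomials in the rescaling with value 1 at 2^k. *)
Lemma homogP P k (x : el P) : good P ->
  homog k x <-> Sg chD x = qk K (2%:R ^ k) *: x.
Proof.
move=> gP; split.
  move=> [r [hr <-] h]; rewrite Sg_cls // -clsZ //; congr (cls P _).
  apply: funext => b; rewrite -[RHS]/(_ * _) /sig /= (ktau_homog (h b)) lamD mulrA.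
  by rewrite -rmorphM /= -expfzDr // addrC subrK.
have [r hr ->] := elP x => e; exists (dproj k r); last first.
  by move=> b; case: (kcompP (r b)).
split; last first.
  rewrite (@eig_limit _ _ _ _ 1 _ gP hr e) ?rmorph1 ?scale1r // => F.
  have [p hp hF] := dproj_psig k r [:: k] F; exists p => //.
  by rewrite hp ?inE // eqxx.
case: (@limit_mem chD P r (dproj k r) gP) => [F|]; last by move=> h _; exact: h.
by have [p _ hF] := dproj_psig k r [::] F; exists p.
Qed.

Lemma homog_dense P (A : set (el P)) : good P -> eclosed A -> A 0 ->
  (forall x y, A x -> A y -> A (x + y)) ->
  (forall k x, homog k x -> A x) -> forall x, A x.
Proof.
move=> gP cA A0 AD Ah; apply: el_add_ind => // [|r hr F]; first by case: gP.
have hd k : pmem (dproj k r).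
  case: (@limit_mem chD P r (dproj k r) gP) => [G|]; last by move=> h _; exact: h.
  by have [p _ hF] := dproj_psig k r [::] G; exists p.
have hA k : A (cls P (dproj k r)).
  apply: (Ah k); exists (dproj k r) => // b; by case: (kcompP (r b)).
pose l := undup (flatten [seq [seq gdeg b + j | j <- ksupp (r b)] | b <- F]).
exists (\sum_(k <- l) dproj k r).
  split; first by apply: submod_sum => //; exact: pmem_submod.
  by rewrite cls_sum //; elim/big_ind: _.
move=> b bF; rewrite series_sumE /dproj; have [u1 u2 u3 u4] := kcompP (r b).
rewrite {1}u4.
rewrite -[RHS](big_map (fun k => k - gdeg b) xpredT (kcomp (r b))).
apply: big_extend => //.
  by rewrite map_inj_uniq ?undup_uniq // => i j /addIr.
move=> j js; apply/mapP; exists (gdeg b + j); last by rewrite addrC addKr.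
rewrite mem_undup; apply/flattenP.
by exists [seq gdeg b + j | j <- ksupp (r b)]; apply: map_f.
Qed.

Lemma clW : clinear chW. Proof. by []. Qed.
Lemma clF : clinear chF. Proof. by []. Qed.
Section Weights.
Variable P : pmod K.
Hypothesis gP : good P.
Implicit Types x y : el P.

Lemma wp_clin w : continuous_linear (@wp w P).
Proof. exact: kd_clin. Qed.

Lemma wp_eig w v x : Sg chW x = qk K (2%:R ^+ v) *: x ->
  wp w x = if v == w then x else 0.
Proof.
move=> e; rewrite /wp (kd_eig _ gP clW e).
have -> : (2%:R ^+ v == 2%:R ^+ w :> rat) = (v == w).
  by apply/eqP/eqP => [/pow2_inj | ->].
by case: eqP => _; rewrite ?rmorph1 ?scale1r // rmorph0 scale0r.
Qed.

Lemma Sg_wp w x : Sg chW (wp w x) = qk K (2%:R ^+ w) *: wp w x.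
Proof.
have [r hr ->] := elP x; rewrite /wp kd_cls //.
have h : pmem (kdiag chW (fun q => (q == 2%:R ^+ w)%:R) r).
  by case: (kdiag_mem (fun q => (q == 2%:R ^+ w)%:R) gP clW r) => h _; exact: h.
rewrite Sg_cls // -clsZ //; congr (cls P _); apply: funext => b.
rewrite -[RHS]/(_ * _) /sig /kdiag /=.
by case: eqP => [->|_]; rewrite ?rmorph0 ?mul0r ?mulr0.
Qed.

Lemma wp_wp w v x : wp w (wp v x) = if v == w then wp v x else 0.
Proof. exact: wp_eig (Sg_wp _ _). Qed.

Lemma wp_id w x : Sg chW x = qk K (2%:R ^+ w) *: x <-> wp w x = x.
Proof.
split=> [h|<-]; last exact: Sg_wp.
by rewrite (wp_eig _ h) eqxx.
Qed.

Lemma wt_dense (A : set (el P)) : eclosed A -> A 0 ->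
  (forall x y, A x -> A y -> A (x + y)) ->
  (forall w x, Sg chW x = qk K (2%:R ^+ w) *: x -> A x) -> forall x, A x.
Proof.
move=> cA A0 AD Ah; apply: el_add_ind => // [|r hr F]; first by case: gP.
pose c w := kdiag chW (fun q => (q == 2%:R ^+ w)%:R) r.
have hc w : pmem (c w).
  by case: (kdiag_mem (fun q => (q == 2%:R ^+ w)%:R) gP clW r) => h _; exact: h.
pose l := undup [seq gwt b | b <- F].
exists (\sum_(w <- l) c w).
  split; first by apply: submod_sum => //; exact: pmem_submod.
  rewrite cls_sum //; elim/big_ind: _ => // w _; apply: (Ah w).
  by rewrite -kd_cls //; exact: Sg_wp.
move=> b bF; rewrite series_sumE (bigD1_seq (gwt b)) ?undup_uniq ?mem_undup ?map_f //=.
rewrite /c /kdiag lamW eqxx rmorph1 mul1r big1 ?addr0 // => w wb.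
case: eqP => [/pow2_inj e|_]; first by rewrite e eqxx in wb.
by rewrite rmorph0 mul0r.
Qed.

(** The weights met by [F] are finite in number. Subtracting these components, whose classes vanish,
    produces a representative that is zero on [F]. *)
Lemma wp_inj x : (forall w, wp w x = 0) -> x = 0.
Proof.
pose A := [set y : el P | forall F, (forall w, near_zero F (wp w y)) -> near_zero F y].
move=> h; apply: haus; first by case: gP.
have [r hr e] := elP x => F; rewrite e.
pose c w := kdiag chW (fun q => (q == 2%:R ^+ w)%:R) r.
have hc w : pmem (c w).
  by case: (kdiag_mem (fun q => (q == 2%:R ^+ w)%:R) gP clW r) => h' _; exact: h'.
pose l := undup [seq gwt b | b <- F].
have pS : pmem (\sum_(w <- l) c w) by apply: submod_sum => //; exact: pmem_submod.
have e0 : cls P (\sum_(w <- l) c w) = 0.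
  rewrite cls_sum // big1 // => w _; rewrite -kd_cls // -e; exact: h.
rewrite -[cls P r]subr0 -e0 -clsB //; apply: nz_cls.
  by apply: submodB => //; exact: pmem_submod.
move=> b bF; rewrite -[LHS]/(r b - _ b).
rewrite series_sumE (bigD1_seq (gwt b)) ?undup_uniq ?mem_undup ?map_f //=.
rewrite /c /kdiag lamW eqxx rmorph1 mul1r big1 ?addr0 ?subrr // => w wb.
case: eqP => [/pow2_inj e'|_]; first by rewrite e' eqxx in wb.
by rewrite rmorph0 mul0r.
Qed.

Lemma supp_wtP (p : pred nat) x :
  supported (fun b => p (gwt b)) x <-> (forall w, ~~ p w -> wp w x = 0).
Proof.
split.
  move=> [r [hr <-] h] w pw; rewrite /wp kd_cls // -[RHS]cls0; congr (cls P _).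
  apply: funext => b; rewrite /kdiag lamW.
  have [->|/h pb] := eqVneq (r b) 0; first by rewrite mulr0.
  case: eqP => [/pow2_inj e|_]; first by rewrite e (negbTE pw) in pb.
  by rewrite rmorph0 mul0r.
move=> h; have [r hr e] := elP x.
pose s : series K (pidx P) := fun b => if p (gwt b) then r b else 0.
(* Truncating a representative to the weights in [p] is the functional calculus for the indicator
   function of the corresponding powers of 2, so the truncation is again a member. *)
pose f q := (`[< exists2 w, p w & q = 2%:R ^+ w >] : nat)%:R : rat.
have f2 w : f (2%:R ^+ w) = (p w)%:R.
  rewrite /f; congr (_%:R); congr nat_of_bool; apply/asboolP/idP => [[v pv e2]|pw].
    by rewrite (pow2_inj e2).
  by exists w.
have es : s = kdiag chW f r.
  apply: funext => b; rewrite /kdiag lamW f2 /s; case: (p _).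
    by rewrite rmorph1 mul1r.
  by rewrite rmorph0 mul0r.
have hs : pmem s by rewrite es; case: (kdiag_mem f gP clW r) => h' _; exact: h'.
exists s; last by move=> b; rewrite /s; case: (p _) => //; rewrite eqxx.
split=> //; apply/eqP; rewrite -subr_eq0; apply/eqP; apply: wp_inj => w.
rewrite (caddB (clin_cadd (wp_clin w))) es -kd_cls // -e /wp kd_kd //.
have [pw|pw] := boolP (p w); last first.
  have -> : kd chW (fun q => (q == 2 ^+ w)%:R * f q) x = 0.
    have -> : (fun q : rat => (q == 2 ^+ w)%:R * f q) = fun q => f q * (q == 2 ^+ w)%:R.
      by apply: funext => q; rewrite mulrC.
    rewrite -kd_kd // -[kd chW (fun q => (q == 2 ^+ w)%:R) x]/(wp w x) h //.
    exact: (cadd0 (clin_cadd (kd_clin _ gP clW))).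
  by rewrite -[kd chW _ x]/(wp w x) h // subrr.
apply/eqP; rewrite subr_eq0; apply/eqP; congr (kd chW _ x); apply: funext => q.
by case: eqP => [->|_]; rewrite ?f2 ?pw ?mulr1 // mul0r.
Qed.

Lemma supp_wt1 w x : supported (fun b => gwt b == w) x <->
  Sg chW x = qk K (2%:R ^+ w) *: x.
Proof.
split.
  move=> [r [hr <-] h]; rewrite Sg_cls // -clsZ //; congr (cls P _).
  apply: funext => b; rewrite -[RHS]/(_ * _) /sig /= lamW.
  by have [->|/h /eqP ->] := eqVneq (r b) 0; rewrite ?mulr0.
move=> e; apply/(supp_wtP (fun v => v == w)) => v vw.
by rewrite (wp_eig _ e) eq_sym (negbTE vw).
Qed.

Lemma supp_fd1 i x : supported (fun b => gfd b == i) x <->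
  Sg chF x = qk K (2%:R ^+ i) *: x.
Proof.
split.
  move=> [r [hr <-] h]; rewrite Sg_cls // -clsZ //; congr (cls P _).
  apply: funext => b; rewrite -[RHS]/(_ * _) /sig /= lamF.
  by have [->|/h /eqP ->] := eqVneq (r b) 0; rewrite ?mulr0.
have [r hr ->] := elP x => e.
pose f (q : rat) := (q == 2%:R ^+ i)%:R : rat.
have h : pmem (kdiag chF f r) by case: (kdiag_mem f gP clF r) => h _; exact: h.
exists (kdiag chF f r).
  by split=> //; rewrite -kd_cls // (kd_eig _ gP clF e) /f eqxx rmorph1 scale1r.
move=> b; apply: contraR => nb; rewrite /kdiag lamF /f.
case: (2%:R ^+ gfd b =P 2%:R ^+ i :> rat) => [e'|_]; last by rewrite rmorph0 mul0r.
by rewrite (pow2_inj e') eqxx in nb.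
Qed.

(** A nonzero coefficient has even degree, so every basis element occurring in a homogeneous
    representative has the parity of i. *)
Lemma par_homog k i x : homog i x -> Sg (chP k) x = ksign K (k * i) *: x.
Proof.
move=> [r [hr <-] h]; rewrite Sg_cls // -clsZ //; congr (cls P _).
apply: funext => b; rewrite -[RHS]/(_ * _) /sig /=.
have [->|r0] := eqVneq (r b) 0; first by rewrite !mulr0.
congr (_ * _); rewrite lamP /ksign.
have ob := er_gr_odd (h b) r0.
have -> : (-1 : rat) ^ (k * gdeg b) = (-1) ^+ `|(k * gdeg b)%R|%N.
  case: (k * gdeg b)%R => n //; rewrite NegzE -exprz_inv invrN1.
  by rewrite -exprnP abszN.
rewrite rmorphXn rmorphN1 -[LHS]signr_odd -[RHS]signr_odd.
congr (_ ^+ nat_of_bool _); rewrite !abszM !oddM; congr andb.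
by move: ob; lia.
Qed.

End Weights.

End Projections.

(** * Signs and free Lie algebras *)

Section Parity.
Variable K : evenRing.
Implicit Types (B C D : gset) (P Q : pmod K).

Lemma qk_signz k : qk K ((-1) ^ k) = ksign K k.
Proof.
have -> : (-1 : rat) ^ k = (-1) ^+ `|k|%N.
  by case: k => n //; rewrite NegzE -exprz_inv invrN1 -exprnP abszN.
by rewrite rmorphXn rmorphN1.
Qed.

Lemma ksign_odd k : ksign K k = (-1) ^+ (odd `|k|%N).
Proof. by rewrite /ksign -signr_odd. Qed.

Lemma ksignM k l : ksign K (k + l) = ksign K k * ksign K l.
Proof. by rewrite -!qk_signz expfzDr ?oppr_eq0 ?oner_eq0 // rmorphM. Qed.

Lemma ksignMK k : ksign K k * ksign K k = 1.
Proof. by rewrite ksign_odd; case: odd; rewrite ?expr1 ?expr0 ?mulr1 // mulrNN mulr1. Qed.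

Lemma sigPE k B (x : series K B) b : sig (chP K k) x b = ksign K (k * gdeg b) * x b.
Proof. by rewrite /sig lamP qk_signz. Qed.

Definition epar (p : bool) B (x : series K B) :=
  forall b, odd `|gdeg b|%N != p -> x b = 0.

Lemma ppart_epar p B (x : series K B) : epar p (ppart p x).
Proof. by move=> b; rewrite /ppart => /negbTE ->. Qed.

Lemma ppart_id p q B (x : series K B) : epar p x ->
  ppart q x = if q == p then x else 0.
Proof.
move=> h; apply: funext => b; rewrite /ppart; case: (eqVneq q p) => [->|qp].
  by case: ifP => // /negbT /h.
by case: eqP => // e; apply: h; rewrite e.
Qed.

Lemma ppart_sum B (x : series K B) : x = ppart false x + ppart true x.
Proof.
apply: funext => b; rewrite -[RHS]/(ppart false x b + ppart true x b) /ppart.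
by case: odd; rewrite /= ?addr0 ?add0r.
Qed.

(** The parity projections are the two spectral projections of an involution, which is possible as 2
    is invertible. Hence they preserve each submodule stable under rescaling. *)
Lemma ppart_sig p B (x : series K B) :
  ppart p x = qk K 2%:R^-1 *: (x + (-1) ^+ p *: sig (chP K 1) x).
Proof.
apply: funext => b; rewrite -[RHS]/(_ * (x b + _ * sig _ x b)) sigPE mul1r ksign_odd /ppart.
have e2 : qk K 2%:R^-1 * (x b + x b) = x b.
  have -> : x b + x b = qk K 2%:R * x b by rewrite rmorph_nat mulr2n mulrDl mul1r.
  by rewrite qkVK.
case: odd; case: p => /=; rewrite ?expr0 ?expr1 ?mul1r ?mulN1r ?opprK ?e2 //.
  by rewrite subrr mulr0.
by rewrite subrr mulr0.
Qed.

Lemma sigP_epar p B (x : series K B) k : epar p x ->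
  sig (chP K k) x = (-1) ^+ (odd `|k|%N && p) *: x.
Proof.
move=> h; apply: funext => b; rewrite sigPE -[RHS]/(_ * _).
have [e|/h ->] := eqVneq (odd `|gdeg b|%N) p; last by rewrite !mulr0.
by rewrite ksign_odd abszM oddM e.
Qed.

Lemma eparP p B (x : series K B) : epar p x <-> sig (chP K 1) x = (-1) ^+ p *: x.
Proof.
split=> [/sigP_epar -> //|h].
have <- : ppart p x = x; last exact: ppart_epar.
rewrite ppart_sig h scalerA -expr2 sqrr_sign scale1r.
apply: funext => b; rewrite -[LHS]/(_ * (x b + x b)).
have -> : x b + x b = qk K 2%:R * x b by rewrite rmorph_nat mulr2n mulrDl mul1r.
by rewrite qkVK.
Qed.

Lemma ppart_pmem P p x : good P -> @pmem K P x -> @pmem K P (ppart p x).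
Proof.
move=> gP hx; rewrite ppart_sig; apply: submodZ; first exact: pmem_submod.
apply: submodD; [exact: pmem_submod | by [] |].
by apply: submodZ; [exact: pmem_submod | exact: good_pmem].
Qed.

Lemma ppart_prel P p x : good P -> @prel K P x -> @prel K P (ppart p x).
Proof.
move=> gP hx; rewrite ppart_sig; apply: submodZ; first exact: prel_submod.
apply: submodD; [exact: prel_submod | by [] |].
by apply: submodZ; [exact: prel_submod | exact: good_prel].
Qed.

Lemma gswap_epar B C D (m : series K C -> series K B -> series K D) p q x y :
  bifin m -> epar p x -> epar q y -> gswap m x y = (-1) ^+ (p && q) *: m y x.
Proof.
move=> [m1 m2] hx hy; rewrite /gswap !big_bool !(ppart_id _ hx) !(ppart_id _ hy).
by case: p {hx}; case: q {hy};
  rewrite /= ?(rfin0 (m1 _)) ?(rfin0 (m2 _)) ?scaler0 ?addr0 ?add0r.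
Qed.

Lemma tcomm_epar B p q (x y : series K (words B)) : epar p x -> epar q y ->
  tcomm x y = tmul x y - (-1) ^+ (p && q) *: tmul y x.
Proof. by move=> hx hy; rewrite /tcomm (gswap_epar (@tmul_bifin K B) hx hy). Qed.

Lemma gswap_mem B C D (m : series K C -> series K B -> series K D)
   (X : set (series K B)) (Y : set (series K C)) (H : set (series K D)) x y :
  submod H -> (forall p, X (ppart p x)) -> (forall q, Y (ppart q y)) ->
  (forall x y, X x -> Y y -> H (m y x)) -> H (gswap m x y).
Proof.
move=> mH hx hy h; apply: submod_sum => // p _ _; apply: submod_sum => // q _ _.
by apply: submodZ => //; exact: h.
Qed.

Lemma hspan_eq B C (f h : series K B -> series K C) S : rfin f -> rfin h ->
  (forall x, S x -> f x = h x) -> forall x, hspan S x -> f x = h x.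
Proof.
move=> hf hh e x hx; apply/eqP; rewrite -subr_eq0; apply/eqP.
apply: (@hspan_map K _ _ (fun x => f x - h x) S [set z | z = 0]) hx.
- exact: rfin_sub.
- by split=> // a y z -> ->; rewrite scaler0 addr0.
- move=> y h'; apply: funext => b; have [z -> e'] := h' [:: b].
  by rewrite -e' ?inE.
- by move=> z /e /= ->; rewrite subrr.
Qed.

(** * Members and relations of the completed tensor algebra and its Lie algebra *)

Section TensAlg.
Variable P : pmod K.
Hypothesis gP : good P.
Notation T := (tensalg_pmod P).

Lemma tcons_pmem x F : @pmem K P x -> @pmem K T F -> @pmem K T (tcons x F).
Proof.
move=> hx; have [h _] := @tcons_bifin K (pidx P).
apply: (hspan_map (h x)); [exact: hspan_submod | exact: hspan_sclosed |].
move=> _ [xs hxs ->]; rewrite -pure_cons; apply: sub_hspan; exists (x :: xs) => //.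
by move=> y; rewrite inE => /predU1P[->|/hxs].
Qed.

Lemma tcons_prell x F : @pmem K P x -> @prel K P x -> @pmem K T F -> @prel K T (tcons x F).
Proof.
move=> px hx; have [h _] := @tcons_bifin K (pidx P).
apply: (hspan_map (h x)); [exact: hspan_submod | exact: hspan_sclosed |].
move=> _ [xs hxs ->]; rewrite -pure_cons; apply: sub_hspan; exists (x :: xs); split=> //.
  by move=> y; rewrite inE => /predU1P[->|/hxs].
by exists x => //; rewrite inE eqxx.
Qed.

Lemma tcons_prelr x F : @pmem K P x -> @prel K T F -> @prel K T (tcons x F).
Proof.
move=> hx; have [h _] := @tcons_bifin K (pidx P).
apply: (hspan_map (h x)); [exact: hspan_submod | exact: hspan_sclosed |].
move=> _ [xs [hxs [z zxs raises] ->]]; rewrite -pure_cons; apply: sub_hspan; exists (x :: xs).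
split=> //; first by move=> y; rewrite inE => /predU1P[->|/hxs].
by exists z => //; rewrite inE zxs orbT.
Qed.

Lemma pure_pmem xs : {in xs, forall x, @pmem K P x} -> @pmem K T (pure xs).
Proof. by move=> h; apply: sub_hspan; exists xs. Qed.

Lemma tmul_pmem x y : @pmem K T x -> @pmem K T y -> @pmem K T (tmul x y).
Proof.
move=> hx hy; apply: (hspan_bilin (@tmul_bifin K _) _ _ _ hx hy); [exact: hspan_submod | exact: hspan_sclosed |].
move=> _ _ [xs hxs ->] [ys hys ->]; rewrite tmul_pure; apply: pure_pmem => z.
by rewrite mem_cat => /orP[/hxs|/hys].
Qed.

Lemma tmul_prell x y : @prel K T x -> @pmem K T y -> @prel K T (tmul x y).
Proof.
move=> hx hy; apply: (hspan_bilin (@tmul_bifin K _) _ _ _ hx hy); [exact: hspan_submod | exact: hspan_sclosed |].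
move=> _ _ [xs [hxs [u uxs ru] ->]] [ys hys ->]; rewrite tmul_pure; apply: sub_hspan.
exists (xs ++ ys); split=> //; first by move=> z; rewrite mem_cat => /orP[/hxs|/hys].
by exists u => //; rewrite mem_cat uxs.
Qed.

Lemma tmul_prelr x y : @pmem K T x -> @prel K T y -> @prel K T (tmul x y).
Proof.
move=> hx hy; apply: (hspan_bilin (@tmul_bifin K _) _ _ _ hx hy); [exact: hspan_submod | exact: hspan_sclosed |].
move=> _ _ [xs hxs ->] [ys [hys [u uxs ru] ->]]; rewrite tmul_pure; apply: sub_hspan.
exists (xs ++ ys); split=> //; first by move=> z; rewrite mem_cat => /orP[/hxs|/hys].
by exists u => //; rewrite mem_cat uxs orbT.
Qed.

Lemma tcomm_tpmem x y : @pmem K T x -> @pmem K T y -> @pmem K T (tcomm x y).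
Proof.
move=> hx hy; have gT := good_tensalg gP.
rewrite /tcomm; apply: (submodB (@pmem_submod K T)); first exact: tmul_pmem.
apply: (@gswap_mem (pidx T) (pidx T) (pidx T) (@tmul K (pidx P)) (@pmem K T) (@pmem K T) (@pmem K T)); first exact: pmem_submod.
- by move=> p; exact: ppart_pmem.
- by move=> p; exact: ppart_pmem.
- by move=> u v hu hv; exact: tmul_pmem.
Qed.

Lemma tcomm_tprell x y : @prel K T x -> @pmem K T y -> @prel K T (tcomm x y).
Proof.
move=> hx hy; have gT := good_tensalg gP.
rewrite /tcomm; apply: (submodB (@prel_submod K T)); first exact: tmul_prell.
apply: (@gswap_mem (pidx T) (pidx T) (pidx T) (@tmul K (pidx P)) (@prel K T) (@pmem K T) (@prel K T)); first exact: prel_submod.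
- by move=> p; exact: ppart_prel.
- by move=> p; exact: ppart_pmem.
- by move=> u v hu hv; exact: tmul_prelr.
Qed.

Lemma tcomm_tprelr x y : @pmem K T x -> @prel K T y -> @prel K T (tcomm x y).
Proof.
move=> hx hy; have gT := good_tensalg gP.
rewrite /tcomm; apply: (submodB (@prel_submod K T)); first exact: tmul_prelr.
apply: (@gswap_mem (pidx T) (pidx T) (pidx T) (@tmul K (pidx P)) (@pmem K T) (@prel K T) (@prel K T)); first exact: prel_submod.
- by move=> p; exact: ppart_pmem.
- by move=> p; exact: ppart_prel.
- by move=> u v hu hv; exact: tmul_prell.
Qed.

Lemma lie_tensalg x : @pmem K (lie_pmod P) x -> @pmem K T x.
Proof.
apply: hspan_min; [exact: hspan_submod | exact: hspan_sclosed |].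
move=> z; elim=> [u hu|u v _ IHu _ IHv]; last exact: tcomm_tpmem.
by apply: pure_pmem => w; rewrite inE => /eqP ->.
Qed.

Lemma lie_tcomm x y : @pmem K (lie_pmod P) x -> @pmem K (lie_pmod P) y ->
  @pmem K (lie_pmod P) (tcomm x y).
Proof.
move=> hx hy; apply: (hspan_bilin (@tcomm_bifin K _) _ _ _ hx hy); [exact: hspan_submod | exact: hspan_sclosed |].
by move=> u v hu hv; apply: sub_hspan; exact: lie_br.
Qed.

Lemma lie_prell x y : @prel K (lie_pmod P) x -> @pmem K (lie_pmod P) y ->
  @prel K (lie_pmod P) (tcomm x y).
Proof.
move=> [h1 h2] hy; split; first exact: lie_tcomm.
by apply: tcomm_tprell => //; exact: lie_tensalg.
Qed.

Lemma lie_prelr x y : @pmem K (lie_pmod P) x -> @prel K (lie_pmod P) y ->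
  @prel K (lie_pmod P) (tcomm x y).
Proof.
move=> hx [h1 h2]; split; first exact: lie_tcomm.
by apply: tcomm_tprelr => //; exact: lie_tensalg.
Qed.

Lemma lie_gen_mem x : @pmem K P x -> @pmem K (lie_pmod P) (pure [:: x]).
Proof. by move=> hx; apply: sub_hspan; exact: lie_gen. Qed.

End TensAlg.

Lemma tens0l B C (y : series K C) : tens (0 : series K B) y = 0.
Proof. by apply: funext => b; rewrite /tens mul0r. Qed.
Lemma tens0r B C (x : series K B) : tens x (0 : series K C) = 0.
Proof. by apply: funext => b; rewrite /tens mulr0. Qed.
Lemma tcons0l B F : tcons (0 : series K B) F = 0.
Proof. by apply: funext => -[|b w] //=; rewrite mul0r. Qed.
Lemma tcons0r B (x : series K B) : tcons x 0 = 0.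
Proof. by apply: funext => -[|b w] //=; rewrite mulr0. Qed.

Lemma pure_has0 B (xs : seq (series K B)) : 0 \in xs -> pure xs = 0.
Proof.
elim: xs => // x xs IH; rewrite inE pure_cons => /predU1P[<-|/IH ->].
  exact: tcons0l.
exact: tcons0r.
Qed.

Lemma hspan_zero B (S : set (series K B)) : (forall x, S x -> x = 0) ->
  forall x, hspan S x -> x = 0.
Proof. exact: (hspan_eq (@rfin_id K B) (@rfin_cst0 K B B)). Qed.

End Parity.

Lemma zoddD (x y : int) : odd `|(x + y)%R|%N = odd `|x|%N (+) odd `|y|%N.
Proof. lia. Qed.

(** * The Lie de Rham complex *)

Section Modules.
Variables (K : evenRing) (V : fgmod).
Notation W := (Wmod K V).
Notation U := (Umod K V).
Notation G := (gLie K V).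
Notation O1 := (Omega1 K V).
Notation D1 := (desusp_pmod (Omega1 K V)).
Notation T1 := (tensalg_pmod (desusp_pmod (Omega1 K V))).
Notation L1 := (LOmega1 K V).
Notation Om := (Omega K V).

Lemma good_W : good W. Proof. exact: good_free. Qed.
Lemma good_U : good U. Proof. exact/good_tensalg/good_W. Qed.
Lemma good_G : good G. Proof. exact/good_lie/good_W. Qed.

Lemma relW0 x : @prel K W x -> x = 0. Proof. exact: hspan0. Qed.
Lemma relU0 x : @prel K U x -> x = 0.
Proof.
apply: hspan_zero => _ [xs [_ [z zxs /relW0 z0] ->]].
by apply: pure_has0; rewrite -z0.
Qed.
Lemma relG0 x : @prel K G x -> x = 0. Proof. by case=> _ /relU0. Qed.
Lemma relUG0 x : @prel K (tens_pmod U G) x -> x = 0.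
Proof.
apply: hspan_zero => _ [y [z [_ _ h ->]]].
by case: h => [/relU0 ->|/relG0 ->]; [exact: tens0l | exact: tens0r].
Qed.

Lemma G_sub_U x : @pmem K G x -> @pmem K U x.
Proof. exact: (lie_tensalg good_W). Qed.

(** The free Lie algebra is a quotient by zero, so its classes have unique representatives; this is
    what makes [inO] and [oneform] computable on series. *)
Lemma repG r : @pmem K G r -> rep (cls G r) = r.
Proof.
move=> hr; have /relG0 := rep_cls hr.
by move/eqP; rewrite subr_eq0 => /eqP.
Qed.

Lemma good_O1 : good O1.
Proof.
apply: good_quot; first by apply: good_tens; [exact: good_U | exact: good_G].
move=> chi _ [i [j [x [y [z [hx [hy sy] [hz sz] ->]]]]]].
exists i, j, (sig chi x), (sig chi y), (sig chi z); split.
- exact: (good_pmem chi good_U hx).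
- by split; [exact: (good_pmem chi good_G hy) | exact: shomog_sig].
- by split; [exact: (good_pmem chi good_G hz) | exact: shomog_sig].
- rewrite sigD sigB sigZ !sig_tens sig_tcomm !sig_tmul.
  by rewrite /ksign rmorphXn rmorphN1.
Qed.

Lemma good_D1 : good D1. Proof. exact/good_desusp/good_O1. Qed.
Lemma good_T1 : good T1. Proof. exact/good_tensalg/good_D1. Qed.
Lemma good_L1 : good L1. Proof. exact/good_lie/good_D1. Qed.
Lemma good_Om : good Om.
Proof. by apply: good_sum; [exact: good_G | exact: good_L1]. Qed.

(** The effect of [lact] on a single factor. The sign comes from moving [y] past the desuspension;
    on tensors this is ordinary left multiplication by [y] twisted by the parity operator. *)
Definition lmul (y : series K (pidx U)) (t : series K (pidx O1)) : series K (pidx O1) :=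
  fun b => \sum_(k < (size b.1).+1)
    ksign K (@gdeg (pidx U) (take k b.1)) * y (take k b.1) * t (drop k b.1, b.2).

Lemma lmul_bifin : bifin lmul.
Proof.
split=> z [u v]; rewrite /lmul; apply: ffl_sum => k _.
  by apply: ffl_mull; exact: (@ffl_ev K (pidx O1)).
by apply: ffl_mulr; apply: ffl_mull; exact: (@ffl_ev K (pidx U)).
Qed.

Lemma lmul_tens y x z : lmul y (tens x z) = tens (tmul (sig (chP K 1) y) x) z.
Proof.
apply: funext => -[u v]; rewrite /lmul /tens /tmul /= mulr_suml.
by apply: eq_bigr => k _; rewrite sigPE mul1r !mulrA.
Qed.

Lemma tmul_assoc (P : pmod K) x y z : @pmem K (tensalg_pmod P) x ->
  @pmem K (tensalg_pmod P) y -> @pmem K (tensalg_pmod P) z ->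
  tmul (tmul x y) z = tmul x (tmul y z).
Proof.
move=> hx hy hz; have [m1 m2] := @tmul_bifin K (pidx P).
apply: (hspan_eq (f := fun x => tmul (tmul x y) z) (h := fun x => tmul x (tmul y z)) _ _ _ hx).
- exact: (rfin_comp (m2 y) (m2 z)).
- exact: (m2 _).
move=> _ [xs hxs ->].
apply: (hspan_eq (f := fun y => tmul (tmul (pure xs) y) z)
   (h := fun y => tmul (pure xs) (tmul y z)) _ _ _ hy).
- exact: (rfin_comp (m1 _) (m2 z)).
- exact: (rfin_comp (m2 _) (m1 _)).
move=> _ [ys hys ->].
apply: (hspan_eq (f := fun z => tmul (tmul (pure xs) (pure ys)) z)
   (h := fun z => tmul (pure xs) (tmul (pure ys) z)) _ _ _ hz).
- exact: (m1 _).
- exact: (rfin_comp (m1 _) (m1 _)).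
by move=> _ [zs hzs ->]; rewrite !tmul_pure catA.
Qed.

Lemma lmul_pmem y t : @pmem K U y -> @pmem K O1 t -> @pmem K O1 (lmul y t).
Proof.
move=> hy; have [m1 m2] := lmul_bifin.
apply: (hspan_map (m1 y)); [exact: hspan_submod | exact: hspan_sclosed |].
move=> _ [x [z [hx hz ->]]]; rewrite lmul_tens; apply: sub_hspan.
exists (tmul (sig (chP K 1) y) x), z; split=> //.
by apply: tmul_pmem hx; exact: (good_pmem _ good_U).
Qed.

Lemma lmul_prel y t : @pmem K U y -> @prel K O1 t -> @prel K O1 (lmul y t).
Proof.
move=> hy; have [m1 m2] := lmul_bifin.
apply: (hspan_map (m1 y)); [exact: hspan_submod | exact: hspan_sclosed |].
move=> s [/relUG0 ->|]; first by rewrite (rfin0 (m1 y)); exact: hspan_0.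
move=> [i [j [x [y' [z [hx [hy' sy] [hz sz] ->]]]]]].
apply: sub_hspan; right; have hsy := good_pmem (chP K 1) good_U hy.
exists i, j, (tmul (sig (chP K 1) y) x), y', z; split=> //; first exact: tmul_pmem.
rewrite (rfinD (m1 y)) (rfinB (m1 y)) (rfinZ (m1 y)) !lmul_tens.
by rewrite !tmul_assoc //; exact: G_sub_U.
Qed.

Notation lactO := (@lact K V).
Notation DW := (pidx L1).

Lemma set_nth_cut (T : Type) (d : T) s j b' : (j < size s)%N ->
  set_nth d s j b' = take j s ++ b' :: drop j.+1 s.
Proof. by move=> h; rewrite set_nthE h. Qed.

Lemma nth_cut (T : Type) (d : T) s j : (j < size s)%N ->
  s = take j s ++ nth d s j :: drop j.+1 s.
Proof. by move=> h; rewrite -drop_nth // cat_take_drop. Qed.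

Lemma lact_bifin : bifin lactO.
Proof.
split=> z s; rewrite /lact; apply: ffl_sum => j _; case: (nth _ s j) => u v;
  apply: ffl_sum => k _.
  by apply: ffl_mull; exact: (@ffl_ev K (pidx L1)).
by apply: ffl_mulr; apply: ffl_mull; exact: (@ffl_ev K (pidx U)).
Qed.

Lemma sig_lact chi y F : sig chi (lactO y F) = lactO (sig chi y) (sig chi F).
Proof.
apply: funext => s; rewrite /lact {1}/sig rmorph_sum mulr_sumr; apply: eq_bigr => j _.
case en : (nth _ s j) => [u v]; rewrite rmorph_sum mulr_sumr; apply: eq_bigr => k _.
have -> : lam chi (s : DW) =
   lam chi (take k u : pidx U) * lam chi (set_nth ([::], [::]) s j (drop k u, v) : DW).
  rewrite set_nth_cut // {1}(nth_cut ([::], [::]) (ltn_ord j)) en.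
  rewrite !lam_cat !lam_cons !lam_desusp !lam_pair -{1}(cat_take_drop k u) lam_cat.
  by rewrite -/(pidx U); ring.
have ek d : ctau chi (ksign K d) = ksign K d by rewrite /ksign rmorphXn rmorphN1.
rewrite /sig !(rmorphM (ctau chi)) ek (rmorphM (@qk K)).
by rewrite [LHS]mulrACA; congr (_ * _); rewrite mulrCA.
Qed.

Lemma lact_nil y : lactO y (pure [::]) = 0.
Proof.
apply: funext => s; rewrite /lact big1 // => j _; case: (nth _ s j) => u v.
rewrite big1 // => k _; rewrite pure_nil set_nth_cut //.
by rewrite -size_eq0 size_cat /= addnS mulr0.
Qed.

(** The Leibniz rule on the first factor of a word. Since [y] is supported on words of parity q, the
    degree of the prefix split off in [lact] may be replaced by q in the sign. *)
Lemma lact_cons q y t F : epar q y ->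
  lactO y (tcons t F) = tcons (lmul y t : series K (pidx D1)) F
     + tcons (sig (chP K q%:Z) t) (lactO y F).
Proof.
move=> hy; apply: funext => -[|[u v] s].
  by rewrite -[RHS]/(_ + _) /lact big_ord0 addr0.
rewrite -[RHS]/(_ * _ + _ * _) {1}/lact big_ord_recl /=; congr (_ + _).
  rewrite /lmul mulr_suml; apply: eq_bigr => k _ /=.
  by rewrite big_nil addr0 mulr1 mulrA.
rewrite /lact mulr_sumr; apply: eq_bigr => j _ /=.
case: (nth _ s j) => u' v'; rewrite mulr_sumr; apply: eq_bigr => k _.
rewrite sigPE /= !big_cons.
set d := \sum_(b <- take k u') _; set e := \sum_(b <- take j s) _.
have [h|h] := eqVneq (odd `|d|%N) q; last first.
  by rewrite (hy _ h) !(mulr0, mul0r).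
have -> : ksign K (d * (1 + (@gdeg (pidx D1) (u, v) + e))) =
   ksign K (q%:Z * @gdeg (pidx D1) (u, v)) * ksign K (d * (1 + e)).
  rewrite -ksignM !ksign_odd; congr (_ ^+ nat_of_bool _).
  rewrite !(abszM, oddM, zoddD) h /=.
  have -> : odd `|q%:Z|%N = q by case: q {hy h}.
  by case: q {hy h}; case: odd; case: odd.
rewrite -!mulrA; congr (_ * _); rewrite [RHS]mulrCA; congr (_ * _).
by rewrite [RHS]mulrCA.
Qed.
End Modules.

(** * The bracket of the semidirect product descends to classes *)

Section OmegaBracket.
Variables (K : evenRing) (V : fgmod).
Notation W := (Wmod K V).
Notation G := (gLie K V).
Notation D1 := (desusp_pmod (Omega1 K V)).
Notation T1 := (tensalg_pmod (desusp_pmod (Omega1 K V))).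
Notation L1 := (LOmega1 K V).
Notation Om := (Omega K V).
Notation lactO := (@lact K V).
Notation DW := (pidx L1).

Lemma bifin_post B C D E (m : series K B -> series K C -> series K D)
  (f : series K D -> series K E) : bifin m -> rfin f -> bifin (fun x y => f (m x y)).
Proof. by move=> [m1 m2] hf; split=> z; apply: rfin_comp hf. Qed.

Lemma bifin_parity B C D (m m' : series K B -> series K C -> series K D) x y :
  bifin m -> bifin m' ->
  (forall p q, m (ppart p x) (ppart q y) = m' (ppart p x) (ppart q y)) -> m x y = m' x y.
Proof.
move=> [m1 m2] [n1 n2] h; rewrite (ppart_sum x) (ppart_sum y).
rewrite (rfinD (m1 _)) (rfinD (n1 _)) (rfinD (m2 _)) (rfinD (m2 _)).
by rewrite (rfinD (n2 _)) (rfinD (n2 _)) !h.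
Qed.

Lemma sigP_rfin k B : rfin (@sig K (chP K k) B).
Proof.
move=> b; have e : (fun x : series K B => sig (chP K k) x b) =
    (fun x => qk K (lam (chP K k) b) * x b) by [].
by rewrite e; apply: ffl_mull; exact: ffl_ev.
Qed.

Lemma lact_pure_tmul q y xs H : epar q y ->
  lactO y (tmul (pure xs) H) = tmul (lactO y (pure xs)) H
    + tmul (sig (chP K q%:Z) (pure xs)) (lactO y H).
Proof.
move=> hy; have [m1 m2] := @tmul_bifin K (pidx D1).
have [c1 c2] := @tcons_bifin K (pidx D1).
elim: xs => [|x xs IH].
  by rewrite tmul_one lact_nil (rfin0 (m2 _)) add0r sig_pure tmul_one.
rewrite pure_cons tmul_cons !(lact_cons _ _ hy) IH (rfinD (c1 _)) (rfinD (m2 _)).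
by rewrite sig_tcons !tmul_cons addrA.
Qed.

Lemma lact_tmul q y F H : epar q y -> @pmem K T1 F ->
  lactO y (tmul F H) = tmul (lactO y F) H + tmul (sig (chP K q%:Z) F) (lactO y H).
Proof.
move=> hy hF; have [m1 m2] := @tmul_bifin K (pidx D1); have [l1 l2] := @lact_bifin K V.
have hs : rfin (@sig K (chP K q%:Z) DW) by exact: sigP_rfin.
apply: (hspan_eq (f := fun F => lactO y (tmul F H))
  (h := fun F => tmul (lactO y F) H + tmul (sig (chP K q%:Z) F) (lactO y H)) _ _ _ hF).
- exact: (rfin_comp (m2 H) (l1 y)).
- by apply: rfin_add; [exact: (rfin_comp (l1 y) (m2 H)) | exact: (rfin_comp hs (m2 _))].
by move=> _ [xs _ ->]; exact: lact_pure_tmul.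
Qed.

Lemma lact_epar q p y F : epar q y -> epar p F -> epar (q (+) p) (lactO y F).
Proof.
rewrite !eparP sig_lact => -> ->; have [l1 l2] := @lact_bifin K V.
by rewrite (rfinZ (l1 _)) (rfinZ (l2 _)) scalerA -signr_addb addbC.
Qed.

(** The graded derivation rule on products gives it on commutators. This is what keeps the action
    inside the free Lie algebra on the desuspended 1-forms, by induction on Lie monomials. *)
Lemma lact_tcomm q y F H : epar q y -> @pmem K T1 F -> @pmem K T1 H ->
  lactO y (tcomm F H) = tcomm (lactO y F) H + tcomm (sig (chP K q%:Z) F) (lactO y H).
Proof.
move=> hy hF hH; have [l1 l2] := @lact_bifin K V; have [t1 t2] := @tcomm_bifin K (pidx D1).
have [m1 m2] := @tmul_bifin K (pidx D1).
have b1 (a b c : bool) : (b && c) (+) (a && c) = (a (+) b) && c by case: a b c => [] [] [].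
have b2 (a b c : bool) : (a && b) (+) (b && (a (+) c)) = b && c by case: a b c => [] [] [].
have main p r F' H' : @pmem K T1 F' -> @pmem K T1 H' -> epar p F' -> epar r H' ->
    lactO y (tcomm F' H') = tcomm (lactO y F') H' + tcomm (sig (chP K q%:Z) F') (lactO y H').
  move=> pF pH eF eH.
  rewrite (tcomm_epar eF eH) (tcomm_epar (lact_epar hy eF) eH).
  have es : sig (chP K q%:Z) F' = (-1) ^+ (q && p) *: F'.
    by rewrite (sigP_epar _ eF); case: q {hy}.
  have es' : sig (chP K q%:Z) H' = (-1) ^+ (q && r) *: H'.
    by rewrite (sigP_epar _ eH); case: q {hy es}.
  rewrite es (rfinZ (t2 _)) (tcomm_epar eF (lact_epar hy eH)).
  rewrite (rfinB (l1 y)) (rfinZ (l1 y)) !(lact_tmul _ hy) // es es'.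
  rewrite !(rfinZ (m2 _)) scalerBr !scalerDr !scalerA.
  rewrite -!signr_addb.
  rewrite b1 b2.
  rewrite opprD [RHS]addrACA; congr (_ + _); exact: addrC.
have gT := good_T1 K V.
have hs : rfin (@sig K (chP K q%:Z) DW) by exact: sigP_rfin.
apply: (bifin_parity (m := fun F H => lactO y (tcomm F H))
   (m' := fun F H => tcomm (lactO y F) H + tcomm (sig (chP K q%:Z) F) (lactO y H))).
- by apply: bifin_post (l1 y); exact: tcomm_bifin.
- apply: bifin_add.
    by apply: (bifin_comp2 (@tcomm_bifin K _) (l1 y)); exact: rfin_id.
  by apply: (bifin_comp2 (@tcomm_bifin K _) hs (l1 y)).
by move=> p r; apply: (main p r); (try exact: ppart_epar); exact: ppart_pmem.
Qed.

Lemma lact_mem y F : @pmem K G y -> @pmem K L1 F -> @pmem K L1 (lactO y F).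
Proof.
move=> hy hF; have [l1 l2] := @lact_bifin K V.
suff main q z : epar q z -> @pmem K G z -> @pmem K L1 (lactO z F).
  rewrite (ppart_sum y) (rfinD (l2 _)); apply: (submodD (@pmem_submod K L1));
    by apply: main (@ppart_epar _ _ _ _) _; apply: ppart_pmem => //; exact: good_G.
move=> hz mz; apply: (hspan_map (l1 z) _ _ _ hF); try exact: hspan_submod; try exact: hspan_sclosed.
move=> s; elim=> [t ht|u v hu IHu hv IHv].
  rewrite pure_cons (lact_cons _ _ hz) lact_nil.
  have [c1 c2] := @tcons_bifin K (pidx D1).
  rewrite (rfin0 (c1 _)) addr0 -pure_cons; apply: lie_gen_mem.
  by apply: lmul_pmem ht; exact: G_sub_U.
have pu : @pmem K L1 u by exact: sub_hspan.
have pv : @pmem K L1 v by exact: sub_hspan.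
rewrite (lact_tcomm hz); try exact: (lie_tensalg (good_D1 K V)).
by apply: (submodD (@pmem_submod K L1)); apply: lie_tcomm => //; exact: (good_pmem _ (good_L1 K V)).
Qed.

(** Relations of the Lie algebra are those of the tensor algebra, so it suffices to let [y] act on a
    word with one factor a relation: either that factor is hit, and [lmul] preserves relations, or
    it survives. *)
Lemma lact_rel y F : @pmem K G y -> @prel K L1 F -> @prel K L1 (lactO y F).
Proof.
move=> hy [hF rF]; split; first exact: lact_mem.
have [l1 l2] := @lact_bifin K V; have [c1 c2] := @tcons_bifin K (pidx D1).
suff main q z : epar q z -> @pmem K G z -> @prel K T1 (lactO z F).
  rewrite (ppart_sum y) (rfinD (l2 _)); apply: (submodD (@prel_submod K T1));
    by apply: main (@ppart_epar _ _ _ _) _; apply: ppart_pmem => //; exact: good_G.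
move=> hz mz; have uz := G_sub_U mz.
apply: (hspan_map (l1 z) _ _ _ rF); try exact: hspan_submod; try exact: hspan_sclosed.
move=> _ [xs [hxs [x xxs rx] ->]].
have memp ys : {in ys, forall t, @pmem K D1 t} -> @pmem K T1 (lactO z (pure ys)).
  elim: ys => [|t ys IH] h.
    by rewrite lact_nil; exact: pmem0.
  have ht : @pmem K D1 t by apply: h; rewrite inE eqxx.
  have hys : {in ys, forall t, @pmem K D1 t} by move=> t' h'; apply: h; rewrite inE h' orbT.
  rewrite pure_cons (lact_cons _ _ hz); apply: (submodD (@pmem_submod K T1)).
    by apply: tcons_pmem; [exact: lmul_pmem | exact: pure_pmem].
  apply: tcons_pmem; last exact: IH.
  exact: (good_pmem _ (good_D1 K V)).
elim: xs hxs xxs => // t xs IH h xxs.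
have ht : @pmem K D1 t by apply: h; rewrite inE eqxx.
have hxs : {in xs, forall t, @pmem K D1 t} by move=> t' h'; apply: h; rewrite inE h' orbT.
have hst : @pmem K D1 (sig (chP K q%:Z) t) by exact: (good_pmem _ (good_D1 K V)).
rewrite pure_cons (lact_cons _ _ hz); apply: (submodD (@prel_submod K T1)).
  move: xxs; rewrite inE => /predU1P[e|xxs].
    apply: tcons_prell; [exact: lmul_pmem | | exact: pure_pmem].
    by apply: lmul_prel => //; rewrite -e.
  apply: tcons_prelr; first exact: lmul_pmem.
  by apply: sub_hspan; exists xs; split=> //; exists x.
move: xxs; rewrite inE => /predU1P[e|xxs].
  apply: tcons_prell => //; last exact: memp.
  by apply: (good_prel _ (good_D1 K V)); rewrite -e.
by apply: tcons_prelr => //; exact: IH.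
Qed.

Notation brO := (@Obr K V).

Lemma Obr_bifin : bifin brO.
Proof.
have -> : brO = fun x y => copair (tcomm (linl x) (linl y)) 0 +
  copair 0 (tcomm (linr x) (linr y) + lactO (linl x) (linr y)
     - gswap lactO (linr x) (linl y)).
  by apply: funext => x; apply: funext => y; rewrite /Obr copairE.
have hl := @linl_rfin K (pidx G) DW; have hr := @linr_rfin K (pidx G) DW.
apply: bifin_add.
  apply: (bifin_post _ (@copair_l_rfin K (pidx G) DW)).
  exact: (bifin_comp2 (@tcomm_bifin K _) hl hl).
apply: (bifin_post (m := fun x y => tcomm (linr x) (linr y) + lactO (linl x) (linr y)
     - gswap lactO (linr x) (linl y)) _ (@copair_r_rfin K (pidx G) DW)).
apply: bifin_sub; last exact: (bifin_comp2 (gswap_bifin (@lact_bifin K V)) hr hl).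
apply: bifin_add; first exact: (bifin_comp2 (@tcomm_bifin K _) hr hr).
exact: (bifin_comp2 (@lact_bifin K V) hl hr).
Qed.

Lemma sig_Obr chi x y : sig chi (brO x y) = brO (sig chi x) (sig chi y).
Proof.
rewrite /Obr sig_copair; congr copair; first exact: sig_tcomm.
rewrite sigB; congr (_ - _); last exact: (sig_gswap (@sig_lact K V chi)).
by rewrite sigD; congr (_ + _); [exact: sig_tcomm | exact: sig_lact].
Qed.

Lemma Obr_mem x y : @pmem K Om x -> @pmem K Om y -> @pmem K Om (brO x y).
Proof.
move=> [x1 x2] [y1 y2]; split; first exact: (lie_tcomm x1 y1).
apply: (submodB (@pmem_submod K L1)).
  apply: (submodD (@pmem_submod K L1)); [exact: lie_tcomm | exact: lact_mem].
apply: (@gswap_mem K _ _ _ lactO (@pmem K L1) (@pmem K G)); first exact: pmem_submod.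
- by move=> p; apply: ppart_pmem x2; exact: good_L1.
- by move=> p; apply: ppart_pmem y1; exact: good_G.
- by move=> u v hu hv; exact: lact_mem.
Qed.

Lemma Obr_rell x y : @pmem K Om x -> @prel K Om x -> @pmem K Om y -> @prel K Om (brO x y).
Proof.
move=> [x1 x2] [/relG0 r1 r2] [y1 y2]; split.
  rewrite -[linl _]/(tcomm (linl x) (linl y)) r1.
  by have [_ h] := @tcomm_bifin K (pidx W); rewrite (rfin0 (h _)); exact: prel0.
apply: (submodB (@prel_submod K L1)).
  apply: (submodD (@prel_submod K L1)); first exact: (lie_prell (good_D1 K V)).
  by rewrite r1; have [_ h] := @lact_bifin K V; rewrite (rfin0 (h _)); exact: prel0.
apply: (@gswap_mem K _ _ _ lactO (@prel K L1) (@pmem K G)); first exact: prel_submod.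
- by move=> p; apply: ppart_prel r2; exact: good_L1.
- by move=> p; apply: ppart_pmem y1; exact: good_G.
- by move=> u v hu hv; exact: lact_rel.
Qed.

Lemma Obr_relr x y : @pmem K Om x -> @pmem K Om y -> @prel K Om y -> @prel K Om (brO x y).
Proof.
move=> [x1 x2] [y1 y2] [/relG0 r1 r2]; split.
  rewrite -[linl _]/(tcomm (linl x) (linl y)) r1.
  by have [h _] := @tcomm_bifin K (pidx W); rewrite (rfin0 (h _)); exact: prel0.
apply: (submodB (@prel_submod K L1)).
  apply: (submodD (@prel_submod K L1)); first exact: (lie_prelr (good_D1 K V)).
  exact: lact_rel.
have [_ h] := gswap_bifin (@lact_bifin K V).
rewrite r1; have [h1 _] := gswap_bifin (@lact_bifin K V); rewrite (rfin0 (h1 _)).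
exact: prel0.
Qed.

End OmegaBracket.

(** * Topological generators of the algebra of forms and of DR *)

Section OmegaGenerators.
Variables (K : evenRing) (V : fgmod).
Notation W := (Wmod K V).
Notation U := (Umod K V).
Notation G := (gLie K V).
Notation O1 := (Omega1 K V).
Notation D1 := (desusp_pmod (Omega1 K V)).
Notation L1 := (LOmega1 K V).
Notation Om := (Omega K V).
Notation lactO := (@lact K V).
Notation DW := (pidx L1).

Notation brO := (@gl_br K Om).
Notation brG := (@gl_br K G).
Notation DRm := (DRmod K V).

Lemma brGE r s : @pmem K G r -> @pmem K G s ->
  brG (cls G r) (cls G s) = cls G (tcomm r s).
Proof. by move=> hr hs; rewrite /gl_br /= !repG. Qed.

Lemma tcommG_mem r s : @pmem K G r -> @pmem K G s -> @pmem K G (tcomm r s).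
Proof. exact: (lie_tcomm (P := W)). Qed.

Lemma brG_clinr x : continuous_linear (brG x).
Proof.
apply: (@elmap2_clinr K G G G (@tcomm K (pidx W))).
- exact: tcomm_bifin.
- exact: tcommG_mem.
- by move=> u v hu ru hv; exact: (lie_prell (good_W K V)).
- by move=> u v hu hv rv; exact: (lie_prelr (good_W K V)).
Qed.

Lemma brG_clinl y : continuous_linear (fun x => brG x y).
Proof.
apply: (@elmap2_clinl K G G G (@tcomm K (pidx W))).
- exact: tcomm_bifin.
- exact: tcommG_mem.
- by move=> u v hu ru hv; exact: (lie_prell (good_W K V)).
- by move=> u v hu hv rv; exact: (lie_prelr (good_W K V)).
Qed.

Lemma Sg_brG chi x y : Sg chi (brG x y) = brG (Sg chi x) (Sg chi y).
Proof.
have [r hr ->] := elP x; have [s hs ->] := elP y; have gG := @good_G K V.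
rewrite brGE // !Sg_cls //; last exact: tcommG_mem.
rewrite brGE; try exact: (good_pmem _ gG).
by congr (cls G _); exact: sig_tcomm.
Qed.

Lemma brE r s : @pmem K Om r -> @pmem K Om s ->
  brO (cls Om r) (cls Om s) = cls Om (Obr r s).
Proof.
apply: (@elmap2_cls K Om Om Om (@Obr K V)).
- exact: Obr_bifin.
- exact: Obr_mem.
- exact: Obr_rell.
- exact: Obr_relr.
Qed.

Lemma br_clinr x : continuous_linear (brO x).
Proof.
apply: (@elmap2_clinr K Om Om Om (@Obr K V)).
- exact: Obr_bifin.
- exact: Obr_mem.
- exact: Obr_rell.
- exact: Obr_relr.
Qed.

Lemma br_clinl y : continuous_linear (fun x => brO x y).
Proof.
apply: (@elmap2_clinl K Om Om Om (@Obr K V)).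
- exact: Obr_bifin.
- exact: Obr_mem.
- exact: Obr_rell.
- exact: Obr_relr.
Qed.

Lemma Sg_br chi x y : Sg chi (brO x y) = brO (Sg chi x) (Sg chi y).
Proof.
have [r hr ->] := elP x; have [s hs ->] := elP y; have gO := @good_Om K V.
rewrite brE // !Sg_cls //; last exact: Obr_mem.
by rewrite brE; [rewrite sig_Obr | exact: (good_pmem _ gO) | exact: (good_pmem _ gO)].
Qed.

Lemma inO_cls r : @pmem K G r -> inO (cls G r) = cls Om (copair r 0).
Proof. by move=> hr; rewrite /inO repG. Qed.

Lemma inO_clin : continuous_linear (@inO K V).
Proof.
apply: (@elmap_clin K G Om (fun r => copair r 0)).
- by move=> x y; rewrite (rfinB (@copair_l_rfin K (pidx G) DW)).
- by move=> x hx; split=> //; exact: pmem0.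
- by move=> x hx rx; split=> //; exact: prel0.
- exact: copair_l_rfin.
Qed.

Lemma Sg_inO (chi : chr K) (y : el G) : Sg chi (inO y) = inO (Sg chi y).
Proof.
have [r hr ->] := elP y; have gO := @good_Om K V; have gG := @good_G K V.
have h0 : @pmem K Om (copair r 0) by split=> //; exact: pmem0.
rewrite inO_cls // !Sg_cls // inO_cls; last exact: (good_pmem _ gG).
by rewrite sig_copair sig0.
Qed.

Lemma inO_inj : injective (@inO K V).
Proof.
move=> x y; have [r hr ->] := elP x; have [s hs ->] := elP y.
rewrite !inO_cls //.
have h0 z : @pmem K G z -> @pmem K Om (copair z 0) by move=> hz; split=> //; exact: pmem0.
move/(cls_eq (h0 _ hr) (h0 _ hs)) => -[/relG0 + _].
move=> e; congr (cls G _); apply/eqP; rewrite -subr_eq0; apply/eqP.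
by rewrite -e.
Qed.

Definition form1 (t : series K (pidx O1)) : series K (pidx Om) :=
  copair (0 : series K (pidx G)) (pure [:: t] : series K DW).

Lemma form1_rfin : rfin form1.
Proof.
have h : rfin (fun t : series K (pidx D1) => (pure [:: t] : series K DW)).
  have -> : (fun t : series K (pidx D1) => pure [:: t]) = (fun t => tcons t (pure [::])).
    by apply: funext => t; rewrite pure_cons.
  by have [_ c2] := @tcons_bifin K (pidx D1); exact: c2.
exact: (rfin_comp h (@copair_r_rfin K (pidx G) DW)).
Qed.

Lemma form1_mem t : @pmem K O1 t -> @pmem K Om (form1 t).
Proof. by move=> ht; split; [exact: pmem0 | exact: (lie_gen_mem (P := D1))]. Qed.

Lemma pnil_mem (P : pmod K) : @pmem K (tensalg_pmod P) (pure [::]).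
Proof. by apply: pure_pmem. Qed.

Lemma tens_mem (P Q : pmod K) x y : @pmem K P x -> @pmem K Q y ->
  @pmem K (tens_pmod P Q) (tens x y).
Proof. by move=> hx hy; apply: sub_hspan; exists x, y. Qed.

Lemma oneform_cls r : @pmem K G r -> oneform (cls G r) = cls Om (form1 (tens (pure [::]) r)).
Proof. by move=> hr; rewrite /oneform repG. Qed.

Lemma oneform_clin : continuous_linear (@oneform K V).
Proof.
have hr : rfin (fun r : series K (pidx G) => form1 (tens (pure [::]) r)).
  by have [h1 _] := @tens_bifin K (pidx U) (pidx G); exact: (rfin_comp (h1 _) form1_rfin).
apply: (@elmap_clin K G Om (fun r => form1 (tens (pure [::]) r))) => //.
- exact: (rfinB hr).
- by move=> x hx; apply: form1_mem; apply: (tens_mem (P := U)) => //; exact: pnil_mem.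
- by move=> x hx /relG0 ->; rewrite (rfin0 hr); exact: prel0.
Qed.

Lemma Sg_oneform (chi : chr K) (y : el G) :
  Sg chi (oneform y) = qk K (cfd chi * cdg chi) *: oneform (Sg chi y).
Proof.
have [r hr ->] := elP y; have gO := @good_Om K V; have gG := @good_G K V.
have h0 z : @pmem K G z -> @pmem K O1 (tens (pure [::]) z).
  by move=> hz; apply: (tens_mem (P := U)); [exact: pnil_mem | exact: hz].
rewrite oneform_cls // !Sg_cls //; last by apply: form1_mem; exact: h0.
have hs := good_pmem chi gG hr.
rewrite oneform_cls // -clsZ; last by apply: form1_mem; exact: h0.
congr (cls Om _); rewrite -(rfinZ form1_rfin) /form1 sig_copair sig0; congr copair.
by rewrite sig_pure /= sig_desusp sig_tens sig_pure.
Qed.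

Lemma lact_single y t : lactO y (pure [:: t]) = pure [:: lmul y t].
Proof.
have [l1 l2] := @lact_bifin K V; have [m1 m2] := @lmul_bifin K V.
have [c1 c2] := @tcons_bifin K (pidx D1).
have main q z : epar q z -> lactO z (pure [:: t]) = pure [:: lmul z t].
  by move=> hz; rewrite !pure_cons (lact_cons _ _ hz) lact_nil (rfin0 (c1 _)) addr0.
rewrite (ppart_sum y) (rfinD (l2 _)) (rfinD (m2 _)) !(main _ _ (@ppart_epar _ _ _ _)).
by rewrite !pure_cons; symmetry; exact: (rfinD (c2 _)). 
Qed.

Lemma Obr_lr y F : @Obr K V (copair y 0) (copair 0 F) = copair 0 (lactO y F).
Proof.
have [t1 t2] := @tcomm_bifin K (pidx W); have [u1 u2] := @tcomm_bifin K (pidx D1).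
have [g1 g2] := gswap_bifin (@lact_bifin K V).
rewrite /Obr; congr copair.
  rewrite -[linl (copair 0 F)]/(0 : series K (pidx G)); exact: (rfin0 (t1 _)).
rewrite -[linl (copair 0 F)]/(0 : series K (pidx G)) -[linr (copair y 0)]/(0 : series K DW).
by rewrite (rfin0 (u2 _)) (rfin0 (g1 _)) add0r subr0.
Qed.

Lemma Obr_rr F H : @Obr K V (copair 0 F) (copair 0 H) = copair 0 (tcomm F H).
Proof.
have [t1 t2] := @tcomm_bifin K (pidx W); have [l1 l2] := @lact_bifin K V.
have [g1 g2] := gswap_bifin (@lact_bifin K V).
rewrite /Obr; congr copair.
  rewrite -[linl (copair 0 F)]/(0 : series K (pidx G)); exact: (rfin0 (t2 _)).
rewrite -[linl (copair 0 F)]/(0 : series K (pidx G)) -[linl (copair 0 H)]/(0 : series K (pidx G)).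
by rewrite (rfin0 (l2 _)) (rfin0 (g1 _)) addr0 subr0.
Qed.

Lemma submod_preim_el (P Q : pmod K) (f : el P -> el Q) (A : set (el Q)) :
  continuous_linear f -> submod A -> submod [set x | A (f x)].
Proof.
move=> hf [A0 Al]; split=> [|a x y] /=; first by rewrite (cadd0 (clin_cadd hf)).
by move=> hx hy; rewrite (proj1 hf); exact: Al.
Qed.

Lemma sigPK k B (x : series K B) : sig (chP K k) (sig (chP K k) x) = x.
Proof. by apply: funext => b; rewrite !sigPE mulrA ksignMK mul1r. Qed.

(** Functions and their differentials generate the algebra of forms. The point is the general 1-form
    x (x) dz, obtained from dz by letting the letters of x act one after the other through the
    bracket. *)
Lemma Om_ind (A : set (el Om)) : submod A -> eclosed A ->
  (forall y, A (inO y)) -> (forall y, A (oneform y)) ->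
  (forall x y, A x -> A y -> A (brO x y)) -> forall x, A x.
Proof.
move=> mA cA Ai Ao Ab; have gO := @good_Om K V.
pose S := [set r | exists2 x, @pmem K G x & r = copair x 0] `|`
          [set r | exists2 s, lie_monomial (@pmem K D1) s & r = copair 0 s].
have gT : pclosed (tens_pmod U G) by case: (good_tens (good_U K V) (good_G K V)).
have gU : pclosed U by case: (good_U K V).
have one t : @pmem K O1 t -> A (cls Om (form1 t)).
  have hc : continuous_linear (@elmap K (tens_pmod U G) Om form1).
    apply: elmap_clin; [exact: (rfinB form1_rfin) | exact: form1_mem | | exact: form1_rfin].
    by move=> x _ /relUG0 ->; rewrite (rfin0 form1_rfin); exact: prel0.
  have ec z : @pmem K (tens_pmod U G) z -> @elmap K (tens_pmod U G) Om form1 (cls (tens_pmod U G) z) = cls Om (form1 z).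
    move=> hz; apply: elmap_cls => //; [exact: (rfinB form1_rfin) | exact: form1_mem |].
    by move=> x _ /relUG0 ->; rewrite (rfin0 form1_rfin); exact: prel0.
  move=> ht; rewrite -(ec _ ht); move: (cls _ _).
  apply: (@el_ind K (tens_pmod U G) _ [set z | A (@elmap K (tens_pmod U G) Om form1 z)] (proj1 gT) _ (@sub_hspan _ _ _)) => //.
  - exact: submod_preim_el.
  - exact: (eclosed_preim (clin_cadd hc)).
  move=> _ [x [z [hx hz ->]]]; rewrite /= ec; last exact: tens_mem.
  pose f x' := form1 (tens x' z).
  have hf : rfin f.
    by have [_ h2] := @tens_bifin K (pidx U) (pidx G); exact: (rfin_comp (h2 z) form1_rfin).
  have fm x' : @pmem K U x' -> @pmem K Om (f x') by move=> h; apply: form1_mem; exact: (tens_mem (P := U) h hz).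
  have fr x' : @pmem K U x' -> @prel K U x' -> @prel K Om (f x').
    by move=> _ /relU0 ->; rewrite (rfin0 hf); exact: prel0.
  have fc : continuous_linear (@elmap K U Om f).
    by apply: elmap_clin => //; exact: (rfinB hf).
  have fe x' : @pmem K U x' -> @elmap K U Om f (cls U x') = cls Om (f x').
    by move=> h; apply: elmap_cls => //; exact: (rfinB hf).
  rewrite -/(f x) -(fe _ hx); move: (cls U x).
  apply: (@el_ind K U _ [set z | A (@elmap K U Om f z)] (proj1 gU) _ (@sub_hspan _ _ _)) => //.
  - exact: submod_preim_el.
  - exact: (eclosed_preim (clin_cadd fc)).
  move=> _ [xs hxs ->]; rewrite /= fe; last exact: pure_pmem.
  elim: xs hxs => [|w xs IH] h; first by rewrite /f -oneform_cls //; exact: Ao.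
  have hw : @pmem K W w by apply: h; rewrite inE eqxx.
  have hxs : {in xs, forall t, @pmem K W t} by move=> t' h'; apply: h; rewrite inE h' orbT.
  have hw' : @pmem K G (sig (chP K 1) (pure [:: w])).
    by apply: (good_pmem _ (good_G K V)); exact: lie_gen_mem.
  (* The letter is twisted by the parity operator beforehand, which cancels the sign that [lmul]
     introduces when passing the desuspension. *)
  have -> : cls Om (f (pure (w :: xs))) =
      brO (inO (cls G (sig (chP K 1) (pure [:: w])))) (cls Om (f (pure xs))).
    rewrite inO_cls // brE; [|by split=> //; exact: pmem0|by apply: fm; exact: pure_pmem].
    congr (cls Om _); rewrite /f /form1 Obr_lr lact_single lmul_tens sigPK.
    by rewrite tmul_pure.
  by apply: Ab; [exact: Ai | exact: IH].
apply: (@el_ind K Om S A) => //.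
- by case: gO => -[].
- move=> r [r1 r2]; rewrite -(linK r) copairE.
  apply: (submodD (@hspan_submod K _ S)).
    by apply: sub_hspan; left; exists (linl r).
  have h := @copair_r_rfin K (pidx G) DW.
  apply: (hspan_map h (@hspan_submod _ _ S) (@hspan_sclosed _ _ S) _ r2).
  by move=> s hs; apply: sub_hspan; right; exists s.
- move=> r [[x hx ->]|[s hs ->]]; first by split=> //; exact: pmem0.
  by split; [exact: pmem0 | exact: sub_hspan].
move=> r [[x hx ->]|[s hs ->]]; first by rewrite -inO_cls //; exact: Ai.
elim: hs => [t ht|u v hu IHu hv IHv]; first exact: one.
have m0 z : lie_monomial (@pmem K D1) z -> @pmem K Om (copair 0 z).
  by move=> hz; split; [exact: pmem0 | exact: sub_hspan].
rewrite -Obr_rr -brE; [exact: Ab | exact: m0 | exact: m0].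
Qed.

Lemma good_DR : good DRm.
Proof.
apply: good_quot; first by apply: good_tens; exact: good_Om.
move=> chi s [[i [j [x [y [[hx sx] [hy sy] ->]]]]]|[x [y [z [hx hy hz ->]]]]].
  left; exists i, j, (sig chi x), (sig chi y); split.
  - by split; [exact: (good_pmem chi (good_Om K V)) | exact: shomog_sig].
  - by split; [exact: (good_pmem chi (good_Om K V)) | exact: shomog_sig].
  - by rewrite sigB sigZ !sig_tens /ksign rmorphXn rmorphN1.
right; exists (sig chi x), (sig chi y), (sig chi z); split;
  try exact: (good_pmem chi (good_Om K V)).
by rewrite sigB !sig_tens !sig_Obr.
Qed.

Lemma DR_tens_rel r : @prel K (tens_pmod Om Om) r -> @prel K DRm r.
Proof. by move=> h; apply: sub_hspan; left. Qed.

Lemma dpE r s : @pmem K Om r -> @pmem K Om s ->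
  drpair (cls Om r) (cls Om s) = cls DRm (tens r s).
Proof.
apply: (@elmap2_cls K Om Om DRm (@tens K (pidx Om) (pidx Om))).
- exact: tens_bifin.
- by move=> x y hx hy; exact: (tens_mem (P := Om) (Q := Om)).
- move=> x y hx rx hy; apply: DR_tens_rel; apply: sub_hspan; exists x, y.
  by split=> //; left.
- move=> x y hx hy ry; apply: DR_tens_rel; apply: sub_hspan; exists x, y.
  by split=> //; right.
Qed.

Lemma dp_clinr x : @continuous_linear K Om DRm (drpair x).
Proof.
apply: (@elmap2_clinr K Om Om DRm (@tens K (pidx Om) (pidx Om))).
- exact: tens_bifin.
- by move=> u v hx hy; exact: (tens_mem (P := Om) (Q := Om)).
- move=> u v hx rx hy; apply: DR_tens_rel; apply: sub_hspan; exists u, v.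
  by split=> //; left.
- move=> u v hx hy ry; apply: DR_tens_rel; apply: sub_hspan; exists u, v.
  by split=> //; right.
Qed.

Lemma dp_clinl y : @continuous_linear K Om DRm (fun x => drpair x y).
Proof.
apply: (@elmap2_clinl K Om Om DRm (@tens K (pidx Om) (pidx Om))).
- exact: tens_bifin.
- by move=> u v hx hy; exact: (tens_mem (P := Om) (Q := Om)).
- move=> u v hx rx hy; apply: DR_tens_rel; apply: sub_hspan; exists u, v.
  by split=> //; left.
- move=> u v hx hy ry; apply: DR_tens_rel; apply: sub_hspan; exists u, v.
  by split=> //; right.
Qed.

Lemma Sg_dp (chi : chr K) (x y : el Om) : @Sg K chi DRm (drpair x y) = drpair (Sg chi x) (Sg chi y).
Proof.
have [r hr ->] := elP x; have [s hs ->] := elP y; have gO := @good_Om K V.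
rewrite dpE // (Sg_cls _ good_DR); last exact: (tens_mem (P := Om) (Q := Om)).
rewrite !Sg_cls // dpE; [by rewrite sig_tens | exact: (good_pmem _ gO) | exact: (good_pmem _ gO)].
Qed.

Lemma dp_inv (x y z : el Om) : drpair x (brO y z) = drpair (brO x y) z.
Proof.
have [r hr ->] := elP x; have [s hs ->] := elP y; have [t ht ->] := elP z.
have h1 : @pmem K Om (Obr r s) by exact: Obr_mem.
have h2 : @pmem K Om (Obr s t) by exact: Obr_mem.
rewrite !brE // !dpE //; apply/(@cls_eq K DRm).
- exact: (tens_mem (P := Om) (Q := Om)).
- exact: (tens_mem (P := Om) (Q := Om)).
by apply: sub_hspan; right; right; exists r, s, t.
Qed.

Lemma dp_sym i j (x y : el Om) : homog i x -> homog j y ->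
  drpair x y = ksign K (i * j) *: drpair y x.
Proof.
move=> [r [hr <-] sr] [s [hs <-] ss].
have ht := tens_mem (P := Om) (Q := Om) hr hs.
have ht' := tens_mem (P := Om) (Q := Om) hs hr.
rewrite !dpE // -(@clsZ K DRm) //; apply/(@cls_eq K DRm) => //.
  by apply: (submodZ _ (@pmem_submod K DRm)).
by apply: sub_hspan; right; left; exists i, j, r, s.
Qed.

Lemma DR_ind (A : set (el DRm)) : submod A -> eclosed A ->
  (forall x y, A (drpair x y)) -> forall z, A z.
Proof.
move=> mA cA h; have [[cP _] _] := good_DR.
apply: (@el_ind K DRm _ A cP _ (@sub_hspan _ _ _)) => //.
move=> _ [r [s [hr hs ->]]]; rewrite -dpE //; exact: h.
Qed.

End OmegaGenerators.

(** * Rational generators with finitely many coordinates in each weight *)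

Lemma span_rows n (S : set 'rV[rat]_n) :
  exists m (A : 'M[rat]_(m, n)), (forall i, S (row i A)) /\ forall v, S v -> (v <= A)%MS.
Proof.
(* Induction on the corank: a member of [S] outside the row space is added as a new row and raises
   the rank. The rows always belong to [S] itself. *)
suff H k m (A : 'M[rat]_(m, n)) : (n - \rank A <= k)%N -> (forall i, S (row i A)) ->
    exists m (A : 'M[rat]_(m, n)), (forall i, S (row i A)) /\ forall v, S v -> (v <= A)%MS.
  by apply: (H n 0%N 0); [exact: leq_subr | case].
elim: k m A => [|k IH] m A hk hA.
  exists m, A; split=> // v _; apply: submx_full.
  by rewrite /row_full eqn_leq rank_leq_col -subn_eq0 -leqn0.
have [h|/existsNP[v /not_implyP[Sv hv]]] := pselect (forall v, S v -> (v <= A)%MS).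
  by exists m, A.
apply: (IH _ (col_mx A v)).
  have : (\rank A < \rank (col_mx A v))%N.
    have hlt : (A < A + v)%MS.
      rewrite ltmxE addsmxSl /=; apply/negP => h; apply: hv.
      exact: submx_trans (addsmxSr _ _) h.
    by have := rank_ltmx hlt; rewrite addsmxE.
  have := rank_leq_col (col_mx A v); lia.
move=> i; case: (fintype.splitP i) => j hj.
  by rewrite (_ : i = lshift 1 j) ?rowKu; [exact: hA | exact: val_inj].
rewrite (_ : i = rshift m j) ?rowKd; last exact: val_inj.
rewrite [row j v](_ : _ = v) //.
by apply/rowP => l; rewrite !mxE ord1.
Qed.

Section Rational.
Variable K : evenRing.
Implicit Types B C D : gset.

Definition isq (x : K) := exists q, x = qk K q.

Lemma isq0 : isq 0. Proof. by exists 0; rewrite rmorph0. Qed.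
Lemma isq1 : isq 1. Proof. by exists 1; rewrite rmorph1. Qed.
Lemma isqD x y : isq x -> isq y -> isq (x + y).
Proof. by move=> [p ->] [q ->]; exists (p + q); rewrite rmorphD. Qed.
Lemma isqN x : isq x -> isq (- x).
Proof. by move=> [p ->]; exists (- p); rewrite rmorphN. Qed.
Lemma isqM x y : isq x -> isq y -> isq (x * y).
Proof. by move=> [p ->] [q ->]; exists (p * q); rewrite rmorphM. Qed.
Lemma isq_sum (I : Type) (r : seq I) (P : pred I) F :
  (forall i, P i -> isq (F i)) -> isq (\sum_(i <- r | P i) F i).
Proof. by move=> h; elim/big_ind: _ => //; [exact: isq0 | exact: isqD]. Qed.
Lemma isq_sign n : isq ((-1) ^+ n).
Proof. by exists ((-1) ^+ n); rewrite rmorphXn rmorphN1. Qed.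

Definition supp_in B (Q : pred B) (r : series K B) := forall b, ~~ Q b -> r b = 0.
Definition ratv B (r : series K B) := forall b, isq (r b).

(* Rationality replaces the missing linear algebra over K: in each weight a
   member of the span is recovered from finitely many coordinates. *)
Definition ratgen B (R : set (series K B)) (L : nat -> seq B) :=
  forall r, R r -> ratv r /\
    exists w, supp_in (fun b => (gwt b == w) && (b \in L w)) r.

(** The [e i] need not be independent: they are the rows of a rational projector onto the span of
    the generators in weight w. What matters is that a member of weight w is recovered K-linearly
    from its own coordinates. *)
Lemma wbasis B (R : set (series K B)) L (w : nat) : ratgen R L ->
  exists n (b : 'I_n -> B) (e : 'I_n -> series K B),
    [/\ forall i, gwt (b i) = w, forall i, hspan R (e i),
        forall i, supp_in (fun c => gwt c == w) (e i) &
        forall x, hspan R x -> forall c, gwt c = w -> x c = \sum_i x (b i) * e i c].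
Proof.
move=> hR; pose l := [seq b <- L w | gwt b == w].
pose b (i : 'I_(size l)) := tnth (in_tuple l) i.
have bl c : c \in l -> exists i, c = b i.
  by move=> cl; have /tnthP[i ->] : c \in in_tuple l by []; exists i.
pose S : set 'rV[rat]_(size l) := [set v | exists r, [/\ R r,
   supp_in (fun c => gwt c == w) r & forall i, r (b i) = qk K (v 0 i)]].
have [m [A [hA hS]]] := span_rows S.
have [r hr] := choice hA.
(* For v in the row space of [A] one has v = v * pinvmx A * A, so the coefficients of v with respect
   to the [e i] are its coordinates. *)
pose e i := \sum_k qk K (pinvmx A i k) *: r k.
have rl z c : R z -> supp_in (fun c => gwt c == w) z -> c \notin l -> z c = 0.
  move=> Rz sz cl; have [_ [w' h]] := hR _ Rz.
  have [ew|nw] := eqVneq (gwt c) w; last exact: sz.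
  apply: h; apply/negP => /andP[/eqP e1 cL]; move: cl.
  by rewrite mem_filter -ew e1 eqxx cL.
exists (size l), b, e; split.
- by move=> i; have := mem_tnth i (in_tuple l); rewrite mem_filter => /andP[/eqP].
- move=> i; apply: (submod_sum (@hspan_submod K B R)) => k _ _.
  apply: (submodZ _ (@hspan_submod K B R)).
  by apply: sub_hspan; case: (hr k).
- move=> i c cw; rewrite /e series_sumE big1 // => k _.
  by rewrite -[LHS]/(_ * _); case: (hr k) => _ -> //; rewrite mulr0.
move=> x hx c cw.
have sE (a : K) (y : series K B) c' : (a *: y) c' = a * y c' by [].
(* Both sides at the coordinate [c] are viewed as row-finite maps, so that their equality on
   generators extends to the closed span. *)
pose f (y : series K B) : series K B := fun c' => if c' == c then y c else 0.
pose h (y : series K B) : series K B := fun c' => if c' == c then \sum_i y (b i) * e i c else 0.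
have hf : rfin f by move=> c'; apply: ffl_if; [exact: ffl_ev | exact: ffl_cst0].
have hh : rfin h.
  move=> c'; apply: ffl_if; last exact: ffl_cst0.
  by apply: ffl_sum => i _; apply: ffl_mulr; exact: ffl_ev.
have := congr1 (fun z : series K B => z c) (hspan_eq hf hh (S := R) _ hx).
rewrite /f /h eqxx; apply=> z Rz; apply: funext => c'; case: eqP => // _.
have [raises [w' sz]] := hR _ Rz.
have [ew|nw] := eqVneq w' w; last first.
  have z0 c1 : gwt c1 = w -> z c1 = 0.
    move=> e1; apply: sz; apply/negP => /andP[/eqP e2 _].
    by move: nw; rewrite -e2 e1 eqxx.
  rewrite z0 // big1 // => i _; rewrite z0 ?mul0r //.
  by have := mem_tnth i (in_tuple l); rewrite mem_filter => /andP[/eqP].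
have sz' : supp_in (fun c => gwt c == w) z.
  by move=> c1 h1; apply: sz; rewrite -ew in h1; rewrite (negbTE h1).
have [cl|cl] := boolP (c \in l); last first.
  rewrite (rl _ _ Rz sz' cl) big1 // => i _; rewrite /e series_sumE big1 ?mulr0 // => k _.
  by rewrite sE; case: (hr k) => h1 h2 h3; rewrite (rl _ _ h1 h2 cl) mulr0.
have [j ->] := bl _ cl.
have [q hq] := choice raises.
pose v : 'rV[rat]_(size l) := \row_i q (b i).
have Sv : S v by exists z; split=> // i; rewrite mxE.
have := mulmxKpV (hS _ Sv) => /(congr1 (fun M : 'rV_(size l) => M 0 j)).
rewrite -mulmxA mxE [v 0 j]mxE => ev.
rewrite hq -ev rmorph_sum; apply: eq_bigr => i _.
rewrite rmorphM /= [v 0 i]mxE -hq; congr (_ * _).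
rewrite mxE rmorph_sum /e series_sumE; apply: eq_bigr => k _.
rewrite rmorphM /= sE; case: (hr k) => _ _ ->.
by rewrite [_ 0 j]mxE.
Qed.

Lemma tmul_supp B (Q1 Q2 Q : pred (seq B)) (r s : series K (words B)) :
  (forall u v, Q1 u -> Q2 v -> Q (u ++ v)) ->
  supp_in (Q1 : pred (words B)) r -> supp_in (Q2 : pred (words B)) s ->
  supp_in (Q : pred (words B)) (tmul r s).
Proof.
move=> h hr hs w Qw; rewrite /tmul big1 // => k _.
have [q1|/hr -> //] := boolP (Q1 (take k w)); last by rewrite mul0r.
have [q2|/hs ->] := boolP (Q2 (drop k w)); last by rewrite mulr0.
by have := h _ _ q1 q2; rewrite cat_take_drop (negbTE Qw).
Qed.

Lemma tmul_ratv B (r s : series K (words B)) : ratv r -> ratv s -> ratv (tmul r s).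
Proof. by move=> hr hs w; apply: isq_sum => k _; exact: isqM. Qed.

Lemma ppart_supp B p (Q : pred B) (r : series K B) : supp_in Q r -> supp_in Q (ppart p r).
Proof. by move=> h b /h e; rewrite /ppart e; case: ifP. Qed.

Lemma ppart_ratv B p (r : series K B) : ratv r -> ratv (ppart p r).
Proof. by move=> h b; rewrite /ppart; case: ifP => _; [exact: h | exact: isq0]. Qed.

Lemma tcomm_ratv B (r s : series K (words B)) : ratv r -> ratv s -> ratv (tcomm r s).
Proof.
move=> hr hs w; apply: isqD; first exact: tmul_ratv.
rewrite -[X in isq X]/(- (gswap (@tmul K B) r s) w); apply: isqN.
rewrite /gswap series_sumE; apply: isq_sum => p _; rewrite series_sumE; apply: isq_sum => q _.
rewrite -[X in isq X]/(_ * _); apply: isqM; first exact: isq_sign.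
by apply: tmul_ratv; exact: ppart_ratv.
Qed.

Lemma tcomm_supp B (Q1 Q2 Q : pred (seq B)) (r s : series K (words B)) :
  (forall u v, Q1 u -> Q2 v -> Q (u ++ v)) -> (forall u v, Q1 u -> Q2 v -> Q (v ++ u)) ->
  supp_in (Q1 : pred (words B)) r -> supp_in (Q2 : pred (words B)) s ->
  supp_in (Q : pred (words B)) (tcomm r s).
Proof.
move=> h1 h2 hr hs w Qw; rewrite /tcomm -[LHS]/(tmul r s w - gswap (@tmul K B) r s w).
rewrite (tmul_supp h1 hr hs) // sub0r /gswap series_sumE big1 ?oppr0 // => p _.
rewrite series_sumE big1 // => q _; rewrite -[LHS]/(_ * _).
have h2' u v : Q2 u -> Q1 v -> Q (u ++ v) by move=> a b; exact: h2.
by rewrite (tmul_supp h2' (ppart_supp q hs) (ppart_supp p hr)) // mulr0.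
Qed.

Fixpoint wordsle (T : eqType) (l : seq T) (n : nat) : seq (seq T) :=
  if n is n'.+1 then [::] :: [seq b :: u | b <- l, u <- wordsle l n'] else [:: [::]].

Lemma wordsleP (T : eqType) (l : seq T) n u : {subset u <= l} -> (size u <= n)%N ->
  u \in wordsle l n.
Proof.
elim: n u => [|n IH] [|b u] //= h hs.
rewrite inE /=; apply/allpairsP; exists (b, u); split=> //=.
  by apply: h; rewrite inE eqxx.
by apply: IH => // c cu; apply: h; rewrite inE cu orbT.
Qed.

(* As no letter has weight 0, a word of weight [w] has at most [w] letters. *)
Definition wlist B (L : nat -> seq B) (w : nat) : seq (words B) :=
  wordsle (flatten [seq L i | i <- iota 0 w.+1]) w.

Definition gletters B (L : nat -> seq B) (u : words B) := all (fun b => b \in L (gwt b)) u.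

Lemma wlistP B (L : nat -> seq B) (u : words B) : L 0%N = [::] -> gletters L u ->
  u \in wlist L (gwt u).
Proof.
move=> L0 /allP h; apply: wordsleP.
  move=> b bu; apply/flattenP; exists (L (gwt b)); last exact: h.
  apply: map_f; rewrite mem_iota add0n ltnS /=.
  by rewrite (big_rem b) //= leq_addr.
elim: u h => [|b u IH] h //=.
rewrite big_cons.
have hb : (0 < gwt b)%N.
  have := h b; rewrite inE eqxx => /(_ isT).
  by case: (gwt b) => //; rewrite L0.
have hu : (size u <= \sum_(b <- u) gwt b)%N.
  by apply: IH => c cu; apply: h; rewrite inE cu orbT.
by rewrite -add1n; exact: leq_add.
Qed.

Lemma gwt_cat B (u v : words B) : gwt (u ++ v : words B) = (gwt u + gwt v)%N.
Proof. by rewrite /= big_cat. Qed.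

(** Lie monomials have no constant term. Excluding the empty word keeps weight 0 empty, which is
    what the next application of [wlist] requires. *)
Definition lielist B (L : nat -> seq B) (w : nat) : seq (words B) :=
  [seq u <- wlist L w | u != [::]].

Lemma ratgen_pure B (R : set (series K B)) L : L 0%N = [::] -> ratgen R L ->
  ratgen [set t | exists2 xs, {in xs, forall x, R x} & t = pure xs] (wlist L).
Proof.
move=> L0 hR _ [xs hxs ->].
suff [h [w hw]] : ratv (pure xs) /\ exists w : nat,
    supp_in (fun u : words B => (gwt u == w) && gletters L u) (pure xs).
  split=> //; exists w => u; apply: contraNeq => ru.
  have : (gwt u == w) && gletters L u by apply: contraNT ru => /hw ->.
  by move=> /andP[/eqP <- gu]; rewrite eqxx /=; exact: wlistP.
elim: xs hxs => [|x xs IH] h.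
  split; first by move=> u; rewrite pure_nil; case: eqP => _; [exact: isq1 | exact: isq0].
  exists 0%N => u; rewrite pure_nil; case: (u =P [::]) => // ->.
  by rewrite /= big_nil eqxx.
have hxs : {in xs, forall x, R x} by move=> y hy; apply: h; rewrite inE hy orbT.
have [r1 [w1 s1]] := IH hxs.
have [r0 [w0 s0]] := hR x (h x (mem_head _ _)).
rewrite pure_cons; split.
  by move=> [|b u] /=; [exact: isq0 | exact: isqM].
exists (w0 + w1)%N => -[|b u] //= hu.
have [b0|/s0 ->] := boolP ((gwt b == w0) && (b \in L w0)); last by rewrite mul0r.
have [u0|/s1 ->] := boolP ((gwt (u : words B) == w1) && gletters L u); last by rewrite mulr0.
move: hu b0 u0; rewrite big_cons => hu /andP[/eqP e0 bL] /andP[/eqP e1 gu].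
by move: hu; rewrite e0 -[X in (_ + X)%N]/(gwt (u : words B)) e1 eqxx bL gu.
Qed.

Lemma ratgen_lie B (R : set (series K B)) L : L 0%N = [::] -> ratgen R L ->
  ratgen (lie_monomial R) (lielist L).
Proof.
move=> L0 hR t ht.
suff [h [w hw]] : ratv t /\ exists w : nat,
    supp_in (fun u : words B => [&& gwt u == w, gletters L u & u != [::]]) t.
  split=> //; exists w => u; apply: contraNeq => ru.
  have : [&& gwt u == w, gletters L u & u != [::]] by apply: contraNT ru => /hw ->.
  by move=> /and3P[/eqP <- gu u0]; rewrite eqxx mem_filter u0 /=; exact: wlistP.
elim: ht => [x Rx|r s _ [r1 [w1 s1]] _ [r2 [w2 s2]]].
  have [r0 [w0 s0]] := hR x Rx.
  rewrite pure_cons; split.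
    move=> [|b u] /=; first exact: isq0.
    by apply: isqM => //; rewrite pure_nil; case: eqP => _; [exact: isq1 | exact: isq0].
  exists w0 => -[|b u] //= hu.
  have [b0|/s0 ->] := boolP ((gwt b == w0) && (b \in L w0)); last by rewrite mul0r.
  rewrite pure_nil; case: eqP => [u0|_]; last by rewrite mulr0.
  move: hu b0; rewrite u0 big_seq1 => hu /andP[/eqP e0 bL].
  by move: hu; rewrite /= e0 eqxx bL.
split; first exact: tcomm_ratv.
exists (w1 + w2)%N; apply: tcomm_supp s1 s2 => u v /and3P[/eqP hu gu u0] /and3P[/eqP hv gv v0].
  by rewrite gwt_cat hu hv eqxx /gletters all_cat; apply/and3P; split=> //;
    [apply/andP | case: u u0 {hu gu}].
by rewrite gwt_cat hu hv addnC eqxx /gletters all_cat; apply/and3P; split=> //;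
    [apply/andP | case: v v0 {hv gv}].
Qed.

Lemma ratgen_tens B C (R : set (series K B)) (S : set (series K C)) L M :
  ratgen R L -> ratgen S M ->
  ratgen [set t | exists x y, [/\ R x, S y & t = tens x y]]
    (fun w => flatten [seq [seq (b, c) | b <- L i, c <- M (w - i)%N] | i <- iota 0 w.+1]).
Proof.
move=> hR hS _ [x [y [Rx Sy ->]]].
have [r1 [w1 s1]] := hR _ Rx; have [r2 [w2 s2]] := hS _ Sy.
split; first by move=> [b c]; apply: isqM.
exists (w1 + w2)%N => -[b c] h; rewrite /tens /=.
have [b0|/s1 ->] := boolP ((gwt b == w1) && (b \in L w1)); last by rewrite mul0r.
have [c0|/s2 ->] := boolP ((gwt c == w2) && (c \in M w2)); last by rewrite mulr0.
move: b0 c0 h => /andP[/eqP e1 b1] /andP[/eqP e2 c1].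
have -> : gwt ((b, c) : pairs B C) = (w1 + w2)%N by rewrite /= e1 e2.
rewrite eqxx andTb => /negP; case; apply/flattenP; exists [seq (b, c) | b <- L w1, c <- M (w1 + w2 - w1)%N].
  by apply/mapP; exists w1; rewrite ?mem_iota ?add0n ?ltnS ?leq_addr.
by rewrite addKn; apply: allpairs_f.
Qed.

End Rational.

(** * A universal property of DR *)

Section Universal.
Variables (K : evenRing) (V : fgmod).
Notation W := (Wmod K V).
Notation U := (Umod K V).
Notation G := (gLie K V).
Notation D1 := (desusp_pmod (Omega1 K V)).
Notation L1 := (LOmega1 K V).
Notation Om := (Omega K V).
Notation DW := (pidx L1).

Lemma sub_pure (P : pmod K) (R : set (series K (pidx P))) :
  @pmem K P `<=` hspan R -> @pmem K (tensalg_pmod P) `<=`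
    hspan [set t | exists2 xs, {in xs, forall x, R x} & t = pure xs].
Proof.
move=> h; apply: hspan_min; [exact: hspan_submod | exact: hspan_sclosed |].
move=> _ [xs hxs ->]; elim: xs hxs => [|x xs IH] hx.
  by apply: sub_hspan; exists [::].
rewrite pure_cons.
have hxs : {in xs, forall x, @pmem K P x} by move=> y hy; apply: hx; rewrite inE hy orbT.
apply: (hspan_bilin (@tcons_bifin K (pidx P)) _ _ _ (h _ (hx x (mem_head _ _))) (IH hxs));
  [exact: hspan_submod | exact: hspan_sclosed |].
move=> r _ Rr [rs hrs ->]; apply: sub_hspan; exists (r :: rs); last by rewrite pure_cons.
by move=> y; rewrite inE => /predU1P[->|/hrs].
Qed.

Lemma sub_lie (P : pmod K) (R : set (series K (pidx P))) :
  @pmem K P `<=` hspan R -> @pmem K (lie_pmod P) `<=` hspan (lie_monomial R).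
Proof.
move=> h; apply: hspan_min; [exact: hspan_submod | exact: hspan_sclosed |].
move=> t; elim=> [x hx|u v _ IHu _ IHv].
  have [_ c2] := @tcons_bifin K (pidx P); rewrite pure_cons.
  apply: (hspan_map (c2 (pure [::])) _ _ _ (h _ hx)); [exact: hspan_submod | exact: hspan_sclosed |].
  by move=> r Rr; apply: sub_hspan; rewrite -pure_cons; exact: lie_gen.
apply: (hspan_bilin (@tcomm_bifin K (pidx P)) _ _ _ IHu IHv);
  [exact: hspan_submod | exact: hspan_sclosed |].
by move=> r s hr hs; apply: sub_hspan; exact: lie_br.
Qed.

Lemma sub_tens (P Q : pmod K) (R : set (series K (pidx P))) (S : set (series K (pidx Q))) :
  @pmem K P `<=` hspan R -> @pmem K Q `<=` hspan S -> @pmem K (tens_pmod P Q) `<=`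
    hspan [set t | exists x y, [/\ R x, S y & t = tens x y]].
Proof.
move=> hP hQ; apply: hspan_min; [exact: hspan_submod | exact: hspan_sclosed |].
move=> _ [x [y [hx hy ->]]].
apply: (hspan_bilin (@tens_bifin K (pidx P) (pidx Q)) _ _ _ (hP _ hx) (hQ _ hy));
  [exact: hspan_submod | exact: hspan_sclosed |].
by move=> r s hr hs; apply: sub_hspan; exists r, s.
Qed.

Lemma lie_monoS (B : gset) (R S : set (series K B)) : R `<=` S ->
  lie_monomial R `<=` lie_monomial S.
Proof.
by move=> h t; elim=> [x hx|u v _ IHu _ IHv]; [apply: lie_gen; exact: h | exact: lie_br].
Qed.

Lemma Om_rational : exists R L, [/\ ratgen R L, @pmem K Om `<=` hspan R &
  hspan R `<=` @pmem K Om].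
Proof.
pose dl (b : pidx W) : series K (pidx W) := fun c => if c == b then 1 else 0.
pose RW := [set r | exists b, r = dl b].
pose LW (w : nat) : seq (pidx W) := if w == 1%N then enum 'I_(rk V) else [::].
have gW : ratgen RW LW.
  move=> _ [b ->]; split; first by move=> c; rewrite /dl; case: ifP => _; [exact: isq1 | exact: isq0].
  exists 1%N => c; rewrite /dl; case: (c =P b) => // ->.
  by rewrite /LW /= mem_enum.
have sW : @pmem K W `<=` hspan RW.
  move=> x _; have -> : x = \sum_(b : 'I_(rk V)) x b *: dl b.
    apply: funext => c; rewrite series_sumE (bigD1 (c : 'I_(rk V))) //= big1 ?addr0.
      by rewrite -[RHS]/(x c * dl c c) /dl eqxx mulr1.
    move=> b bc; rewrite -[LHS]/(x b * dl b c) /dl.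
    by rewrite eq_sym (negbTE bc) mulr0.
  apply: (submod_sum (@hspan_submod K _ RW)) => b _ _.
  by apply: (submodZ _ (@hspan_submod K _ RW)); apply: sub_hspan; exists b.
pose RU : set (series K (pidx U)) :=
  [set t | exists2 xs, {in xs, forall x, RW x} & t = pure xs].
have gU : ratgen RU (wlist LW) by exact: ratgen_pure.
have sU : @pmem K U `<=` hspan RU by exact: (sub_pure sW).
pose RG : set (series K (pidx G)) := lie_monomial RW.
have gG : ratgen RG (lielist LW) by exact: ratgen_lie.
have sG : @pmem K G `<=` hspan RG by exact: (sub_lie sW).
have RWm : RW `<=` @pmem K W by move=> x _; exact: sub_hspan.
have RUm : RU `<=` @pmem K U.
  by move=> _ [xs hxs ->]; apply: pure_pmem => x /hxs; exact: RWm.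
have RGm : RG `<=` @pmem K G by move=> x /(lie_monoS RWm); exact: sub_hspan.
pose RO : set (series K (pidx D1)) :=
  [set t | exists x y, [/\ RU x, RG y & t = @tens K (pidx U) (pidx G) x y]].
(* A 1-form has no part of weight 0 because its second tensor factor lies in the Lie algebra; hence
   the words in 1-forms of a given weight are again finite in number. *)
have [LO [gO LO0]] : exists LO, ratgen RO LO /\ LO 0%N = [::].
  eexists; split; first exact: (ratgen_tens gU gG).
  by [].
have sO : @pmem K D1 `<=` hspan RO by exact: (sub_tens sU sG).
have ROm : RO `<=` @pmem K D1.
  move=> _ [x [y [hx hy ->]]]; apply: (tens_mem (P := U) (Q := G)).
    exact: RUm.
  exact: RGm.
pose RL : set (series K (pidx L1)) := lie_monomial RO.
have gL : ratgen RL (lielist LO) by exact: ratgen_lie.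
have sL : @pmem K L1 `<=` hspan RL by exact: (sub_lie (P := D1) sO).
have RLm : RL `<=` @pmem K L1 by move=> x /(lie_monoS ROm); exact: sub_hspan.
pose R : set (series K (pidx Om)) :=
  [set r | exists2 x, RG x & r = copair x 0] `|` [set r | exists2 x, RL x & r = copair 0 x].
exists R, (fun w => [seq inl b | b <- lielist LW w] ++ [seq inr b | b <- lielist LO w]); split.
- move=> _ [[x Rx ->]|[x Rx ->]].
    have [rx [w sx]] := gG _ Rx; split; first by move=> [b|b]; [exact: rx | exact: isq0].
    exists w => -[b|b] // hb; apply: sx; apply: contraNN hb => /andP[e bL] /=.
    by rewrite e mem_cat map_f.
  have [rx [w sx]] := gL _ Rx; split; first by move=> [b|b]; [exact: isq0 | exact: rx].
  exists w => -[b|b] // hb; apply: sx; apply: contraNN hb => /andP[e bL] /=.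
  by rewrite e mem_cat map_f ?orbT.
- move=> r [r1 r2]; rewrite -(linK r) copairE; apply: (submodD (@hspan_submod K _ R)).
    apply: (hspan_map (@copair_l_rfin K (pidx G) DW) _ _ _ (sG _ r1));
      [exact: hspan_submod | exact: hspan_sclosed |].
    by move=> x Rx; apply: sub_hspan; left; exists x.
  apply: (hspan_map (@copair_r_rfin K (pidx G) DW) _ _ _ (sL _ r2));
      [exact: hspan_submod | exact: hspan_sclosed |].
  by move=> x Rx; apply: sub_hspan; right; exists x.
have [[cO _] _] := good_Om K V.
apply: hspan_min => //; first exact: pmem_submod.
move=> _ [[x Rx ->]|[x Rx ->]].
  by split; [exact: RGm | exact: pmem0].
by split; [exact: pmem0 | exact: RLm].
Qed.

Section Graph.
Variables (P Q : pmod K) (f : series K (pidx P) -> series K (pidx Q)) (b : el P -> el Q).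
Hypotheses (gP : good P) (gQ : good Q) (hf : rfin f) (hb : continuous_linear b).
Definition graph_ok (r : series K (pidx P)) := @pmem K Q (f r) /\ cls Q (f r) = b (cls P r).

(** To see that the series map [f] represents the map [b] of classes, weight-homogeneous members
    suffice: finitely many weight components approximate any member on a prescribed finite set, and
    both maps are continuous. *)
Lemma graph_all : (forall w r, pmem r -> supp_in (fun c => gwt c == w) r -> graph_ok r) ->
  forall r, pmem r -> graph_ok r.
Proof.
move=> hw r hr; have [[cP _] _] := gP; have [[cQ rQ] _] := gQ.
have app (F : seq (pidx P)) : exists2 s, [/\ pmem s, pmem (f s) & cls Q (f s) = b (cls P s)] & {in F, s =1 r}.
  pose c w := kdiag (chW K) (fun q => (q == 2%:R ^+ w)%:R) r.
  have hc w : pmem (c w).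
    by case: (kdiag_mem (fun q => (q == 2%:R ^+ w)%:R) gP (@clW K) r) => h _; exact: h.
  have oc w : graph_ok (c w).
    apply: (hw w) => // b' hb'; rewrite /c /kdiag lamW.
    by case: eqP => [/pow2_inj e|_]; [rewrite e eqxx in hb' | rewrite rmorph0 mul0r].
  pose l := undup [seq gwt b' | b' <- F].
  exists (\sum_(w <- l) c w).
    have h1 : pmem (f (\sum_(w <- l) c w)).
      rewrite (rfin_sum hf); apply: (submod_sum (@pmem_submod K Q)) => w _ _.
      by case: (oc w).
    split=> //; first by apply: (submod_sum (@pmem_submod K P)).
    rewrite (rfin_sum hf) cls_sum => [|w _]; last by case: (oc w).
    rewrite cls_sum // (cadd_sum (clin_cadd hb)); apply: eq_bigr => w _.
    by case: (oc w).
  move=> b' bF; rewrite series_sumE (bigD1_seq (gwt b')) ?undup_uniq ?mem_undup ?map_f //=.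
  rewrite /c /kdiag lamW eqxx rmorph1 mul1r big1 ?addr0 // => w wb.
  case: eqP => [/pow2_inj e|_]; first by rewrite e eqxx in wb.
  by rewrite rmorph0 mul0r.
have hfr : pmem (f r).
  apply: (sclosed_preim hf cQ) => F; have [s [_ h _] e] := app F; by exists s.
split=> //; apply/eqP; rewrite -subr_eq0; apply/eqP; apply: haus; first by case: gQ.
move=> F; have [_ cb] := hb; have [F1 h1] := cb F.
have [F2 h2] := rfin_nbhs hf F.
have [s [hs hfs es] e] := app (F1 ++ F2).
have e0 : {in F1 ++ F2, forall c, (r - s) c = 0}.
  by move=> c cF; rewrite -[LHS]/(r c - s c) e // subrr.
have hrs : pmem (r - s) by apply: submodB => //; exact: pmem_submod.
have -> : cls Q (f r) - b (cls P r) = cls Q (f (r - s)) - b (cls P (r - s)).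
  rewrite (rfinB hf) clsB // clsB // (caddB (clin_cadd hb)) es.
  by rewrite opprB addrA subrK.
apply: nzB.
  apply: nz_cls; first by rewrite (rfinB hf); apply: submodB => //; exact: pmem_submod.
  by apply: h2 => c cF; apply: e0; rewrite mem_cat cF orbT.
apply: h1; apply: nz_cls => // c cF.
by apply: e0; rewrite mem_cat cF.
Qed.
End Graph.

Notation DRm := (DRmod K V).

Lemma sum_one n (i0 : 'I_n) (phi : 'I_n -> K) :
  (forall i, i != i0 -> phi i = 0) -> \sum_i phi i = phi i0.
Proof. by move=> h; rewrite (bigD1 i0) //= big1 ?addr0. Qed.

(** The map [m] lives on classes, whereas a map out of the completed tensor product must be given on
    series. It is lifted on the generators of each pair of weights; compatibility with weights makes
    the lift row-finite, and the last two hypotheses kill the two families of relations of DR. *)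
Lemma DR_univ (m : el Om -> el Om -> el DRm) :
  (forall x, @continuous_linear K Om DRm (m x)) ->
  (forall y, @continuous_linear K Om DRm (m^~ y)) ->
  (forall x y, @Sg K (chW K) DRm (m x y) = m (Sg (chW K) x) (Sg (chW K) y)) ->
  (forall i j x y, homog i x -> homog j y -> m x y = ksign K (i * j) *: m y x) ->
  (forall x y z, m x (@gl_br K Om y z) = m (@gl_br K Om x y) z) ->
  exists E, @continuous_linear K DRm DRm E /\ forall x y, E (drpair x y) = m x y.
Proof.
move=> m1 m2 mw ms mi; have gO := @good_Om K V; have gD := @good_DR K V.
have [R [L [gR sR Rs]]] := Om_rational.
have hb w : exists d : {n : nat & (('I_n -> pidx Om) * ('I_n -> series K (pidx Om)))%type},
   [/\ forall i, gwt ((projT2 d).1 i) = w, forall i, hspan R ((projT2 d).2 i),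
       forall i, supp_in (fun c => gwt c == w) ((projT2 d).2 i) &
       forall x, hspan R x -> forall c, gwt c = w ->
         x c = \sum_i x ((projT2 d).1 i) * (projT2 d).2 i c].
  by have [n [b [e h]]] := wbasis w gR; exists (existT _ n (b, e)).
have [d hd] := choice hb.
pose b w i := (projT2 (d w)).1 i; pose e w i := (projT2 (d w)).2 i.
have he w i : @pmem K Om (e w i) by apply: Rs; case: (hd w) => _ h _ _; exact: h.
have bw w i : gwt (b w i) = w by case: (hd w) => h _ _ _; exact: h.
have ew w i : supp_in (fun c => gwt c == w) (e w i) by case: (hd w) => _ _ h _; exact: h.
have hx w r : @pmem K Om r -> supp_in (fun c => gwt c == w) r ->
    r = \sum_i r (b w i) *: e w i.
  move=> hr sr; apply: funext => c; rewrite series_sumE.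
  have [cw|cw] := eqVneq (gwt c) w; first by case: (hd w) => _ _ _ /(_ r (sR _ hr) c cw).
  rewrite sr // big1 // => i _; rewrite -[LHS]/(_ * _).
  by rewrite ew // mulr0.
have seig w r : @pmem K Om r -> supp_in (fun c => gwt c == w) r ->
    Sg (chW K) (cls Om r) = qk K (2%:R ^+ w) *: cls Om r.
  move=> hr sr; apply/(supp_wt1 gO w); exists r => // c; apply: contraNT => cw.
  by apply/eqP; exact: sr.
have hes u v i j : exists r, [/\ @pmem K DRm r,
    cls DRm r = m (cls Om (e u i)) (cls Om (e v j)) & supp_in (fun c => gwt c == u + v)%N r].
  have : @Sg K (chW K) DRm (m (cls Om (e u i)) (cls Om (e v j))) =
      qk K (2%:R ^+ (u + v)%N) *: m (cls Om (e u i)) (cls Om (e v j)).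
    rewrite mw (seig u _ (he u i) (ew u i)) (seig v _ (he v j) (ew v j)) (clinZ _ _ (m2 _)) (clinZ _ _ (m1 _)) scalerA.
    by rewrite exprD rmorphM.
  move/(supp_wt1 gD) => [r [hr er] sr]; exists r; split=> // c; apply: contraNeq; exact: sr.
have [ee hee] : exists ee : forall u v, 'I_(projT1 (d u)) -> 'I_(projT1 (d v)) -> series K (pidx DRm),
   forall u v i j, [/\ @pmem K DRm (ee u v i j),
     cls DRm (ee u v i j) = m (cls Om (e u i)) (cls Om (e v j)) &
     supp_in (fun c => gwt c == u + v)%N (ee u v i j)].
  exists (fun u v i j => projT1 (cid (hes u v i j))) => u v i j.
  exact: (projT2 (cid (hes u v i j))).
(* Since [ee u v] is supported in weight u + v, only the finitely many splittings of the weight of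
   [t] contribute to this coefficient. *)
pose f (F : series K (pairs (pidx Om) (pidx Om))) : series K (pidx DRm) := fun t =>
  \sum_(u < (gwt t).+1) \sum_i \sum_j F (b u i, b (gwt t - u)%N j) * ee u (gwt t - u)%N i j t.
have hf : rfin f.
  move=> t; apply: ffl_sum => u _; apply: ffl_sum => i _; apply: ffl_sum => j _.
  by apply: ffl_mulr; exact: (@ffl_ev K (pairs (pidx Om) (pidx Om))).
have f_hom u v r s : @pmem K Om r -> @pmem K Om s -> supp_in (fun c => gwt c == u) r ->
    supp_in (fun c => gwt c == v) s ->
    f (tens r s) = \sum_i \sum_j (r (b u i) * s (b v j)) *: ee u v i j.
  move=> hr hs sr ss; apply: funext => t; rewrite /f series_sumE.
  have [tw|tw] := eqVneq (gwt t) (u + v)%N; last first.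
    transitivity (0 : K).
      rewrite big1 // => u' _; rewrite big1 // => i _; rewrite big1 // => j _.
      rewrite /tens /=; have [eu|nu] := eqVneq (u' : nat) u; last by rewrite sr ?bw // !mul0r.
      rewrite ss ?mulr0 ?mul0r // bw; apply: contraNneq tw => <-.
      by rewrite -eu subnKC // -ltnS.
    rewrite big1 // => i _; rewrite series_sumE big1 // => j _.
    by rewrite -[LHS]/(_ * _); case: (hee u v i j) => _ _ -> //; rewrite mulr0.
  have uu : (u < (gwt t).+1)%N by rewrite tw ltnS leq_addr.
  rewrite (sum_one (i0 := Ordinal uu)); last first.
    move=> u' nu; rewrite big1 // => i _; rewrite big1 // => j _.
    by rewrite /tens sr ?mul0r // bw.
  change (nat_of_ord (Ordinal uu)) with u.
  have -> : (gwt t - u)%N = v by rewrite tw addKn.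
  apply: eq_bigr => i _; rewrite series_sumE; apply: eq_bigr => j _.
  by [].
have ok r s : @pmem K Om r -> @pmem K Om s ->
    @pmem K DRm (f (tens r s)) /\ cls DRm (f (tens r s)) = m (cls Om r) (cls Om s).
  have [t1 t2] := @tens_bifin K (pidx Om) (pidx Om).
  move=> hr hs.
  apply: (@graph_all Om DRm (fun r => f (tens r s)) (m^~ (cls Om s)) gO gD
     (rfin_comp (t2 s) hf) (m2 _) _ _ hr) => u r' hr' sr'.
  apply: (@graph_all Om DRm (fun s => f (tens r' s)) (m (cls Om r')) gO gD
     (rfin_comp (t1 r') hf) (m1 _) _ _ hs) => v s' hs' ss'.
  have hee' i j : @pmem K DRm ((r' (b u i) * s' (b v j)) *: ee u v i j).
    by apply: (submodZ _ (@pmem_submod K DRm)); case: (hee u v i j).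
  rewrite /graph_ok (f_hom u v) //; split.
    apply: (submod_sum (@pmem_submod K DRm)) => i _ _.
    by apply: (submod_sum (@pmem_submod K DRm)) => j _ _.
  rewrite (@cls_sum K DRm); last first.
    by move=> i _; apply: (submod_sum (@pmem_submod K DRm)) => j _ _.
  rewrite [in RHS](hx u r' hr' sr') cls_sum; last first.
    by move=> i _; apply: (submodZ _ (@pmem_submod K Om)).
  rewrite (cadd_sum (clin_cadd (m2 _))); apply: eq_bigr => i _.
  rewrite (@cls_sum K DRm) //.
  rewrite [in RHS](hx v s' hs' ss') cls_sum; last first.
    by move=> j _; apply: (submodZ _ (@pmem_submod K Om)).
  rewrite (cadd_sum (clin_cadd (m1 _))); apply: eq_bigr => j _.
  have [h1 h2 _] := hee u v i j.
  rewrite (@clsZ K DRm) // h2 !clsZ // (clinZ _ _ (m1 _)) (clinZ _ _ (m2 _)) scalerA.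
  by rewrite mulrC.
have fmem F : @pmem K DRm F -> @pmem K DRm (f F).
  apply: (hspan_map hf (@pmem_submod K DRm)); first by case: gD => -[].
  by move=> _ [x [y [hx' hy ->]]]; case: (ok _ _ hx' hy).
have rel_of F : @pmem K DRm (f F) -> cls DRm (f F) = 0 -> @prel K DRm (f F).
  by move=> h1 h2; apply/(@cls_eq0 K DRm).
have gDr : sclosed (@prel K DRm) by case: gD => -[].
have cls0P x : @pmem K Om x -> @prel K Om x -> cls Om x = 0.
  by move=> h1 h2; apply/cls_eq0.
have frel F : @prel K DRm F -> @prel K DRm (f F).
  apply: (hspan_map hf (@prel_submod K DRm)) => // G' [h|].
    move: G' h; apply: (hspan_map hf (@prel_submod K DRm)) => // _ [x [y [hx' hy h ->]]].
    have [h1 h2] := ok _ _ hx' hy; apply: rel_of => //; rewrite h2.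
    case: h => h; rewrite (cls0P _ _ h) //.
      exact: (cadd0 (clin_cadd (m2 _))).
    exact: (cadd0 (clin_cadd (m1 _))).
  have hO : submod (@pmem K DRm) by exact: pmem_submod.
  move=> [[i [j [x [y [[hx' sx] [hy sy] ->]]]]]|[x [y [z [hx' hy hz ->]]]]].
    have [h1 h2] := ok _ _ hx' hy; have [h3 h4] := ok _ _ hy hx'.
    rewrite (rfinB hf) (rfinZ hf); apply/(@cls_eq0 K DRm).
      by apply: (submodB hO) => //; apply: (submodZ _ hO).
    rewrite (@clsB K DRm) // ?(@clsZ K DRm) //; last exact: (submodZ _ hO).
    by rewrite h2 h4 -(ms i j) ?subrr //; [exists x | exists y].
  have hyz : @pmem K Om (Obr y z) by exact: Obr_mem.
  have hxy : @pmem K Om (Obr x y) by exact: Obr_mem.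
  have [h1 h2] := ok _ _ hx' hyz; have [h3 h4] := ok _ _ hxy hz.
  rewrite (rfinB hf); apply/(@cls_eq0 K DRm); first exact: (submodB hO).
  by rewrite (@clsB K DRm) // h2 h4 -!brE // mi subrr.
have fB : forall x y, f (x - y) = f x - f y by exact: (rfinB hf).
(* The series map preserves members and relations, so it induces the required map of classes. *)
exists (@elmap K DRm DRm f); split.
  by apply: elmap_clin => // x _; exact: frel.
move=> x y; have [r hr ->] := elP x; have [s hs ->] := elP y.
rewrite dpE // elmap_cls //; first by case: (ok _ _ hr hs).
  by move=> z _; exact: frel.
exact: (tens_mem (P := Om) (Q := Om)).
Qed.

End Universal.

Lemma zmod_comm_aux (Z : zmodType) (a b c d a' d' : Z) :
  a + b + (c + d) - (a' + c + (b + d')) = a - a' + (d - d').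
Proof.
have -> : a + b + (c + d) = (a + d) + (b + c) by rewrite [RHS]addrACA (addrC d).
have -> : a' + c + (b + d') = (a' + d') + (b + c).
  by rewrite (addrC b c) [RHS]addrACA (addrC d').
by rewrite opprD addrACA subrr addr0 opprD addrACA.
Qed.

(** * Derivations and the operators they induce *)

Section Derivations.
Variable K : evenRing.
Implicit Types (P Q : pmod K) (chi : chr K).

Definition par k P (x : el P) : el P := Sg (chP K k) x.

Lemma par_clin k P : good P -> continuous_linear (@par k P).
Proof. by move=> gP; apply: Sg_clin. Qed.

Lemma Sg_par chi k P (x : el P) : good P -> Sg chi (par k x) = par k (Sg chi x).
Proof.
move=> gP; have [r hr ->] := elP x; rewrite /par.
have h1 chi' : pmem (sig chi' r) by exact: good_pmem.
rewrite !Sg_cls //; congr (cls P _); apply: funext => b; rewrite sigPE.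
rewrite -[LHS]/(qk K (lam chi b) * ctau chi (sig (chP K k) r b)) sigPE.
by rewrite -qk_signz ctau_qk mulrCA.
Qed.

Lemma par_par k l P (x : el P) : good P -> par k (par l x) = par (k + l) x.
Proof.
move=> gP; have [r hr ->] := elP x; rewrite /par.
have h1 chi' : pmem (sig chi' r) by exact: good_pmem.
rewrite !Sg_cls //; congr (cls P _); apply: funext => b; rewrite !sigPE mulrA.
by rewrite -ksignM mulrDl.
Qed.

Lemma par0 P (x : el P) : good P -> par 0 x = x.
Proof.
move=> gP; have [r hr ->] := elP x; rewrite /par !Sg_cls //; congr (cls P _).
by apply: funext => b; rewrite sigPE mul0r /ksign expr0 mul1r.
Qed.

(** Having degree k becomes an equation between additive continuous maps, valid on all elements;
    such equations can be checked on generators. *)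
Lemma degreeP P Q k (f : el P -> el Q) : good P -> good Q -> cadd f ->
  (forall q x, f (qk K q *: x) = qk K q *: f x) ->
  has_degree k f <-> forall x, Sg (chD K) (f x) = qk K (2%:R ^ k) *: f (Sg (chD K) x).
Proof.
move=> gP gQ hf fq; split=> [h|h i x].
  apply: (homog_dense gP).
  - apply: (@eclosed_eq _ _ _ (@Sg K (chD K) Q \o f)
       (fun x => qk K (2%:R ^ k) *: (f \o @Sg K (chD K) P) x)); first by case: gQ.
      by apply: cadd_comp => //; exact: Sg_cadd.
    by apply: cadd_scale; apply: cadd_comp => //; exact: Sg_cadd.
  - by rewrite (cadd0 hf) !(cadd0 (Sg_cadd _ _)) // (cadd0 hf) scaler0.
  - move=> x y ex ey; rewrite (caddD hf) !(caddD (Sg_cadd _ _)) // (caddD hf) scalerDr.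
    by rewrite ex ey.
  move=> i x hx; move/(homogP _ _ gQ): (h _ _ hx) => ->.
  move/(homogP _ _ gP): hx => ->; rewrite fq scalerA -rmorphM /=.
  by rewrite -expfzDr // addrC.
move/(homogP _ _ gP) => e; apply/(homogP _ _ gQ); rewrite h e fq scalerA -rmorphM /=.
by rewrite -expfzDr // addrC.
Qed.

Lemma parE P k i (x : el P) : good P -> homog i x -> par k x = ksign K (k * i) *: x.
Proof. by move=> gP; exact: par_homog. Qed.

Lemma par_degree P Q j k (f : el P -> el Q) x : good P -> good Q -> continuous_linear f ->
  has_degree k f -> par j (f x) = ksign K (j * k) *: f (par j x).
Proof.
move=> gP gQ hf hd; move: x; apply: (homog_dense gP).
- apply: (@eclosed_eq _ _ _ (@par j Q \o f) (fun x => ksign K (j * k) *: (f \o @par j P) x)).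
  + by case: gQ.
  + by apply: clin_cadd; apply: clin_comp => //; exact: par_clin.
  + by apply: clin_cadd; apply: clin_scale; apply: clin_comp => //; exact: par_clin.
- by rewrite (cadd0 (clin_cadd hf)) /par !(cadd0 (Sg_cadd _ _)) // (cadd0 (clin_cadd hf)) scaler0.
- move=> x y ex ey; rewrite (caddD (clin_cadd hf)) /par !(caddD (Sg_cadd _ _)) //.
  by rewrite (caddD (clin_cadd hf)) scalerDr -/(par j _) ex -/(par j (f y)) ey.
move=> i x hx; rewrite (parE j gQ (hd _ _ hx)) (parE j gP hx).
by rewrite (clinZ _ _ hf) scalerA mulrDr ksignM mulrC.
Qed.

Section GL.
Variable L : glie K.
Hypotheses (gL : good L) (b1 : forall x, continuous_linear (@gl_br K L x))
  (b2 : forall y, continuous_linear (fun x => @gl_br K L x y))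
  (bS : forall chi x y, Sg chi (@gl_br K L x y) = gl_br (Sg chi x) (Sg chi y)).
Notation br := (@gl_br K L).

Lemma brDl x x' y : br (x + x') y = br x y + br x' y.
Proof. exact: (caddD (clin_cadd (b2 y))). Qed.
Lemma brDr x y y' : br x (y + y') = br x y + br x y'.
Proof. exact: (caddD (clin_cadd (b1 x))). Qed.
Lemma brZl a x y : br (a *: x) y = a *: br x y.
Proof. exact: (clinZ a x (b2 y)). Qed.
Lemma brZr a x y : br x (a *: y) = a *: br x y.
Proof. exact: (clinZ a y (b1 x)). Qed.
Lemma br0l y : br 0 y = 0. Proof. exact: (cadd0 (clin_cadd (b2 y))). Qed.
Lemma br0r x : br x 0 = 0. Proof. exact: (cadd0 (clin_cadd (b1 x))). Qed.
Lemma brBl x x' y : br (x - x') y = br x y - br x' y.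
Proof. exact: (caddB (clin_cadd (b2 y))). Qed.
Lemma brBr x y y' : br x (y - y') = br x y - br x y'.
Proof. exact: (caddB (clin_cadd (b1 x))). Qed.

(** The Leibniz rule with the sign written as the operator [par k], so that it makes sense for
    inhomogeneous elements and is preserved by limits. *)
Definition full_leibniz k (D : el L -> el L) :=
  forall x y, D (br x y) = br (D x) y + br (par k x) (D y).

Lemma der_full k D : is_derivation (L := L) k D -> full_leibniz k D.
Proof.
move=> [hD dD hl] x y; move: x; apply: (homog_dense gL).
- apply: (@eclosed_eq _ _ _ (fun x => D (br x y)) (fun x => br (D x) y + br (par k x) (D y))).
  + by case: gL.
  + by apply: clin_cadd; exact: (clin_comp (b2 y) hD).
  + apply: clin_cadd; apply: clin_add; first exact: (clin_comp hD (b2 y)).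
    exact: (clin_comp (par_clin k gL) (b2 (D y))).
- rewrite br0l /par (cadd0 (Sg_cadd _ gL)) (cadd0 (clin_cadd hD)) !br0l.
  by rewrite addr0.
- move=> x x' e e'; rewrite brDl /par (caddD (Sg_cadd _ gL)) !(caddD (clin_cadd hD)).
  by rewrite !brDl e e' addrACA.
by move=> i x hx; rewrite (parE k gL hx) (hl _ _ _ hx) brZl.
Qed.

Lemma full_der k D : continuous_linear D -> has_degree k D -> full_leibniz k D ->
  is_derivation (L := L) k D.
Proof.
by move=> h1 h2 h3; split=> // i x y hx; rewrite h3 (parE k gL hx) brZl.
Qed.

Lemma der_par k j D x : is_derivation (L := L) k D ->
  par j (D x) = ksign K (j * k) *: D (par j x).
Proof. by move=> [h1 h2 _]; exact: par_degree. Qed.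

Lemma homogD k (x y : el L) : homog k x -> homog k y -> homog k (x + y).
Proof.
move=> /(homogP _ _ gL) hx /(homogP _ _ gL) hy; apply/(homogP _ _ gL).
by rewrite (caddD (Sg_cadd _ gL)) hx hy scalerDr.
Qed.

Lemma homogZs k j (x : el L) : homog k x -> homog k (ksign K j *: x).
Proof.
move=> /(homogP _ _ gL) hx; apply/(homogP _ _ gL).
by rewrite -qk_signz SgZq // hx !scalerA mulrC.
Qed.

Lemma der_comm k l D E : is_derivation (L := L) k D -> is_derivation (L := L) l E ->
  is_derivation (L := L) (k + l) (fun x => D (E x) - ksign K (k * l) *: E (D x)).
Proof.
move=> hD hE; have lD := der_full hD; have lE := der_full hE.
have [cD dD _] := hD; have [cE dE _] := hE.
apply: full_der.
- by apply: clin_sub; [exact: (clin_comp cE cD) | apply: clin_scale; exact: (clin_comp cD cE)].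
- move=> i x hx; apply: homogD; first by rewrite (addrC k) addrA; apply: dD; exact: dE.
  rewrite -scaleN1r; rewrite [X in X *: _](_ : _ = ksign K 1); last by rewrite /ksign expr1.
  by apply: homogZs; apply: homogZs; rewrite addrA; apply: dE; exact: dD.
move=> x y; rewrite lE lD !(caddD (clin_cadd cD)) !(caddD (clin_cadd cE)) !lD !lE.
rewrite (der_par k x hE) brBl brBr !brZl !brZr.
have -> : D (par l x) = ksign K (k * l) *: par l (D x).
  by rewrite (der_par l x hD) scalerA (mulrC l) ksignMK scale1r.
rewrite !brZl !par_par // (addrC l k) !scalerDr.
exact: zmod_comm_aux.
Qed.

(** The elements on which [D] intertwines the rescaling up to the factor c form a closed submodule
    stable under the bracket, so generators decide. *)
Lemma full_sig chi c k D : continuous_linear D -> full_leibniz k D ->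
  submod [set x | Sg chi (D x) = qk K c *: D (Sg chi x)] /\ eclosed [set x | Sg chi (D x) = qk K c *: D (Sg chi x)] /\ forall x y, Sg chi (D x) = qk K c *: D (Sg chi x) ->
   Sg chi (D y) = qk K c *: D (Sg chi y) -> Sg chi (D (br x y)) = qk K c *: D (Sg chi (br x y)).
Proof.
move=> cD lD; have sD := clin_cadd cD; have sS := Sg_cadd chi gL; split; last split.
- split=> [|a x y] /=.
    by rewrite (cadd0 sD) !(cadd0 sS) (cadd0 sD) scaler0.
  move=> ex ey; rewrite (caddD sD) !(caddD sS) (clinZ _ _ cD) !SgZ // ex ey.
  by rewrite (caddD sD) (clinZ _ _ cD) scalerDr !scalerA mulrC.
- apply: (@eclosed_eq _ _ _ (@Sg K chi L \o D) (fun x => qk K c *: (D \o @Sg K chi L) x)).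
  + by case: gL.
  + exact: cadd_comp.
  + by apply: cadd_scale; exact: cadd_comp.
move=> x y ex ey; rewrite lD (caddD sS) !bS ex ey Sg_par // brZl brZr -scalerDr.
by rewrite -lD.
Qed.

End GL.
End Derivations.

(** * Operators on DR induced by derivations; the exterior differential *)

Section Exterior.
Variables (K : evenRing) (V : fgmod).
Notation G := (gLie K V).
Notation D1 := (desusp_pmod (Omega1 K V)).
Notation Om := (Omega K V).

Notation brO := (@gl_br K Om).
Notation DRm := (DRmod K V).
Notation gO := (good_Om K V).
Notation gG := (good_G K V).
Notation gDR := (good_DR K V).

Lemma par_br k x y : par k (brO x y) = brO (par k x) (par k y).
Proof. exact: Sg_br. Qed.

(** The twists [F] and [F'] are arbitrary: with [id] and [par k] this covers derivations, with a
    pullback it covers compositions of a derivation and a homomorphism. *)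
Lemma Om_uniq (D1 D2 F F' : el Om -> el Om) :
  continuous_linear D1 -> continuous_linear D2 ->
  (forall x y, D1 (brO x y) = brO (D1 x) (F y) + brO (F' x) (D1 y)) ->
  (forall x y, D2 (brO x y) = brO (D2 x) (F y) + brO (F' x) (D2 y)) ->
  (forall y, D1 (inO y) = D2 (inO y)) -> (forall y, D1 (oneform y) = D2 (oneform y)) ->
  forall x, D1 x = D2 x.
Proof.
move=> c1 c2 l1 l2 ei eo; apply: (Om_ind (A := [set x | D1 x = D2 x])) => //.
- exact: submod_eqs.
- by apply: eclosed_eq; [case: gO | exact: clin_cadd | exact: clin_cadd].
by move=> x y /= ex ey; rewrite l1 l2 ex ey.
Qed.

Lemma Om_uniq_hom (f1 f2 : el Om -> el Om) :
  lie_hom (L := Om) (L' := Om) f1 -> lie_hom (L := Om) (L' := Om) f2 ->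
  (forall y, f1 (inO y) = f2 (inO y)) -> (forall y, f1 (oneform y) = f2 (oneform y)) ->
  forall x, f1 x = f2 x.
Proof.
move=> [c1 l1] [c2 l2] ei eo; apply: (Om_ind (A := [set x | f1 x = f2 x])) => //.
- exact: submod_eqs.
- by apply: eclosed_eq; [case: gO | exact: clin_cadd | exact: clin_cadd].
by move=> x y /= ex ey; rewrite l1 l2 ex ey.
Qed.

Lemma DR_uniq (Q : pmod K) (E1 E2 : el DRm -> el Q) : pclosed Q ->
  continuous_linear E1 -> continuous_linear E2 ->
  (forall x y, E1 (drpair x y) = E2 (drpair x y)) -> forall z, E1 z = E2 z.
Proof.
move=> gQ c1 c2 e; apply: (DR_ind (A := [set x | E1 x = E2 x])) => //.
- exact: submod_eqs.
- by apply: eclosed_eq; [| exact: clin_cadd | exact: clin_cadd].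
Qed.

Definition full_derO := @der_full K Om gO (@br_clinl K V).
Definition der_fullO := @full_der K Om gO (@br_clinl K V).
Definition der_commO := @der_comm K Om gO (@br_clinr K V) (@br_clinl K V).
Definition full_derG := @der_full K G gG (@brG_clinl K V).
Definition der_fullG := @full_der K G gG (@brG_clinl K V).
Definition der_commG := @der_comm K G gG (@brG_clinr K V) (@brG_clinl K V).

Lemma der_uniqO k (D1 D2 : el Om -> el Om) :
  is_derivation (L := Om) k D1 -> is_derivation (L := Om) k D2 ->
  (forall y, D1 (inO y) = D2 (inO y)) -> (forall y, D1 (oneform y) = D2 (oneform y)) ->
  forall x, D1 x = D2 x.
Proof.
move=> h1 h2; have f1 := full_derO h1; have f2 := full_derO h2.
by apply: (Om_uniq (F := id) (F' := @par K k Om)) f1 f2; [case: h1 | case: h2].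
Qed.

Lemma der_sigO chi c k (D : el Om -> el Om) : is_derivation (L := Om) k D ->
  (forall y, Sg chi (D (inO y)) = qk K c *: D (Sg chi (inO y))) ->
  (forall y, Sg chi (D (oneform y)) = qk K c *: D (Sg chi (oneform y))) ->
  forall x, Sg chi (D x) = qk K c *: D (Sg chi x).
Proof.
move=> hD hi ho; have [cD _ _] := hD.
have [h1 [h2 h3]] := full_sig gO (@br_clinr K V) (@br_clinl K V) (@Sg_br K V) chi c cD (full_derO hD).
exact: (Om_ind h1 h2 hi ho h3).
Qed.

Definition dspec k (D : el Om -> el Om) (E : el DRm -> el DRm) :=
  @continuous_linear K DRm DRm E /\ forall x y, E (drpair x y) = drpair (D x) y + drpair (par k x) (D y).

Lemma dpDl (x x' y : el Om) : drpair (x + x') y = drpair x y + drpair x' y.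
Proof. exact: (caddD (clin_cadd (dp_clinl y))). Qed.
Lemma dpDr (x y y' : el Om) : drpair x (y + y') = drpair x y + drpair x y'.
Proof. exact: (caddD (clin_cadd (dp_clinr x))). Qed.
Lemma dpZl a (x y : el Om) : drpair (a *: x) y = a *: drpair x y.
Proof. exact: (clinZ a x (dp_clinl y)). Qed.
Lemma dpZr a (x y : el Om) : drpair x (a *: y) = a *: drpair x y.
Proof. exact: (clinZ a y (dp_clinr x)). Qed.
Lemma dpBl (x x' y : el Om) : drpair (x - x') y = drpair x y - drpair x' y.
Proof. exact: (caddB (clin_cadd (dp_clinl y))). Qed.
Lemma dpBr (x y y' : el Om) : drpair x (y - y') = drpair x y - drpair x y'.
Proof. exact: (caddB (clin_cadd (dp_clinr x))). Qed.
Lemma dp0l (y : el Om) : drpair 0 y = 0.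
Proof. exact: (cadd0 (clin_cadd (dp_clinl y))). Qed.
Lemma dp0r (x : el Om) : drpair x 0 = 0.
Proof. exact: (cadd0 (clin_cadd (dp_clinr x))). Qed.

Lemma dspecP k D E : continuous_linear D ->
  dspec k D E <-> (@continuous_linear K DRm DRm E /\ forall i x y, homog i x ->
      E (drpair x y) = drpair (D x) y + ksign K (k * i) *: drpair x (D y)).
Proof.
move=> cD; split=> -[cE h]; split=> //.
  by move=> i x y hx; rewrite h (parE k gO hx) dpZl.
move=> x y; move: x; apply: (homog_dense gO).
- apply: (@eclosed_eq _ _ _ (fun x => E (drpair x y))
    (fun x => drpair (D x) y + drpair (par k x) (D y))).
  + by case: gDR.
  + by apply: clin_cadd; exact: (clin_comp (dp_clinl y) cE).
  + apply: clin_cadd; apply: clin_add; first exact: (clin_comp cD (dp_clinl y)).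
    exact: (clin_comp (par_clin k gO) (dp_clinl (D y))).
- by rewrite (cadd0 (clin_cadd cD)) (cadd0 (clin_cadd (par_clin k gO))) !dp0l
    (cadd0 (clin_cadd cE)) addr0.
- move=> x x' e e'; rewrite (caddD (clin_cadd cD)) (caddD (clin_cadd (par_clin k gO))) !dpDl.
  by rewrite (caddD (clin_cadd cE)) e e' addrACA.
by move=> i x hx; rewrite (h i) // (parE k gO hx) dpZl.
Qed.

Lemma dspec_uniq k D E E' : dspec k D E -> dspec k D E' -> E = E'.
Proof.
move=> [c1 h1] [c2 h2]; apply: funext; apply: DR_uniq => //; first by case: gDR.
by move=> x y; rewrite h1 h2.
Qed.

Lemma der_DR_eq k D E : continuous_linear D -> dspec k D E -> der_DR k D = E.
Proof.
move=> cD hE; apply: (dspec_uniq (k := k) (D := D)) => //; apply/(dspecP _ _ cD).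
rewrite /der_DR; have : exists E, [set E | @continuous_linear K DRm DRm E /\
    forall i x y, homog i x ->
      E (drpair x y) = drpair (D x) y + ksign K (k * i) *: drpair x (D y)] E.
  by exists E; apply/dspecP.
by move=> /(xgetPex (fun=> 0)).
Qed.

Lemma dspec_comm k l D D' E E' : is_derivation (L := Om) k D -> is_derivation (L := Om) l D' ->
  dspec k D E -> dspec l D' E' ->
  dspec (k + l) (fun x => D (D' x) - ksign K (k * l) *: D' (D x))
                (fun z => E (E' z) - ksign K (k * l) *: E' (E z)).
Proof.
move=> hD hE [c1 l1] [c2 l2]; split.
  by apply: clin_sub; [exact: (clin_comp c2 c1) | apply: clin_scale; exact: (clin_comp c1 c2)].
move=> x y; rewrite l1 l2 !(caddD (clin_cadd c1)) !(caddD (clin_cadd c2)) !l1 !l2.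
rewrite (der_par gO k x hE) dpBl dpBr !dpZl !dpZr.
have -> : D (par l x) = ksign K (k * l) *: par l (D x).
  by rewrite (der_par gO l x hD) scalerA (mulrC l) ksignMK scale1r.
rewrite !dpZl !(par_par _ _ _ gO) (addrC l k) !scalerDr.
exact: zmod_comm_aux.
Qed.

Lemma dspec_sig chi c k D E : dspec k D E ->
  (forall x, Sg chi (D x) = qk K c *: D (Sg chi x)) ->
  forall z : el DRm, Sg chi (E z) = qk K c *: E (Sg chi z).
Proof.
move=> [cE lE] h; have sE := clin_cadd cE; have sS := Sg_cadd chi gDR.
apply: (DR_ind (A := [set z | Sg chi (E z) = qk K c *: E (Sg chi z)])).
- split=> [|a x y] /=.
    by rewrite (cadd0 sE) !(cadd0 sS) (cadd0 sE) scaler0.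
  move=> ex ey; rewrite (caddD sE) !(caddD sS) (clinZ _ _ cE) !(SgZ _ gDR) ex ey.
  by rewrite (caddD sE) (clinZ _ _ cE) scalerDr !scalerA mulrC.
- apply: (@eclosed_eq _ _ _ (@Sg K chi DRm \o E) (fun x => qk K c *: (E \o @Sg K chi DRm) x)).
  + by case: gDR.
  + exact: cadd_comp.
  + by apply: cadd_scale; exact: cadd_comp.
move=> x y /=; rewrite lE (caddD sS) !Sg_dp lE !h dpZl dpZr -scalerDr.
by rewrite (Sg_par _ _ _ gO).
Qed.

Lemma dspec_degree k D E : is_derivation (L := Om) k D -> dspec k D E ->
  @has_degree K DRm DRm k E.
Proof.
move=> [cD dD _] hE; have [cE _] := hE.
apply/(degreeP _ gDR gDR (clin_cadd cE)); first by move=> q x; rewrite (clinZ _ _ cE).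
apply: (dspec_sig hE); apply/(degreeP _ gO gO (clin_cadd cD)) => //.
by move=> q x; rewrite (clinZ _ _ cD).
Qed.

Definition d_ok := [/\ is_derivation (L := Om) 1 (@dO K V),
  forall y, dO (@inO K V y) = oneform y & forall x, dO (@dO K V x) = 0].

Section WithD.
Hypothesis hd : d_ok.
Let dder : is_derivation (L := Om) 1 (@dO K V). Proof. by case: hd. Qed.
Let din y : dO (@inO K V y) = oneform y. Proof. by case: hd. Qed.
Let dd x : dO (@dO K V x) = 0. Proof. by case: hd. Qed.

Lemma d_oneform y : dO (@oneform K V y) = 0. Proof. by rewrite -din dd. Qed.

Lemma dO_sig chi x : Sg chi (@dO K V x) = qk K (cfd chi * cdg chi) *: dO (Sg chi x).
Proof.
apply: (der_sigO dder) => y.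
  by rewrite din Sg_oneform Sg_inO din.
rewrite d_oneform (cadd0 (Sg_cadd _ gO)) Sg_oneform.
have [cD _ _] := dder; by rewrite (clinZ _ _ cD) d_oneform !scaler0.
Qed.

(** The Leibniz expression is fed into [DR_univ]: its symmetry follows from that of the pairing, its
    invariance from the derivation rule of [dO], and it respects weights because d does not change
    them. *)
Lemma dDR_ok : dspec 1 (@dO K V) (@dDR K V).
Proof.
have [cD dD _] := dder; have fD := full_derO dder.
have [E [cE hE]] : exists E, @continuous_linear K DRm DRm E /\
    forall x y, E (drpair x y) = drpair (dO x) y + drpair (par 1 x) (dO y).
  apply: (DR_univ (m := fun x y => drpair (dO x) y + drpair (par 1 x) (dO y))).
  - move=> x; apply: clin_add; first exact: dp_clinr.
    exact: (clin_comp cD (dp_clinr _)).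
  - move=> y; apply: clin_add; first exact: (clin_comp cD (dp_clinl y)).
    exact: (clin_comp (par_clin 1 gO) (dp_clinl _)).
  - move=> x y; rewrite (caddD (Sg_cadd _ gDR)) !Sg_dp !dO_sig /= mulr1 rmorph1 !scale1r.
    by rewrite (Sg_par _ _ _ gO).
  - move=> i j x y hx hy; rewrite (parE 1 gO hx) (parE 1 gO hy) !mul1r !dpZl.
    rewrite (dp_sym (dD _ _ hx) hy) (dp_sym hx (dD _ _ hy)) scalerDr !scalerA addrC.
    rewrite mulrDr mulr1 mulrDl mul1r !ksignM.
    congr (_ + _); congr (_ *: _).
    by rewrite mulrC -mulrA ksignMK mulr1.
  - move=> x y z; rewrite !fD (par_br 1) dpDl dpDr.
    by rewrite !dp_inv addrA.
have hE' : dspec 1 (@dO K V) E by [].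
by rewrite /dDR (der_DR_eq cD hE').
Qed.

Lemma dDR_sig chi (z : el DRm) : Sg chi (dDR z) = qk K (cfd chi * cdg chi) *: dDR (Sg chi z).
Proof. exact: (dspec_sig dDR_ok (dO_sig chi)). Qed.

(** The graded commutator of the odd operator d with itself is 2 d^2. It is induced by the
    corresponding commutator on the algebra of forms, which is zero. *)
Lemma dDR_dDR (z : el DRm) : dDR (dDR z) = 0.
Proof.
have := dspec_comm dder dder dDR_ok dDR_ok => h0.
have hz : dspec (1 + 1) (fun x => dO (dO x) - ksign K (1 * 1) *: dO (@dO K V x)) (fun=> 0).
  split=> [|x y]; first exact: clin_cst0.
  by rewrite !dd scaler0 subrr dp0l dp0r addr0.
have /(congr1 (fun f => f z)) := dspec_uniq h0 hz.
rewrite mulr1 /ksign expr1 scaleN1r opprK => e.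
have : qk K 2%:R^-1 *: (dDR (dDR z) + dDR (dDR z)) = 0 by rewrite e scaler0.
have -> : dDR (dDR z) + dDR (dDR z) = qk K 2%:R *: dDR (dDR z).
  by rewrite rmorph_nat mulr2n scalerDl scale1r.
by rewrite scalerA -rmorphM mulVf // rmorph1 scale1r.
Qed.
End WithD.

End Exterior.

(** * Weights of linear and bilinear maps; the Euler operator *)

Section WeightCalculus.
Variable K : evenRing.
Implicit Types (P Q R : pmod K).

Lemma kd_commute P Q (f : el P -> el Q) phi : good P -> good Q -> continuous_linear f ->
  (forall x, Sg (chW K) (f x) = f (Sg (chW K) x)) ->
  forall x, f (kd (chW K) phi x) = kd (chW K) phi (f x).
Proof.
move=> gP gQ cf h; apply: (wt_dense gP).
- apply: (@eclosed_eq _ _ _ (fun x => f (kd (chW K) phi x)) (fun x => kd (chW K) phi (f x))).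
  + by case: gQ.
  + by apply: clin_cadd; apply: (clin_comp _ cf); exact: kd_clin.
  + by apply: clin_cadd; apply: (clin_comp cf); exact: kd_clin.
- by rewrite (cadd0 (clin_cadd cf)) !(cadd0 (clin_cadd (kd_clin _ _ (@clW K)))) // (cadd0 (clin_cadd cf)).
- move=> x y ex ey; rewrite (caddD (clin_cadd cf)) !(caddD (clin_cadd (kd_clin _ _ (@clW K)))) //.
  by rewrite (caddD (clin_cadd cf)) ex ey.
move=> w x e; have e' : Sg (chW K) (f x) = qk K (2%:R ^+ w) *: f x by rewrite h e (clinZ _ _ cf).
by rewrite (kd_eig _ gP (@clW K) e) (kd_eig _ gQ (@clW K) e') (clinZ _ _ cf).
Qed.

(* The weight goes up by n - m; the two shifts avoid a truncated subtraction. *)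
Lemma wp_shift P Q (f : el P -> el Q) n m : good P -> good Q -> continuous_linear f ->
  (forall x, qk K (2%:R ^+ m) *: Sg (chW K) (f x) = qk K (2%:R ^+ n) *: f (Sg (chW K) x)) ->
  forall x w v, (w + n = v + m)%N -> wp v (f x) = f (wp w x).
Proof.
move=> gP gQ cf h x w v ewv; move: x; apply: (wt_dense gP).
- apply: (@eclosed_eq _ _ _ (fun x => wp v (f x)) (fun x => f (wp w x))).
  + by case: gQ.
  + by apply: clin_cadd; apply: (clin_comp cf); exact: wp_clin.
  + by apply: clin_cadd; apply: (clin_comp _ cf); exact: wp_clin.
- by rewrite (cadd0 (clin_cadd cf)) !(cadd0 (clin_cadd (wp_clin _ _))) // (cadd0 (clin_cadd cf)).
- move=> x y ex ey; rewrite (caddD (clin_cadd cf)) !(caddD (clin_cadd (wp_clin _ _))) //.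
  by rewrite (caddD (clin_cadd cf)) ex ey.
move=> u x e; rewrite (wp_eig gP w e).
have n0 k : (2%:R : rat) ^+ k != 0 by rewrite expf_neq0.
have [mn|mn] := leqP m (u + n)%N.
  have e' : Sg (chW K) (f x) = qk K (2%:R ^+ (u + n - m)%N) *: f x.
    have := h x; rewrite e (clinZ _ _ cf) scalerA -rmorphM /= -exprD.
    move/(congr1 (fun z => qk K (2%:R ^+ m)^-1 *: z)).
    rewrite !scalerA -!rmorphM /= mulVf // rmorph1 scale1r => ->.
    have -> : (n + u = m + (u + n - m))%N by lia.
    by rewrite exprD mulKf.
  rewrite (wp_eig gQ v e'); have -> : (u + n - m == v)%N = (u == w) by lia.
  by case: eqP => // _; rewrite (cadd0 (clin_cadd cf)).
(* Here the weight of the image would be negative. Its eigenvalue is then no power 2^v with v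
   natural, so each of its weight components vanishes. *)
have nw : (u == w) = false by lia.
rewrite nw (cadd0 (clin_cadd cf)).
have -> : wp v (f x) = 0; last by [].
have ew := Sg_wp gQ v (f x).
have h1 : Sg (chW K) (wp v (f x)) = wp v (Sg (chW K) (f x)) by exact: Sg_kd.
have : qk K (2%:R ^+ m) *: Sg (chW K) (wp v (f x)) = qk K (2%:R ^+ (n + u)) *: wp v (f x).
  rewrite h1 -!(clinZ _ _ (wp_clin gQ v)) h e (clinZ _ _ cf) scalerA -rmorphM /= -exprD.
  by rewrite !(clinZ _ _ (wp_clin gQ v)).
rewrite ew scalerA -rmorphM /= -exprD => /eqP; rewrite -subr_eq0 -scalerBl -rmorphB /=.
set c : rat := _ - _ => /eqP e0.
have c0 : c != 0 by rewrite subr_eq0; apply/negP => /eqP /pow2_inj; lia.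
have := congr1 (fun z => qk K c^-1 *: z) e0.
by rewrite scalerA -rmorphM /= mulVf // rmorph1 scale1r scaler0.
Qed.

Lemma wp_commute P Q (f : el P -> el Q) : good P -> good Q -> continuous_linear f ->
  (forall x, Sg (chW K) (f x) = f (Sg (chW K) x)) -> forall w x, wp w (f x) = f (wp w x).
Proof.
move=> gP gQ cf h w x; apply: (@wp_shift _ _ _ 0 0) => // y.
by rewrite h.
Qed.

Section Bilinear.
Variables (P Q R : pmod K) (m : el P -> el Q -> el R).
Hypotheses (gP : good P) (gQ : good Q) (gR : good R).
Hypotheses (m1 : forall x, continuous_linear (m x))
  (m2 : forall y, continuous_linear (m^~ y))
  (mS : forall x y, Sg (chW K) (m x y) = m (Sg (chW K) x) (Sg (chW K) y)).

Lemma m_eig u v x y : Sg (chW K) x = qk K (2%:R ^+ u) *: x ->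
  Sg (chW K) y = qk K (2%:R ^+ v) *: y ->
  Sg (chW K) (m x y) = qk K (2%:R ^+ (u + v)) *: m x y.
Proof.
move=> ex ey; rewrite mS ex ey (clinZ _ _ (m2 _)) (clinZ _ _ (m1 _)) scalerA.
by rewrite exprD rmorphM.
Qed.

Lemma wp_bilin w x y : wp w (m x y) = \sum_(a < w.+1) m (wp a x) (wp (w - a)%N y).
Proof.
have c2 y' : cadd (fun x => \sum_(a < w.+1) m (wp a x) (wp (w - a)%N y')).
  elim: (index_enum _) => [|i r IH].
    rewrite (_ : (fun _ => _) = fun=> 0); first exact: cadd_cst0.
    by apply: funext => z; rewrite big_nil.
  rewrite (_ : (fun _ => _) = fun x => m (wp i x) (wp (w - i)%N y') +
     \sum_(a <- r) m (wp a x) (wp (w - a)%N y')); last by apply: funext => z; rewrite big_cons.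
  by apply: cadd_add IH; apply: clin_cadd; exact: (clin_comp (wp_clin gP i) (m2 _)).
have c1 x' : cadd (fun y => \sum_(a < w.+1) m (wp a x') (wp (w - a)%N y)).
  elim: (index_enum _) => [|i r IH].
    rewrite (_ : (fun _ => _) = fun=> 0); first exact: cadd_cst0.
    by apply: funext => z; rewrite big_nil.
  rewrite (_ : (fun _ => _) = fun y => m (wp i x') (wp (w - i)%N y) +
     \sum_(a <- r) m (wp a x') (wp (w - a)%N y)); last by apply: funext => z; rewrite big_cons.
  by apply: cadd_add IH; apply: clin_cadd; exact: (clin_comp (wp_clin gQ _) (m1 _)).
have w1 := clin_cadd (wp_clin gR w).
move: x; apply: (wt_dense gP).
- apply: (@eclosed_eq _ _ _ (fun x => wp w (m x y)) _ _ _ (c2 y)); first by case: gR.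
  by apply: clin_cadd; exact: (clin_comp (m2 y) (wp_clin gR w)).
- by rewrite (cadd0 (clin_cadd (m2 y))) (cadd0 w1) (cadd0 (c2 y)).
- move=> x x' e e'; rewrite (caddD (clin_cadd (m2 y))) (caddD w1) (caddD (c2 y)).
  by rewrite e e'.
move=> u x ex; move: y; apply: (wt_dense gQ).
- apply: (@eclosed_eq _ _ _ (fun y => wp w (m x y)) _ _ _ (c1 x)); first by case: gR.
  by apply: clin_cadd; exact: (clin_comp (m1 x) (wp_clin gR w)).
- by rewrite (cadd0 (clin_cadd (m1 x))) (cadd0 w1) (cadd0 (c1 x)).
- move=> y y' e e'; rewrite (caddD (clin_cadd (m1 x))) (caddD w1) (caddD (c1 x)).
  by rewrite e e'.
move=> v y ey; rewrite (wp_eig gR w (m_eig ex ey)).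
have e0 a : (a != u) -> m (wp a x) (wp (w - a)%N y) = 0.
  move=> au; rewrite (wp_eig gP a ex) eq_sym (negbTE au).
  exact: (cadd0 (clin_cadd (m2 _))).
have [uw|uw] := leqP u w; last first.
  have -> : (u + v == w)%N = false by lia.
  rewrite big1 // => a _; apply: e0; have := ltn_ord a; lia.
have uw' : (u < w.+1)%N by [].
rewrite (bigD1 (Ordinal uw')) //= big1 ?addr0; last by move=> a au; exact: e0.
rewrite (wp_eig gP u ex) eqxx (wp_eig gQ _ ey).
have -> : (v == w - u)%N = (u + v == w)%N by lia.
by case: eqP => // _; rewrite (cadd0 (clin_cadd (m1 x))).
Qed.

(** The binary logarithm on powers 2^w, which turns the eigenvalues of [Sg (chW K)] into weights;
    the default value elsewhere is 0. *)
Definition flog (q : rat) : rat := (xget 0%N [set w | q = 2%:R ^+ w])%:R.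

Lemma flogE w : flog (2%:R ^+ w) = w%:R.
Proof.
rewrite /flog; congr (_%:R); apply: (@xget_unique _ 0%N [set v | 2%:R ^+ w = 2%:R ^+ v :> rat]) => //.
by move=> v /pow2_inj.
Qed.

Definition wmul S (x : el S) : el S := kd (chW K) flog x.

Lemma wmul_eig S w (x : el S) : good S -> Sg (chW K) x = qk K (2%:R ^+ w) *: x ->
  wmul x = w%:R *: x.
Proof.
by move=> gS e; rewrite /wmul (kd_eig _ gS (@clW K) e) flogE rmorph_nat.
Qed.

Lemma wmul_clin S : good S -> continuous_linear (@wmul S).
Proof. by move=> gS; exact: kd_clin. Qed.

Lemma wmul_bilin x y : wmul (m x y) = m (wmul x) y + m x (wmul y).
Proof.
have w1 := clin_cadd (wmul_clin gR); have wP := clin_cadd (wmul_clin gP).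
have wQ := clin_cadd (wmul_clin gQ).
have c2 y' : cadd (fun x => m (wmul x) y' + m x (wmul y')).
  by apply: cadd_add; apply: clin_cadd; [exact: (clin_comp (wmul_clin gP) (m2 _)) | exact: m2].
have c1 x' : cadd (fun y => m (wmul x') y + m x' (wmul y)).
  by apply: cadd_add; apply: clin_cadd; [exact: m1 | exact: (clin_comp (wmul_clin gQ) (m1 _))].
move: x; apply: (wt_dense gP).
- apply: (@eclosed_eq _ _ _ (fun x => wmul (m x y)) _ _ _ (c2 y)); first by case: gR.
  by apply: clin_cadd; exact: (clin_comp (m2 y) (wmul_clin gR)).
- by rewrite (cadd0 (clin_cadd (m2 y))) (cadd0 w1) (cadd0 (c2 y)).
- move=> x x' e e'; rewrite (caddD (clin_cadd (m2 y))) (caddD w1) e e'.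
  by rewrite (caddD wP) !(caddD (clin_cadd (m2 _))) addrACA.
move=> u x ex; move: y; apply: (wt_dense gQ).
- apply: (@eclosed_eq _ _ _ (fun y => wmul (m x y)) _ _ _ (c1 x)); first by case: gR.
  by apply: clin_cadd; exact: (clin_comp (m1 x) (wmul_clin gR)).
- by rewrite (cadd0 (clin_cadd (m1 x))) (cadd0 w1) (cadd0 (c1 x)).
- move=> y y' e e'; rewrite (caddD (clin_cadd (m1 x))) (caddD w1) e e'.
  by rewrite (caddD wQ) !(caddD (clin_cadd (m1 _))) addrACA.
move=> v y ey; rewrite (wmul_eig gR (m_eig ex ey)) (wmul_eig gP ex) (wmul_eig gQ ey).
by rewrite (clinZ _ _ (m2 _)) (clinZ _ _ (m1 _)) -scalerDl natrD.
Qed.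

End Bilinear.

Lemma eig_none P chi q (x : el P) : good P -> clinear chi ->
  Sg chi x = qk K q *: x -> (forall b : pidx P, lam chi b != q) -> x = 0.
Proof.
move=> gP cl e h; have e1 := kd_eig (fun q' => (q' == q)%:R) gP cl e.
rewrite eqxx rmorph1 scale1r in e1; rewrite -e1.
have [r hr ->] := elP x; rewrite kd_cls // -[RHS]cls0; congr (cls P _).
by apply: funext => b; rewrite /kdiag (negbTE (h b)) rmorph0 mul0r.
Qed.

Lemma wp_wmul P w (x : el P) : good P -> wp w (wmul x) = w%:R *: wp w x.
Proof.
move=> gP; have -> : wp w (wmul x) = wmul (wp w x).
  by apply: (wp_commute gP gP (wmul_clin gP)) => z; exact: Sg_kd.
exact: (wmul_eig gP (Sg_wp gP w x)).
Qed.

Lemma natr_inj0 P n (x : el P) : (n.+1%:R : K) *: x = 0 -> x = 0.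
Proof.
move/(congr1 (fun z => qk K n.+1%:R^-1 *: z)).
rewrite scaler0 scalerA -[n.+1%:R : K](rmorph_nat (@qk K)) -rmorphM /= mulVf ?pnatr_eq0 //.
by rewrite rmorph1 scale1r.
Qed.

Lemma wmul_inj P (x : el P) : good P -> wp 0 x = 0 -> wmul x = 0 -> x = 0.
Proof.
move=> gP x0 wx; apply: (wp_inj gP) => -[|w] //.
by apply: (@natr_inj0 P w); rewrite -wp_wmul // wx (cadd0 (clin_cadd (wp_clin gP _))).
Qed.

(** Division by the weight; on weight 0 the convention 0^-1 = 0 applies, so it inverts [wmul] only
    on elements without part of weight 0. *)
Definition wdiv P (x : el P) : el P := kd (chW K) (fun q => (flog q)^-1) x.

Lemma wdivK P (x : el P) : good P -> wp 0 x = 0 -> wdiv (wmul x) = x.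
Proof.
move=> gP x0; apply/eqP; rewrite -subr_eq0; apply/eqP; apply: (wp_inj gP) => w.
have wc := clin_cadd (wp_clin gP w); rewrite (caddB wc).
have -> : wp w (wdiv (wmul x)) = wdiv (wmul (wp w x)).
  rewrite (wp_commute gP gP (kd_clin _ gP (@clW K))) => [|z]; last exact: Sg_kd.
  by rewrite (wp_commute gP gP (wmul_clin gP)) // => z; exact: Sg_kd.
case: w {wc} => [|w].
  by rewrite x0 (cadd0 (clin_cadd (wmul_clin gP))) /wdiv (cadd0 (clin_cadd (kd_clin _ gP (@clW K)))) subrr.
have e := Sg_wp gP w.+1 x; rewrite (wmul_eig gP e) /wdiv (clinZ _ _ (kd_clin _ gP (@clW K))).
rewrite (kd_eig _ gP (@clW K) e) flogE -[w.+1%:R : K](rmorph_nat (@qk K)) scalerA -rmorphM /=.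
by rewrite mulfV ?pnatr_eq0 // rmorph1 scale1r subrr.
Qed.

End WeightCalculus.

(** * Cartan calculus and the Poincare lemma *)

Section Cartan.
Variables (K : evenRing) (V : fgmod).
Notation W := (Wmod K V).
Notation G := (gLie K V).
Notation Om := (Omega K V).

Notation brO := (@gl_br K Om).
Notation DRm := (DRmod K V).
Notation gO := (good_Om K V).
Notation gG := (good_G K V).
Notation gDR := (good_DR K V).

Lemma lie_at_nil r : @pmem K G r -> r [::] = 0.
Proof.
pose f (x : series K (pidx G)) : series K (pidx G) := fun w => if w == [::] then x [::] else 0.
have hf : rfin f.
  by move=> w; apply: ffl_if; [exact: (@ffl_ev K (pidx G)) | exact: ffl_cst0].
have hB u v : u [::] = 0 -> @tmul K (pidx W) v u [::] = 0.
  by move=> u0; rewrite /tmul big_ord1 /= u0 mulr0.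
have key s : lie_monomial (@pmem K W) s -> s [::] = 0.
  elim=> [x hx|u v _ IHu _ IHv] //.
  rewrite /tcomm -[LHS]/(tmul u v [::] - gswap (@tmul K _) u v [::]) (hB _ _ IHv) sub0r.
  rewrite /gswap series_sumE big1 ?oppr0 // => p _; rewrite series_sumE big1 // => q _.
  rewrite -[LHS]/(_ * _) hB ?mulr0 // /ppart IHu; by case: ifP.
move=> hr; have h := hspan_eq hf (@rfin_cst0 K (pidx G) (pidx G)) (S := lie_monomial (@pmem K W)) _ hr.
have : f r [::] = 0.
  by rewrite h // => s hs; apply: funext => w; rewrite /f; case: eqP => // _; exact: key.
by rewrite /f eqxx.
Qed.

Lemma wp0_G (x : el G) : wp 0 x = 0.
Proof.
have [r hr ->] := elP x; rewrite /wp kd_cls //; last exact: gG.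
rewrite -[RHS](cls0 G); congr (cls G _); apply: funext => w; rewrite /kdiag lamW.
have [->|w0] := eqVneq w [::]; first by rewrite lie_at_nil // mulr0.
case: eqP => [/pow2_inj e|_]; last by rewrite rmorph0 mul0r.
move: e w0; rewrite /= sum1_size => /eqP; rewrite size_eq0 => /eqP -> /eqP //.
Qed.

Lemma SgW_inO (y : el G) : Sg (chW K) (inO y) = inO (Sg (chW K) y).
Proof. exact: Sg_inO. Qed.
Lemma SgW_one (y : el G) : Sg (chW K) (oneform y) = oneform (Sg (chW K) y).
Proof. by rewrite Sg_oneform /= mulr1 rmorph1 scale1r. Qed.

Lemma wp_inO w (y : el G) : wp w (inO y) = inO (wp w y).
Proof. exact: (wp_commute gG gO (@inO_clin K V) SgW_inO). Qed.
Lemma wp_one w (y : el G) : wp w (oneform y) = oneform (wp w y).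
Proof. exact: (wp_commute gG gO (@oneform_clin K V) SgW_one). Qed.

Lemma wp_br w x y : wp w (brO x y) = \sum_(a < w.+1) brO (wp a x) (wp (w - a)%N y).
Proof.
apply: (wp_bilin gO gO gO); [exact: br_clinr | exact: br_clinl | exact: Sg_br].
Qed.
Lemma wp_dp w (x y : el Om) :
  @wp K w DRm (drpair x y) = \sum_(a < w.+1) drpair (wp a x) (wp (w - a)%N y).
Proof.
apply: (@wp_bilin K Om Om DRm _ gO gO gDR); [exact: dp_clinr | exact: dp_clinl | exact: Sg_dp].
Qed.

Lemma wp0_Om (x : el Om) : wp 0 x = 0.
Proof.
apply: (Om_ind (A := [set x | wp 0 x = 0])).
- by apply: submod_eqs; [exact: (wp_clin gO) | exact: clin_cst0].
- apply: (@eclosed_eq _ _ _ (@wp K 0 Om) (fun=> 0)); first by case: gO.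
    exact: (clin_cadd (wp_clin gO _)).
  exact: cadd_cst0.
- by move=> y /=; rewrite wp_inO wp0_G (cadd0 (clin_cadd (@inO_clin K V))).
- by move=> y /=; rewrite wp_one wp0_G (cadd0 (clin_cadd (@oneform_clin K V))).
move=> a b /= ea eb; rewrite wp_br big_ord1 ea.
exact: (br0l (@br_clinl K V)).
Qed.

(** There are no constants: the Lie algebra starts in weight 1 and weights add up under brackets and
    pairings. Hence the Euler operator is injective, and the Poincare lemma holds without
    correction. *)
Lemma wp0_DR (z : el DRm) : wp 0 z = 0.
Proof.
apply: (DR_ind (A := [set z | wp 0 z = 0])).
- by apply: submod_eqs; [exact: (wp_clin gDR) | exact: clin_cst0].
- apply: (@eclosed_eq _ _ _ (@wp K 0 DRm) (fun=> 0)); first by case: gDR.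
    exact: (clin_cadd (wp_clin gDR _)).
  exact: cadd_cst0.
by move=> x y /=; rewrite wp_dp big_ord1 wp0_Om dp0l.
Qed.

Lemma wmul_degree (P : pmod K) : good P -> has_degree 0 (@wmul K P).
Proof.
move=> gP; apply/(degreeP _ gP gP (clin_cadd (wmul_clin gP))).
  by move=> q x; rewrite (clinZ _ _ (wmul_clin gP)).
by move=> x; rewrite expr0z rmorph1 scale1r; exact: Sg_kd.
Qed.

Lemma eul_der : vfield 0 (@wmul K G).
Proof.
apply: der_fullG; [exact: (wmul_clin gG) | exact: (wmul_degree gG) |].
move=> x y; rewrite (par0 _ gG).
by apply: (wmul_bilin gG gG gG); [exact: brG_clinr | exact: brG_clinl | exact: Sg_brG].
Qed.

Lemma eulO_der : is_derivation (L := Om) 0 (@wmul K Om).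
Proof.
apply: der_fullO; [exact: (wmul_clin gO) | exact: (wmul_degree gO) |].
move=> x y; rewrite (par0 _ gO).
by apply: (wmul_bilin gO gO gO); [exact: br_clinr | exact: br_clinl | exact: Sg_br].
Qed.

Lemma eulDR : dspec 0 (@wmul K Om) (@wmul K DRm).
Proof.
split; first exact: (wmul_clin gDR).
move=> x y; rewrite (par0 _ gO).
by apply: (@wmul_bilin K Om Om DRm _ gO gO gDR); [exact: dp_clinr | exact: dp_clinl | exact: Sg_dp].
Qed.

Lemma triv_Om : (forall x : el G, x = 0) -> forall x : el Om, x = 0.
Proof.
move=> h; apply: (Om_ind (A := [set x | x = 0])).
- by split=> // a x y -> ->; rewrite scaler0 addr0.
- move=> x hx; apply: haus; first by case: gO.
  by move=> F; have [y -> e] := hx F; rewrite subr0 in e.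
- by move=> y /=; rewrite (h y) (cadd0 (clin_cadd (@inO_clin K V))).
- by move=> y /=; rewrite (h y) (cadd0 (clin_cadd (@oneform_clin K V))).
by move=> x y /= -> ->; exact: (br0l (@br_clinl K V)).
Qed.

Lemma der0 (L : glie K) k : good L -> (forall y, continuous_linear (fun x => @gl_br K L x y)) ->
  (forall x, continuous_linear (@gl_br K L x)) -> is_derivation (L := L) k (fun=> 0).
Proof.
move=> gL b2 b1; split; first exact: clin_cst0.
  by move=> i x _; apply/(homogP _ _ gL); rewrite (cadd0 (Sg_cadd _ gL)) scaler0.
by move=> i x y _; rewrite (br0l b2) (br0r b1) scaler0 addr0.
Qed.

Lemma der0O k : is_derivation (L := Om) k (fun=> 0).
Proof. by apply: der0; [exact: gO | exact: br_clinl | exact: br_clinr]. Qed.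
Lemma der0G k : vfield k (fun _ : el G => 0).
Proof. by apply: der0; [exact: gG | exact: brG_clinl | exact: brG_clinr]. Qed.

Lemma dspec0 k : dspec k (fun _ : el Om => 0) (fun _ : el DRm => 0).
Proof. by split=> [|x y]; [exact: clin_cst0 | rewrite dp0l dp0r addr0]. Qed.

Lemma der_DR0 k : der_DR k (fun _ : el Om => 0) = (fun=> 0).
Proof. by apply: der_DR_eq; [exact: clin_cst0 | exact: dspec0]. Qed.

(** * Contraction, Lie derivative and primitives in the presence of a symplectic form *)

Section Symplectic.
Variables (N : int) (om : DR K V).
Hypothesis hom : symplectic_form N om.

Lemma om_inj k (xi eta : el G -> el G) : vfield k xi -> vfield k eta ->
  iDR k xi om = iDR k eta om -> xi = eta.
Proof.
have [_ _ /(_ k) [_ inj _]] := hom => h1 h2; apply: inj; exact: mem_set.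
Qed.

Lemma om_form k xi : vfield k xi -> is_form 1 (k + N) (iDR k xi om).
Proof. by have [_ _ /(_ k) [h _ _]] := hom => /h. Qed.

Lemma om_surj k b : is_form 1 (k + N) b -> exists2 xi, vfield k xi & iDR k xi om = b.
Proof. by have [_ _ /(_ k) [_ _ h]] := hom => /h [xi hx e]; exists xi. Qed.

(** If no differential existed, [dO] would be its default 0, and then no field xi with xi x nonzero
    could have a contraction, since i(d x) = i(0) = 0 must equal xi x. Both the Euler field and its
    double would contract [om] to 0, against the injectivity of Phi. *)
Lemma d_exists : d_ok K V.
Proof.
pose S := [set D | [/\ is_derivation (L := Om) 1 D,
    forall y, D (inO y) = oneform y & forall x, D (D x) = 0]].
have [[D SD]|nS] := pselect (exists D, S D).
  have h : S (@dO K V) by apply: (xgetPex (fun=> 0)); exists D.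
  case: h => h1 h2 h3; split; [exact: h1 | exact: h2 | exact: h3].
have d0 : @dO K V = fun=> 0.
  by apply: xgetPN => D SD; apply: nS; exists D.
have [tr|ntr] := pselect (forall x : el G, x = 0).
  have trO := triv_Om tr; case: nS; exists (fun=> 0); split=> //; first exact: der0O.
case: ntr => x.
have i0 xi : vfield 0 xi -> xi x != 0 -> iDR 0 xi om = 0.
  move=> hxi nx; have -> : iDR 0 xi = fun=> 0; last by [].
  rewrite /iDR; have -> : iO 0 xi = fun=> 0; last exact: der_DR0.
  apply: xgetPN => D [hD _ h]; move: (h x); rewrite d0 => e.
  have [cD _ _] := hD; rewrite (cadd0 (clin_cadd cD)) in e.
  move/eqP: nx; apply; apply: (@inO_inj K V); rewrite -e.
  by rewrite (cadd0 (clin_cadd (@inO_clin K V))).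
apply/eqP; apply: contraT => x0.
have ex0 : wmul x != 0.
  by apply: contraNneq x0 => e; rewrite (wmul_inj gG (wp0_G x) e).
have ex1 : wmul x + wmul x != 0.
  apply: contraNneq ex0 => e; apply/eqP; apply: (@natr_inj0 K G 1).
  by rewrite scaler_nat mulr2n.
(* The Euler field is compared with its double, not with 0: while [dO] is 0, the conditions defining
   the contraction with the zero field do not determine it on [oneform]. *)
have hE := eul_der.
have h2 : vfield 0 (fun y => wmul y + @wmul K G y).
  have [c1 c2 c3] := hE; have f3 := full_derG hE.
  apply: der_fullG; first exact: clin_add.
    by move=> i y hy; apply: homogD; [exact: gG | exact: c2 | exact: c2].
  move=> y z; rewrite f3 addrACA (brDl (@brG_clinl K V)) (brDr (@brG_clinr K V)) //.
have := om_inj hE h2; rewrite (i0 _ hE ex0) (i0 _ h2 ex1) => /(_ erefl).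
move/(congr1 (fun f => f x - wmul x)); rewrite subrr addrK => e.
by rewrite -e eqxx in ex0.
Qed.

Notation dok := d_exists.
Lemma dO_der : is_derivation (L := Om) 1 (@dO K V). Proof. by case: dok. Qed.
Lemma dO_in y : dO (@inO K V y) = oneform y. Proof. by case: dok. Qed.
Lemma dO_dO x : dO (@dO K V x) = 0. Proof. by case: dok. Qed.
Lemma dO_clin : continuous_linear (@dO K V). Proof. by case: dO_der. Qed.

Definition i_ok k xi := [/\ is_derivation (L := Om) (k - 1) (@iO K V k xi),
  forall x, iO k xi (inO x) = 0 & forall x, iO k xi (dO (inO x)) = inO (xi x)].

Lemma i_uniq k xi D : i_ok k xi -> is_derivation (L := Om) (k - 1) D ->
  (forall x, D (inO x) = 0) -> (forall x, D (oneform x) = inO (xi x)) ->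
  forall z, iO k xi z = D z.
Proof.
move=> [h1 h2 h3] hD e1 e2; apply: (der_uniqO h1 hD) => y; first by rewrite h2 e1.
by rewrite -dO_in h3 dO_in e2.
Qed.

Lemma i_set k xi : (exists D, [/\ is_derivation (L := Om) (k - 1) D,
    forall x, D (inO x) = 0 & forall x, D (dO (inO x)) = inO (xi x)]) -> i_ok k xi.
Proof. by move=> h; exact: (xgetPex (fun=> 0) h). Qed.

Lemma i0_ok k : i_ok k (fun=> 0) /\ @iO K V k (fun=> 0) = fun=> 0.
Proof.
have h0 : (inO (0 : el G)) = 0 by exact: (cadd0 (clin_cadd (@inO_clin K V))).
have h : i_ok k (fun=> 0) by apply: i_set; exists (fun=> 0); split=> //; exact: der0O.
split=> //; apply: funext => z; apply: (i_uniq h) => //; exact: der0O.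
Qed.

(** A missing contraction would have the default value 0, which is also the contraction with the
    zero field; injectivity of Phi then makes the field zero, and for it the contraction exists. *)
Lemma i_exists k xi : vfield k xi -> i_ok k xi.
Proof.
move=> hxi; have [h|h] := pselect (exists D, [/\ is_derivation (L := Om) (k - 1) D,
    forall x, D (inO x) = 0 & forall x, D (dO (inO x)) = inO (xi x)]); first exact: i_set.
have e0 : iO k xi = fun=> 0 by apply: xgetPN => D hD; apply: h; exists D.
have -> : xi = fun=> 0; last by case: (i0_ok k).
apply: (om_inj hxi (der0G k)); rewrite /iDR e0.
by case: (i0_ok k) => _ ->.
Qed.

(** The argument of [i_exists] is repeated for the passage from the algebra of forms to DR. *)
Lemma iD_ok k xi : vfield k xi -> dspec (k - 1) (iO k xi) (@iDR K V k xi).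
Proof.
move=> hxi; have [hi _ _] := i_exists hxi; have [ci _ _] := hi.
have [[E hE]|h] := pselect (exists E, dspec (k - 1) (iO k xi) E).
  by rewrite /iDR (der_DR_eq ci hE).
have e0 : iDR k xi = fun=> 0.
  by apply: xgetPN => E hE; apply: h; exists E; apply/(dspecP _ _ ci).
have ex : xi = fun=> 0.
  apply: (om_inj hxi (der0G k)); rewrite e0 /iDR.
  by case: (i0_ok k) => _ ->; rewrite der_DR0.
case: h; exists (fun=> 0); rewrite ex; case: (i0_ok k) => _ ->; exact: dspec0.
Qed.

Lemma iDR_clin k xi : vfield k xi -> @continuous_linear K DRm DRm (iDR k xi).
Proof. by move=> /iD_ok []. Qed.

Lemma dDR_spec : dspec 1 (@dO K V) (@dDR K V). Proof. exact: dDR_ok dok. Qed.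
Lemma dDR_clin : @continuous_linear K DRm DRm (@dDR K V). Proof. by case: dDR_spec. Qed.

Lemma LO_spec k xi : vfield k xi -> is_derivation (L := Om) k (@LO K V k xi) /\
  LO k xi = fun x => iO k xi (dO x) - ksign K (k - 1) *: dO (iO k xi x).
Proof.
move=> hxi; have [h1 h2 h3] := i_exists hxi; have cd := clin_cadd dO_clin.
have ci := clin_cadd (let: And3 c _ _ := h1 in c).
pose C x := iO k xi (dO x) - ksign K (k - 1) *: dO (iO k xi x).
have hC : is_derivation (L := Om) k C.
  have := der_commO h1 dO_der; rewrite mulr1 subrK; exact.
have ks : ksign K (k - 1) = - ksign K k.
  by rewrite ksignM /ksign /= expr1 mulrN1.
have Ci x : C (inO x) = inO (xi x).
  by rewrite /C h3 h2 (cadd0 cd) scaler0 subr0.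
have Cd x : C (dO (inO x)) = ksign K k *: dO (inO (xi x)).
  by rewrite /C dO_dO (cadd0 ci) h3 sub0r ks scaleNr opprK.
have hL : [/\ is_derivation (L := Om) k (LO k xi),
    forall x, LO k xi (inO x) = inO (xi x) &
    forall x, LO k xi (dO (inO x)) = ksign K k *: dO (inO (xi x))].
  have hex : exists D : el Om -> el Om, [/\ is_derivation (L := Om) k D,
    forall x, D (inO x) = inO (xi x) &
    forall x, D (dO (inO x)) = ksign K k *: dO (inO (xi x))] by exists C; split.
  exact: (xgetPex (fun=> 0) hex).
have [l1 l2 l3] := hL; split=> //; apply: funext; apply: (der_uniqO l1 hC) => y.
  by rewrite l2 Ci.
by rewrite -dO_in l3 Cd.
Qed.

Lemma LDR_spec k xi : vfield k xi -> dspec k (LO k xi) (@LDR K V k xi) /\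
  forall z : el DRm, LDR k xi z = iDR k xi (dDR z) - ksign K (k - 1) *: dDR (iDR k xi z).
Proof.
move=> hxi; have [h1 h2] := LO_spec hxi; have [c1 _ _] := h1.
have [i1 _ _] := i_exists hxi.
have hc : dspec k (LO k xi) (fun z => iDR k xi (dDR z) - ksign K (k - 1) *: dDR (iDR k xi z)).
  have := dspec_comm i1 dO_der (iD_ok hxi) dDR_spec.
  by rewrite mulr1 subrK h2.
have e : LDR k xi = _ := der_DR_eq c1 hc.
by split=> [|z]; rewrite e.
Qed.

Lemma dom : dDR om = 0. Proof. by case: hom. Qed.

Lemma L_om k xi : vfield k xi -> LDR k xi om = - (ksign K (k - 1) *: dDR (iDR k xi om)).
Proof.
move=> hxi; have [_ ->] := LDR_spec hxi; rewrite dom.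
by rewrite (cadd0 (clin_cadd (iDR_clin hxi))) sub0r.
Qed.

Lemma L_om0 k xi : vfield k xi -> (LDR k xi om = 0 <-> dDR (iDR k xi om) = 0).
Proof.
move=> hxi; rewrite L_om //; split=> [/eqP|->]; last by rewrite scaler0 oppr0.
rewrite oppr_eq0 => /eqP /(congr1 (fun z => ksign K (k - 1) *: z)).
by rewrite scaler0 scalerA ksignMK scale1r.
Qed.

Lemma L_clin k xi : vfield k xi -> @continuous_linear K DRm DRm (LDR k xi).
Proof. by move=> hxi; have [[]] := LDR_spec hxi. Qed.

Lemma d_L k xi (z : el DRm) : vfield k xi -> LDR k xi (dDR z) = ksign K k *: dDR (LDR k xi z).
Proof.
move=> hxi; have [_ e] := LDR_spec hxi.
have e1 : dDR (LDR k xi z) = dDR (iDR k xi (dDR z)).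
  rewrite (e z) (caddB (clin_cadd dDR_clin)) [X in _ - X](_ : _ = 0) ?subr0 //.
  rewrite (clinZ (ksign K (k - 1)) (dDR (iDR k xi z)) dDR_clin) (dDR_dDR dok).
  exact: scaler0.
rewrite e1 (e (dDR z)) (dDR_dDR dok) (cadd0 (clin_cadd (iDR_clin hxi))) sub0r.
have -> : ksign K (k - 1) = - ksign K k by rewrite ksignM /ksign expr1 mulrN1.
by rewrite scaleNr opprK.
Qed.

(** The commutator of a Lie derivative with a contraction is a derivation that kills functions and
    sends each dy to the value of the bracket of the fields at y, so it is the contraction with that
    bracket. *)
Lemma i_comm k l xi eta : vfield k xi -> vfield l eta ->
  vfield (k + l) (vcomm k l xi eta) /\
  forall z : el DRm, iDR (k + l) (vcomm k l xi eta) z =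
     LDR k xi (iDR l eta z) - ksign K (k * (l - 1)) *: iDR l eta (LDR k xi z).
Proof.
move=> hx he; have hv : vfield (k + l) (vcomm k l xi eta).
  have -> : vcomm k l xi eta = (fun x => xi (eta x) - ksign K (k * l) *: eta (xi x)) by [].
  exact: (der_commG hx he).
split=> // z; have [Lx eL] := LO_spec hx; have [Ld _] := LDR_spec hx.
have [i1 i2 i3] := i_exists he; have [j1 j2 j3] := i_exists hv.
have [x1 x2 x3] := i_exists hx.
have hc := der_commO Lx i1; rewrite addrA in hc.
have hcd := dspec_comm Lx i1 Ld (iD_ok he); rewrite addrA in hcd.
have cL := clin_cadd (let: And3 c _ _ := Lx in c).
have ci := clin_cadd (let: And3 c _ _ := i1 in c).
have cx := clin_cadd (let: And3 c _ _ := x1 in c).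
have cd := clin_cadd dO_clin.
have Li y : LO k xi (inO y) = inO (xi y).
  by rewrite eL x3 x2 (cadd0 cd) scaler0 subr0.
have Lo y : LO k xi (oneform y) = ksign K k *: oneform (xi y).
  rewrite eL -dO_in dO_dO (cadd0 cx) x3 sub0r dO_in.
  by rewrite ksignM /ksign /= expr1 mulrN1 scaleNr opprK.
have e : iO (k + l) (vcomm k l xi eta) =
    fun x => LO k xi (iO l eta x) - ksign K (k * (l - 1)) *: iO l eta (LO k xi x).
  apply: funext => x; apply: (der_uniqO j1 hc) => y.
    by rewrite j2 i2 Li i2 (cadd0 cL) scaler0 subrr.
  rewrite -dO_in j3 i3 Li dO_in Lo.
  rewrite (clinZ _ _ (let: And3 c _ _ := i1 in c)) -dO_in i3 scalerA -ksignM.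
  rewrite [X in ksign K X](_ : _ = k * l); last by ring.
  rewrite /vcomm -[(xi \o eta - _) y]/(xi (eta y) - ksign K (k * l) *: eta (xi y)).
  have cI := @inO_clin K V.
  by rewrite (caddB (clin_cadd cI)) (clinZ _ _ cI).
rewrite -e in hcd.
exact: (congr1 (fun f => f z) (dspec_uniq (iD_ok hv) hcd)).
Qed.

Lemma is_formP i k (a : el DRm) : is_form i k a <->
  (Sg (chF K) a = qk K (2%:R ^+ i) *: a /\ Sg (chD K) a = qk K (2%:R ^ (k + i%:Z)) *: a).
Proof.
rewrite /is_form; split=> -[h1 h2]; split.
- by apply/(supp_fd1 gDR).
- by apply/(homogP _ _ gDR).
- by apply/(supp_fd1 gDR).
- by apply/(homogP _ _ gDR).
Qed.

Lemma form_orderP i o (a : el DRm) : form_order i o a <->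
  Sg (chW K) a = qk K (2%:R ^+ (o + i)) *: a.
Proof. exact: (supp_wt1 gDR). Qed.

Lemma SgF_G (y : el G) : Sg (chF K) y = y.
Proof.
have [r hr ->] := elP y; rewrite Sg_cls //; last exact: gG.
congr (cls G _); apply: funext => w; rewrite /sig lamF /= big1 //.
by rewrite expr0 rmorph1 mul1r.
Qed.

Lemma i_sig chi c k xi : vfield k xi ->
  (forall y, Sg chi (xi y) = qk K c *: xi (Sg chi y)) ->
  forall z : el DRm, Sg chi (iDR k xi z) = qk K (c / (cfd chi * cdg chi)) *: iDR k xi (Sg chi z).
Proof.
move=> hxi hc; apply: (dspec_sig (iD_ok hxi)).
have [i1 i2 i3] := i_exists hxi; have [ci _ _] := i1.
have [n1 n2 n3] := cnz chi.
apply: (der_sigO i1) => y.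
  by rewrite i2 (cadd0 (Sg_cadd _ gO)) Sg_inO i2 scaler0.
rewrite -dO_in i3 Sg_inO hc dO_in Sg_oneform (clinZ _ _ ci) -dO_in i3.
rewrite (clinZ _ _ (@inO_clin K V)) scalerA -rmorphM /= divfK //.
by rewrite mulf_neq0.
Qed.

Lemma i_sigF k xi (z : el DRm) : vfield k xi ->
  Sg (chF K) (iDR k xi z) = qk K 2%:R^-1 *: iDR k xi (Sg (chF K) z).
Proof.
move=> hxi; rewrite (@i_sig (chF K) 1) //= ?mulr1 ?mul1r // => y.
by rewrite !SgF_G rmorph1 scale1r.
Qed.

Lemma i_degree k xi : vfield k xi -> @has_degree K DRm DRm (k - 1) (iDR k xi).
Proof. by move=> hxi; have [i1 _ _] := i_exists hxi; exact: dspec_degree (iD_ok hxi). Qed.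

Lemma i_form i k l xi (a : el DRm) : vfield k xi -> is_form i.+1 l a ->
  is_form i (k + l) (iDR k xi a).
Proof.
move=> hxi [hs hh]; split.
  apply/(supp_fd1 gDR); move/(supp_fd1 gDR): hs => e.
  rewrite i_sigF // e (clinZ _ _ (iDR_clin hxi)) scalerA -rmorphM /=.
  by rewrite exprS mulKf.
have := i_degree hxi hh; congr homog; lia.
Qed.

Lemma d_form i k (a : el DRm) : is_form i k a -> is_form i.+1 k (dDR a).
Proof.
move=> /is_formP [h1 h2]; apply/is_formP; split; rewrite (dDR_sig dok) ?h1 ?h2 /=.
  by rewrite (clinZ _ _ dDR_clin) scalerA -rmorphM /= mulr1 exprS.
rewrite (clinZ _ _ dDR_clin) scalerA -rmorphM /= mul1r.
have -> : k + i.+1%:Z = 1 + (k + i%:Z) by lia.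
by rewrite [_ ^ (1 + _)]expfzDr // expr1z.
Qed.

(** The contraction would have form degree -1, that is, eigenvalue 1/2 under [chF], which no basis
    element has. *)
Lemma i_zero k l xi (a : el DRm) : vfield k xi -> is_form 0 l a -> iDR k xi a = 0.
Proof.
move=> hxi /is_formP [hF _]; apply: (@eig_none K DRm (chF K) 2%:R^-1 _ gDR) => //.
  by rewrite (i_sigF a hxi) hF expr0 rmorph1 scale1r.
move=> b; rewrite lamF; apply/eqP => e.
have h : (1 : rat) <= 2%:R ^+ gfd b by rewrite exprn_ege1.
by rewrite e in h.
Qed.

Lemma L_zero k l xi (a : el DRm) : vfield k xi -> is_form 0 l a ->
  LDR k xi a = iDR k xi (dDR a).
Proof.
move=> hxi ha; have [_ ->] := LDR_spec hxi; rewrite (i_zero hxi ha).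
by rewrite (cadd0 (clin_cadd dDR_clin)) scaler0 subr0.
Qed.

Lemma L_form0 k l xi (a : el DRm) : vfield k xi -> is_form 0 l a ->
  is_form 0 (k + l) (LDR k xi a).
Proof. by move=> hxi ha; rewrite (L_zero hxi ha); apply/(i_form hxi)/d_form. Qed.

(** The Euler operators of the Lie algebra, of the algebra of forms and of DR are compatible, so the
    one on DR is the Lie derivative along the Euler field and obeys the Cartan formula. *)
Lemma eul_L z : LDR 0 (@wmul K G) z = wmul (z : el DRm).
Proof.
have [h1 h2] := LDR_spec eul_der; have [l1 l2] := LO_spec eul_der.
have e : LO 0 (@wmul K G) = @wmul K Om.
  apply: funext; have [x1 x2 x3] := i_exists eul_der.
  have cx := clin_cadd (let: And3 c _ _ := x1 in c); have cd := clin_cadd dO_clin.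
  apply: (der_uniqO l1 eulO_der) => y.
    rewrite l2 x3 x2 (cadd0 cd) scaler0 subr0 /wmul.
    exact: (kd_commute _ gG gO (@inO_clin K V) SgW_inO).
  rewrite l2 -dO_in dO_dO (cadd0 cx) x3 sub0r !dO_in.
  have -> : ksign K (0 - 1) = -1 by rewrite /ksign expr1.
  rewrite scaleN1r opprK.
  exact: (kd_commute _ gG gO (@oneform_clin K V) SgW_one).
by rewrite e in h1; rewrite (dspec_uniq h1 eulDR).
Qed.

Lemma eul_cartan (z : el DRm) :
  wmul z = iDR 0 (@wmul K G) (dDR z) + dDR (iDR 0 (@wmul K G) z).
Proof.
rewrite -eul_L; have [_ ->] := LDR_spec eul_der.
by rewrite /ksign /= expr1 scaleN1r opprK.
Qed.

Lemma d_inj k (a : el DRm) : is_form 0 k a -> dDR a = 0 -> a = 0.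
Proof.
move=> ha da; apply: (wmul_inj gDR (wp0_DR a)).
rewrite eul_cartan da (cadd0 (clin_cadd (iDR_clin eul_der))) add0r.
by rewrite (i_zero eul_der ha) (cadd0 (clin_cadd dDR_clin)).
Qed.

(** By the Cartan formula d(i_E b) is the weight times b; the primitive is i_E b divided by the
    weight, which is legitimate because weight 0 is absent. *)
Lemma poincare k (b : el DRm) : is_form 1 k b -> dDR b = 0 ->
  exists2 a : el DRm, is_form 0 k a & dDR a = b.
Proof.
move=> hb db; have ci := iDR_clin eul_der.
have hE : wmul b = dDR (iDR 0 (@wmul K G) b).
  by rewrite eul_cartan db (cadd0 (clin_cadd ci)) add0r.
exists (wdiv (iDR 0 (@wmul K G) b)); last first.
  rewrite /wdiv (kd_commute _ gDR gDR dDR_clin) => [|x].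
    by rewrite -hE; exact: (wdivK gDR (wp0_DR b)).
  by rewrite (dDR_sig dok) /= mulr1 rmorph1 scale1r.
have /is_formP [h1 h2] := i_form eul_der hb; rewrite add0r in h2.
have ck := kd_clin (fun q => (flog q)^-1) gDR (@clW K).
apply/is_formP; rewrite /wdiv; split; rewrite (Sg_kd _ gDR (@clW K)).
  by rewrite h1; exact: (clinZ _ _ ck).
by rewrite h2; exact: (clinZ _ _ ck).
Qed.

End Symplectic.
End Cartan.

(** * Order of vector fields *)

Section Filtration.
Variable K : evenRing.
Implicit Types (P Q R : pmod K).

Definition filt v P (x : el P) := forall u, (u < v)%N -> wp u x = 0.

(* In the terminology of the paper [f] has order at least p + 1. *)
Definition raises p P Q (f : el P -> el Q) :=
  forall w x, Sg (chW K) x = qk K (2%:R ^+ w) *: x -> filt (w + p) (f x).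

Lemma wp_raise P Q (f : el P -> el Q) u x : good P -> good Q -> continuous_linear f ->
  raises 0 f -> wp u (f x) = \sum_(w < u.+1) wp u (f (wp w x)).
Proof.
move=> gP gQ cf hf; have cs : cadd (fun x => \sum_(w < u.+1) wp u (f (wp w x))).
  elim: (index_enum _) => [|i r IH].
    rewrite (_ : (fun _ => _) = fun=> 0); first exact: cadd_cst0.
    by apply: funext => z; rewrite big_nil.
  rewrite (_ : (fun _ => _) = fun x => wp u (f (wp i x)) +
     \sum_(w <- r) wp u (f (wp w x))); last by apply: funext => z; rewrite big_cons.
  apply: cadd_add IH; apply: clin_cadd.
  exact: (clin_comp (clin_comp (wp_clin gP i) cf) (wp_clin gQ u)).
have cl : cadd (fun x => wp u (f x)).
  by apply: clin_cadd; exact: (clin_comp cf (wp_clin gQ u)).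
move: x; apply: (wt_dense gP).
- by apply: (@eclosed_eq _ _ _ (fun x => wp u (f x)) _ _ cl cs); case: gQ.
- by rewrite (cadd0 cl) (cadd0 cs).
- by move=> x y ex ey; rewrite (caddD cl) (caddD cs) ex ey.
move=> v x ex; have e0 (w : 'I_u.+1) : (w : nat) != v -> wp u (f (wp w x)) = 0.
  move=> nw; rewrite (wp_eig gP w ex) eq_sym (negbTE nw) (cadd0 (clin_cadd cf)).
  exact: (cadd0 (clin_cadd (wp_clin gQ u))).
have [vu|uv] := leqP v u; last first.
  rewrite (hf _ _ ex) ?addn0 // big1 // => w _; apply: e0; have := ltn_ord w; lia.
have vu' : (v < u.+1)%N by [].
rewrite (bigD1 (Ordinal vu')) //= big1 ?addr0; last by move=> w nw; exact: e0.
by rewrite (wp_eig gP v ex) eqxx.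
Qed.

Lemma filtS v v' P (x : el P) : (v <= v')%N -> filt v' x -> filt v x.
Proof. by move=> h hx u hu; apply: hx; exact: leq_trans hu h. Qed.

Lemma filt0 P (x : el P) : filt 0 x. Proof. by []. Qed.

Lemma filt_hom w P (x : el P) : good P -> Sg (chW K) x = qk K (2%:R ^+ w) *: x -> filt w x.
Proof. by move=> gP e u uw; rewrite (wp_eig gP u e); case: eqP => // h; lia. Qed.

Section FiltMod.
Variables (v : nat) (P : pmod K).
Hypothesis gP : good P.
Implicit Types x y : el P.
Let wl u := wp_clin gP u.
Lemma filtD x y : filt v x -> filt v y -> filt v (x + y).
Proof. by move=> hx hy u uv; rewrite (caddD (clin_cadd (wl u))) hx // hy // addr0. Qed.
Lemma filtB x y : filt v x -> filt v y -> filt v (x - y).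
Proof. by move=> hx hy u uv; rewrite (caddB (clin_cadd (wl u))) hx // hy // subr0. Qed.
Lemma filtZ a x : filt v x -> filt v (a *: x).
Proof. by move=> hx u uv; rewrite (clinZ _ _ (wl u)) hx // scaler0. Qed.
Lemma filt_0 : filt v (0 : el P).
Proof. by move=> u _; exact: (cadd0 (clin_cadd (wl u))). Qed.
Lemma filt_sum (I : Type) (r : seq I) (p : pred I) F :
  (forall i, p i -> filt v (F i : el P)) -> filt v (\sum_(i <- r | p i) F i).
Proof. by move=> h; elim/big_ind: _ => //; [exact: filt_0 | exact: filtD]. Qed.
End FiltMod.

Lemma raisesS p p' P Q (f : el P -> el Q) : (p <= p')%N -> raises p' f -> raises p f.
Proof. by move=> h hf w x e; apply: (filtS _ (hf _ _ e)); rewrite leq_add2l. Qed.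

(** An element of the filtration is an infinite sum of weight components; [wp_raise] shows that only
    finitely many of them reach a given weight of the image. *)
Lemma raises_filt p v P Q (f : el P -> el Q) x : good P -> good Q -> continuous_linear f ->
  raises p f -> filt v x -> filt (v + p) (f x).
Proof.
move=> gP gQ cf hf hx u uv; rewrite (wp_raise u x gP gQ cf (raisesS (leq0n p) hf)).
rewrite big1 // => w _; have [wv|wv] := ltnP w v.
  by rewrite hx // (cadd0 (clin_cadd cf)) (cadd0 (clin_cadd (wp_clin gQ _))).
by apply: (hf _ _ (Sg_wp gP w x)); lia.
Qed.

Lemma wt_ext P Q (f h : el P -> el Q) : good P -> good Q ->
  continuous_linear f -> continuous_linear h ->
  (forall w x, Sg (chW K) x = qk K (2%:R ^+ w) *: x -> f x = h x) -> forall x, f x = h x.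
Proof.
move=> gP gQ cf ch e; apply: (wt_dense gP) => //.
- by apply: eclosed_eq; [case: gQ | exact: clin_cadd | exact: clin_cadd].
- by rewrite (cadd0 (clin_cadd cf)) (cadd0 (clin_cadd ch)).
- by move=> x y ex ey; rewrite (caddD (clin_cadd cf)) (caddD (clin_cadd ch)) ex ey.
Qed.

End Filtration.

(** * Order and additivity of fields and of their contractions *)

Section VectorFields.
Variables (K : evenRing) (V : fgmod).
Notation G := (gLie K V).
Notation Om := (Omega K V).

Notation DRm := (DRmod K V).
Notation gO := (good_Om K V).
Notation gG := (good_G K V).
Notation gDR := (good_DR K V).

Implicit Types (xi eta f h : el G -> el G) (x y : el G) (z : el DRm).

Lemma el_orderP i x : el_order i x <-> Sg (chW K) x = qk K (2%:R ^+ i) *: x.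
Proof. exact: (supp_wt1 gG). Qed.

Lemma order_geP n f : order_ge n.+1 f <-> continuous_linear f /\ raises n f.
Proof.
split=> -[c h]; split=> //.
  move=> w x /el_orderP hx u uw; have := h w x hx.
  move/(supp_wtP gG (fun b => w + n.+1 <= b + 1)%N); apply; lia.
move=> i x /el_orderP hx; apply/(supp_wtP gG (fun b => i + n.+1 <= b + 1)%N) => w nw.
by apply: (h _ _ hx); lia.
Qed.

(* Order n + 1 in the terminology of the paper. *)
Definition shifts n f := forall w x, Sg (chW K) x = qk K (2%:R ^+ w) *: x ->
  Sg (chW K) (f x) = qk K (2%:R ^+ (w + n)) *: f x.

Lemma has_orderP n f : has_order n.+1 f <-> shifts n f.
Proof.
split=> h.
  by move=> w x /el_orderP hx; apply/el_orderP; apply: (h w) hx; lia.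
move=> i j x e /el_orderP hx; apply/el_orderP.
have -> : j = (i + n)%N by lia.
exact: h.
Qed.

Lemma shifts_raises n f : shifts n f -> raises n f.
Proof. by move=> h w x e; exact: (filt_hom gG (h _ _ e)). Qed.

Lemma shifts_comp n p f h : shifts n f -> shifts p h -> shifts (n + p) (h \o f).
Proof. by move=> hf hh w x e; rewrite addnA; apply: hh; exact: hf. Qed.

Lemma shifts_wp n f w x : continuous_linear f -> shifts n f -> wp (w + n) (f x) = f (wp w x).
Proof.
move=> cf hf; apply: (wp_shift (n := n) (m := 0) gG gG cf) => [y|]; last by rewrite addn0.
rewrite expr0 rmorph1 scale1r; move: y; apply: (wt_ext gG gG).
- exact: (clin_comp cf (Sg_clin gG (@clW K))).
- by apply: clin_scale; exact: (clin_comp (Sg_clin gG (@clW K)) cf).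
move=> v y e; rewrite (hf _ _ e) e (clinZ _ _ cf) scalerA -rmorphM /=.
by rewrite exprD mulrC.
Qed.

Lemma shiftsD n f h : shifts n f -> shifts n h -> shifts n (fun x => f x + h x).
Proof.
by move=> hf hh w x e; rewrite (caddD (Sg_cadd _ gG)) (hf _ _ e) (hh _ _ e) scalerDr.
Qed.

Lemma shifts0 n : shifts n (fun=> 0).
Proof. by move=> w x _; rewrite (cadd0 (Sg_cadd _ gG)) scaler0. Qed.

Lemma shifts_sum n (I : Type) (r : seq I) (p : pred I) (F : I -> el G -> el G) :
  (forall i, p i -> shifts n (F i)) -> shifts n (\sum_(i <- r | p i) F i).
Proof.
by move=> h; elim/big_ind: _ => // [|f g hf hg]; [exact: shifts0 | exact: shiftsD].
Qed.

Lemma vfieldD k xi eta : vfield k xi -> vfield k eta -> vfield k (fun x => xi x + eta x).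
Proof.
move=> h1 h2; have f1 := full_derG h1; have f2 := full_derG h2.
have [c1 d1 _] := h1; have [c2 d2 _] := h2; apply: der_fullG; first exact: clin_add.
  by move=> i x hx; apply: homogD; [exact: gG | exact: d1 | exact: d2].
move=> x y; rewrite f1 f2 addrACA; congr (_ + _).
  by rewrite (brDl (@brG_clinl K V)).
by rewrite (brDr (@brG_clinr K V)).
Qed.

Lemma homogZq k q x : homog k x -> homog k (qk K q *: x).
Proof.
move=> /(homogP _ _ gG) hx; apply/(homogP _ _ gG).
by rewrite (SgZq _ gG) hx !scalerA mulrC.
Qed.

Lemma vfieldZ k q xi : vfield k xi -> vfield k (fun x => qk K q *: xi x).
Proof.
move=> h1; have f1 := full_derG h1.
have [c1 d1 _] := h1; apply: der_fullG; first exact: clin_scale.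
  by move=> i x hx; apply: homogZq; exact: d1.
move=> x y; rewrite f1 scalerDr (brZl (@brG_clinl K V)).
by rewrite (brZr (@brG_clinr K V)).
Qed.

Lemma vfield_sum k (I : Type) (r : seq I) (p : pred I) (F : I -> el G -> el G) :
  (forall i, p i -> vfield k (F i)) -> vfield k (\sum_(i <- r | p i) F i).
Proof.
by move=> h; elim/big_ind: _ => // [|f g hf hg]; [exact: der0G | exact: vfieldD].
Qed.

Lemma vcomm11 xi eta : vcomm 1 1 xi eta = fun x => xi (eta x) + eta (xi x).
Proof.
apply: funext => x; rewrite /vcomm -[LHS]/(xi (eta x) - ksign K (1 * 1) *: eta (xi x)).
by rewrite mulr1 /ksign expr1 scaleN1r opprK.
Qed.

Lemma half2 x : qk K 2%:R^-1 *: (x + x) = x.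
Proof.
have -> : x + x = qk K 2%:R *: x by rewrite rmorph_nat scaler_nat mulr2n.
by rewrite scalerA -rmorphM /= mulVf // rmorph1 scale1r.
Qed.

Section Symplectic.
Variables (N : int) (om : DR K V).
Hypothesis hom : symplectic_form N om.

Lemma i_add k xi eta z : vfield k xi -> vfield k eta ->
  iDR k (fun x => xi x + eta x) z = iDR k xi z + iDR k eta z.
Proof.
move=> h1 h2; have h3 := vfieldD h1 h2.
have [a1 a2 a3] := i_exists hom h1; have [b1 b2 b3] := i_exists hom h2.
have [c1 c2 c3] := i_exists hom h3.
have [ca da _] := a1; have [cb db _] := b1.
have fa := full_derO a1; have fb := full_derO b1.
have hD : is_derivation (L := Om) (k - 1) (fun t => iO k xi t + iO k eta t).
  apply: der_fullO; first exact: clin_add.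
    by move=> i x hx; apply: homogD; [exact: gO | exact: da | exact: db].
  move=> x y; rewrite fa fb addrACA; congr (_ + _).
    by rewrite (brDl (@br_clinl K V)).
  by rewrite (brDr (@br_clinr K V)).
have e : iO k (fun x => xi x + eta x) = fun t => iO k xi t + iO k eta t.
  apply: funext; apply: (der_uniqO c1 hD) => y; first by rewrite c2 a2 b2 addr0.
  rewrite -(dO_in hom) c3 a3 b3; exact: (caddD (clin_cadd (@inO_clin K V))).
have [ea ha] := iD_ok hom h1; have [eb hb] := iD_ok hom h2.
have hs : dspec (k - 1) (iO k (fun x => xi x + eta x)) (fun z => iDR k xi z + iDR k eta z).
  split=> [|x y]; first exact: clin_add.
  by rewrite ha hb e dpDl dpDr addrACA.
by rewrite (dspec_uniq (iD_ok hom h3) hs).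
Qed.

Lemma i_scale k q xi z : vfield k xi ->
  iDR k (fun x => qk K q *: xi x) z = qk K q *: iDR k xi z.
Proof.
move=> h1; have h3 := vfieldZ q h1.
have [a1 a2 a3] := i_exists hom h1; have [c1 c2 c3] := i_exists hom h3.
have [ca da _] := a1; have fa := full_derO a1.
have hD : is_derivation (L := Om) (k - 1) (fun t => qk K q *: iO k xi t).
  apply: der_fullO; first exact: clin_scale.
    move=> i x hx; apply/(homogP _ _ gO); rewrite (SgZq _ gO).
    by move/(homogP _ _ gO): (da _ _ hx) => ->; rewrite !scalerA mulrC.
  move=> x y; rewrite fa scalerDr (brZl (@br_clinl K V)).
  by rewrite (brZr (@br_clinr K V)).
have e : iO k (fun x => qk K q *: xi x) = fun t => qk K q *: iO k xi t.
  apply: funext; apply: (der_uniqO c1 hD) => y; first by rewrite c2 a2 scaler0.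
  rewrite -(dO_in hom) c3 a3; exact: (clinZ _ _ (@inO_clin K V)).
have [ea ha] := iD_ok hom h1.
have hs : dspec (k - 1) (iO k (fun x => qk K q *: xi x)) (fun z => qk K q *: iDR k xi z).
  split=> [|x y]; first exact: clin_scale.
  by rewrite ha e dpZl dpZr scalerDr.
by rewrite (dspec_uniq (iD_ok hom h3) hs).
Qed.

Lemma i_sub k xi eta z : vfield k xi -> vfield k eta ->
  vfield k (fun x => xi x - eta x) /\
  iDR k (fun x => xi x - eta x) z = iDR k xi z - iDR k eta z.
Proof.
move=> h1 h2; have h3 := vfieldZ (-1) h2.
have e : (fun x => xi x - eta x) = fun x => xi x + qk K (-1) *: eta x.
  by apply: funext => x; rewrite rmorphN1 scaleN1r.
rewrite e; split; first exact: vfieldD.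
by rewrite i_add // i_scale // rmorphN1 scaleN1r.
Qed.

Lemma i_sum k (I : Type) (r : seq I) (p : pred I) (F : I -> el G -> el G) z :
  (forall i, p i -> vfield k (F i)) ->
  iDR k (\sum_(i <- r | p i) F i) z = \sum_(i <- r | p i) iDR k (F i) z.
Proof.
move=> h; elim: r => [|i r IH].
  by rewrite !big_nil /iDR; case: (i0_ok hom k) => _ ->; rewrite der_DR0.
rewrite !big_cons; case: ifP => // pi.
by rewrite -IH; apply: i_add; [exact: h | exact: vfield_sum].
Qed.

(** The claim is made for the components [wp w z] of an arbitrary z: it then defines a closed
    submodule and can be checked on generators, where weights of brackets and pairings split
    additively. *)
Lemma i_filt n k xi : vfield k xi -> raises n xi ->
  forall z w u, (u < w + n)%N -> wp u (iDR k xi (wp w z)) = 0.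
Proof.
move=> hxi hr; have [i1 i2 i3] := i_exists hom hxi; have [ci _ _] := i1.
have fi := full_derO i1.
have main (x : el Om) : forall w u, (u < w + n)%N -> wp u (iO k xi (wp w x)) = 0.
  apply: (Om_ind (A := [set x | forall w u, (u < w + n)%N -> wp u (iO k xi (wp w x)) = 0])).
  - have cc w u : continuous_linear (fun x : el Om => wp u (iO k xi (wp w x))).
      exact: (clin_comp (clin_comp (wp_clin gO w) ci) (wp_clin gO u)).
    split=> [w u _|a y y' hy hy' w u uw]; first exact: (cadd0 (clin_cadd (cc w u))).
    by rewrite (proj1 (cc w u)) hy // hy' // scaler0 addr0.
  - move=> x' hx' w u uw; have cc : cadd (fun x : el Om => wp u (iO k xi (wp w x))).
      by apply: clin_cadd; exact: (clin_comp (clin_comp (wp_clin gO w) ci) (wp_clin gO u)).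
    have cl : eclosed [set x | (fun x : el Om => wp u (iO k xi (wp w x))) x = 0].
      apply: (@eclosed_eq _ _ _ (fun x : el Om => wp u (iO k xi (wp w x))) (fun=> 0) _ cc);
        [by case: gO | exact: cadd_cst0].
    by apply: cl => F; have [y Ay e] := hx' F; exists y => //; exact: Ay.
  - by move=> y w u uw; rewrite wp_inO i2 (cadd0 (clin_cadd (wp_clin gO u))).
  - move=> y w u uw; rewrite wp_one -(dO_in hom) i3 wp_inO.
    by rewrite (hr _ _ (Sg_wp gG w y)) // (cadd0 (clin_cadd (@inO_clin K V))).
  move=> x1 x2 h1 h2 w u uw; rewrite wp_br.
  rewrite (cadd_sum (clin_cadd ci)) (cadd_sum (clin_cadd (wp_clin gO u))) big1 // => a _.
  rewrite fi (caddD (clin_cadd (wp_clin gO u))) !wp_br.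
  transitivity (0 + 0 : el Om); last exact: addr0.
  congr (_ + _); apply: big1 => b _.
    rewrite (wp_wp gO); case: eqP => [e|_]; last exact: (br0r (@br_clinr K V)).
    by rewrite e h1 ?(br0l (@br_clinl K V)) //; have := ltn_ord a; have := ltn_ord b; lia.
  have -> : wp b (par (k - 1) (wp a x1)) = par (k - 1) (wp b (wp a x1)).
    exact: (wp_commute gO gO (par_clin (k - 1) gO) (fun t => Sg_par _ _ t gO)).
  rewrite (wp_wp gO); case: eqP => [e|_]; last first.
    by rewrite (cadd0 (clin_cadd (par_clin _ gO))) (br0l (@br_clinl K V)).
  by rewrite h2 ?(br0r (@br_clinr K V)) //; have := ltn_ord a; have := ltn_ord b; lia.
have [cE hE] := iD_ok hom hxi.
move=> z; apply: (DR_ind (A := [set z | forall w u, (u < w + n)%N -> wp u (iDR k xi (wp w z)) = 0])).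
- have cc w u : @continuous_linear K DRm DRm (fun t => wp u (iDR k xi (wp w t))).
    exact: (clin_comp (clin_comp (wp_clin gDR w) cE) (wp_clin gDR u)).
  split=> [w u _|a y y' hy hy' w u uw]; first exact: (cadd0 (clin_cadd (cc w u))).
  by rewrite (proj1 (cc w u)) hy // hy' // scaler0 addr0.
- move=> x' hx' w u uw; have cc : @cadd K DRm DRm (fun t => wp u (iDR k xi (wp w t))).
    by apply: clin_cadd; exact: (clin_comp (clin_comp (wp_clin gDR w) cE) (wp_clin gDR u)).
  have cl : @eclosed K DRm [set t | (fun t => wp u (iDR k xi (wp w t))) t = 0].
    apply: (@eclosed_eq _ _ _ (fun t => wp u (iDR k xi (wp w t))) (fun=> 0) _ cc);
      [by case: gDR | exact: cadd_cst0].
  by apply: cl => F; have [y Ay e] := hx' F; exists y => //; exact: Ay.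
move=> x1 x2 w u uw; rewrite wp_dp.
rewrite (cadd_sum (clin_cadd cE)) (cadd_sum (clin_cadd (wp_clin gDR u))) big1 // => a _.
rewrite hE (caddD (clin_cadd (wp_clin gDR u))) !wp_dp.
transitivity (0 + 0 : el DRm); last exact: addr0.
congr (_ + _); apply: big1 => b _.
  rewrite (wp_wp gO); case: eqP => [e|_]; last exact: dp0r.
  by rewrite e main ?dp0l //; have := ltn_ord a; have := ltn_ord b; lia.
have -> : wp b (par (k - 1) (wp a x1)) = par (k - 1) (wp b (wp a x1)).
  exact: (wp_commute gO gO (par_clin (k - 1) gO) (fun t => Sg_par _ _ t gO)).
rewrite (wp_wp gO); case: eqP => [e|_]; last first.
  by rewrite (cadd0 (clin_cadd (par_clin _ gO))) dp0l.
by rewrite main ?dp0r //; have := ltn_ord a; have := ltn_ord b; lia.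
Qed.

End Symplectic.
End VectorFields.

(** * Symplectic vector fields *)

Section SymplecticFields.
Variables (K : evenRing) (V : fgmod).
Notation G := (gLie K V).
Notation Om := (Omega K V).

Notation DRm := (DRmod K V).
Notation gO := (good_Om K V).
Notation gG := (good_G K V).
Notation gDR := (good_DR K V).

Lemma Sg_comm (chi chi' : chr K) (P : pmod K) (x : el P) : good P -> clinear chi' ->
  Sg chi (Sg chi' x) = Sg chi' (Sg chi x).
Proof.
move=> gP cl; have [r hr ->] := elP x.
have h c : pmem (sig c r) by exact: (good_pmem c gP).
rewrite !(Sg_cls _ gP) //; congr (cls P _); apply: funext => b.
rewrite -[LHS]/(qk K (lam chi b) * ctau chi (qk K (lam chi' b) * ctau chi' (r b))).
rewrite -[RHS]/(qk K (lam chi' b) * ctau chi' (qk K (lam chi b) * ctau chi (r b))).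
by rewrite !cl ctau_qk mulrCA.
Qed.

Lemma SgWVK (P : pmod K) (x : el P) : good P -> Sg (chW K) (Sg (chWV K) x) = x.
Proof.
move=> gP; have [r hr ->] := elP x.
have h c : pmem (sig c r) by exact: (good_pmem c gP).
rewrite !(Sg_cls _ gP) //; congr (cls P _); apply: funext => b.
rewrite -[LHS]/(qk K (lam (chW K) b) * (qk K (lam (chWV K) b) * r b)).
rewrite mulrA -rmorphM lamW /lam /= expr1n exp1rz !mulr1 -exprMn mulfV // expr1n.
by rewrite rmorph1 mul1r.
Qed.

Lemma SgVWK (P : pmod K) (x : el P) : good P -> Sg (chWV K) (Sg (chW K) x) = x.
Proof. by move=> gP; rewrite (@Sg_comm _ _ _ _ gP (@clW K)) SgWVK. Qed.

Lemma SgV_eig (P : pmod K) w (x : el P) : good P ->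
  Sg (chW K) x = qk K (2%:R ^+ w) *: x -> Sg (chWV K) x = qk K (2%:R ^- w) *: x.
Proof.
move=> gP e; have := SgVWK x gP; rewrite e (SgZq _ gP) => {2}<-.
by rewrite scalerA -rmorphM /= mulVf ?expf_neq0 // rmorph1 scale1r.
Qed.

Lemma shifts_sig n (f : el G -> el G) y : continuous_linear f -> shifts n f ->
  Sg (chW K) (f y) = qk K (2%:R ^+ n) *: f (Sg (chW K) y).
Proof.
move=> cf hf; move: y; apply: (wt_ext gG gG).
- exact: (clin_comp cf (Sg_clin gG (@clW K))).
- by apply: clin_scale; exact: (clin_comp (Sg_clin gG (@clW K)) cf).
move=> v y e; rewrite (hf _ _ e) e (clinZ _ _ cf) scalerA -rmorphM /=.
by rewrite exprD mulrC.
Qed.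

Section Symplectic.
Variables (N : int) (om : DR K V).
Hypothesis hom : symplectic_form N om.
Hypothesis omW : @Sg K (chW K) DRm om = qk K (2%:R ^+ 2) *: (om : el DRm).

Lemma i_weight n k xi : vfield k xi -> shifts n xi ->
  @Sg K (chW K) DRm (iDR k xi om) = qk K (2%:R ^+ (n + 2)) *: iDR k xi om.
Proof.
move=> hxi hr; have [cx _ _] := hxi.
rewrite (@i_sig K V N om hom (chW K) (2%:R ^+ n)) //; last by move=> y; exact: shifts_sig.
rewrite omW (clinZ _ _ (iDR_clin hom hxi)) scalerA -rmorphM /= mulr1 divr1.
by rewrite exprD.
Qed.

(** The field is conjugated by the weight rescaling and normalized by 2^-n. Contraction is natural
    under this conjugation, so the weights of [om] and of i_xi(om) show that the conjugate field has
    the same contraction; injectivity of Phi identifies the two fields. *)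
Lemma weight_shifts n k xi : vfield k xi ->
  @Sg K (chW K) DRm (iDR k xi om) = qk K (2%:R ^+ (n + 2)) *: iDR k xi om -> shifts n xi.
Proof.
move=> hxi e; pose c : rat := 2%:R ^- n.
have n0 k' : (2%:R : rat) ^+ k' != 0 by rewrite expf_neq0.
pose cj (P : pmod K) (f : el P -> el P) (t : el P) := qk K c *: Sg (chW K) (f (Sg (chWV K) t)).
have clV : clinear (chWV K) by [].
have cj_clin (P : pmod K) (f : el P -> el P) : good P -> continuous_linear f ->
    continuous_linear (cj P f).
  move=> gP cf; apply: clin_scale.
  exact: (clin_comp (clin_comp (Sg_clin gP clV) cf) (Sg_clin gP (@clW K))).
have hS (P : pmod K) (x : el P) i chi : good P -> clinear chi -> homog i x -> homog i (Sg chi x).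
  move=> gP cl /(homogP _ _ gP) hx; apply/(homogP _ _ gP).
  by rewrite Sg_comm // hx (SgZq _ gP).
have cj_deg (P : pmod K) (f : el P -> el P) j : good P -> has_degree j f -> has_degree j (cj P f).
  move=> gP df i x hx; apply/(homogP _ _ gP); rewrite (SgZq _ gP).
  have /(homogP _ _ gP) -> : homog (i + j) (Sg (chW K) (f (Sg (chWV K) x))).
    by apply: (hS _ _ _ _ gP (@clW K)); apply: df; exact: hS.
  by rewrite !scalerA mulrC.
have [cx dx _] := hxi; have fx := full_derG hxi.
have h' : vfield k (cj G xi).
  apply: der_fullG; [exact: cj_clin gG cx | exact: cj_deg gG dx |] => x y.
  rewrite /cj Sg_brG fx (caddD (Sg_cadd _ gG)) !Sg_brG (Sg_par _ _ _ gG) !(SgWVK _ gG).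
  by rewrite scalerDr (brZl (@brG_clinl K V)) (brZr (@brG_clinr K V)).
have [i1 i2 i3] := i_exists hom hxi; have [j1 j2 j3] := i_exists hom h'.
have [ci di _] := i1; have fi := full_derO i1.
have hD : is_derivation (L := Om) (k - 1) (cj Om (iO k xi)).
  apply: der_fullO; [exact: cj_clin gO ci | exact: cj_deg gO di |] => x y.
  rewrite /cj Sg_br fi (caddD (Sg_cadd _ gO)) !Sg_br (Sg_par _ _ _ gO) !(SgWVK _ gO).
  by rewrite scalerDr (brZl (@br_clinl K V)) (brZr (@br_clinr K V)).
have eI : iO k (cj G xi) = cj Om (iO k xi).
  apply: funext; apply: (der_uniqO j1 hD) => y.
    by rewrite j2 /cj Sg_inO i2 (cadd0 (Sg_cadd _ gO)) scaler0.
  rewrite /cj Sg_oneform /= mulr1 rmorph1 scale1r -!(dO_in hom) j3 i3 Sg_inO.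
  exact: (clinZ _ _ (@inO_clin K V)).
have [cE hE] := iD_ok hom hxi.
have hs : dspec (k - 1) (iO k (cj G xi)) (cj DRm (iDR k xi)).
  split=> [|x y]; first exact: cj_clin gDR cE.
  rewrite eI /cj Sg_dp hE (caddD (Sg_cadd _ gDR)) !Sg_dp (Sg_par _ _ _ gO) !(SgWVK _ gO).
  by rewrite scalerDr dpZl dpZr.
have ee : cj G xi = xi.
  apply: (om_inj hom h' hxi); rewrite (dspec_uniq (iD_ok hom h') hs) /cj.
  rewrite (SgV_eig gDR omW) (clinZ _ _ cE) (SgZq _ gDR) e !scalerA -!rmorphM /=.
  set q := (X in qk K X *: _); have -> : q = 1; last by rewrite rmorph1 scale1r.
  by rewrite /q /c exprD; field; rewrite n0.
move=> w x ex.
have e1 : qk K (c * 2%:R ^- w) *: Sg (chW K) (xi x) = xi x.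
  rewrite -[RHS](congr1 (fun ff : el G -> el G => ff x) ee) /cj (SgV_eig gG ex).
  by rewrite (clinZ _ _ cx) (SgZq _ gG) scalerA -rmorphM.
rewrite -[in RHS]e1 scalerA -rmorphM.
set q := (X in qk K X *: _); have -> : q = 1; last by rewrite rmorph1 scale1r.
by rewrite /q /c exprD; field; rewrite !n0.
Qed.

Definition symp k xi := vfield k xi /\ dDR (iDR k xi om) = 0.

Lemma symp_exists k b : is_form 1 (k + N) b -> dDR b = 0 ->
  exists2 xi, symp k xi & iDR k xi om = b.
Proof. by move=> /(om_surj hom) [xi hx <-] db; exists xi. Qed.

Lemma symp_pot k xi (c : rat) : symp k xi ->
  exists2 a : el DRm, is_form 0 (k + N) a & dDR a = qk K c *: iDR k xi om.
Proof.
move=> [hx dx]; have [h1 h2] := om_form hom hx.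
have hf : is_form 1 (k + N) (qk K c *: (iDR k xi om : el DRm)).
  move/is_formP: (om_form hom hx) => [e1 e2]; apply/is_formP.
  by rewrite !(SgZq _ gDR) e1 e2 !scalerA ![qk K c * _]mulrC.
apply: (poincare hom hf).
by rewrite (clinZ _ _ (dDR_clin hom)) dx scaler0.
Qed.

Lemma d_inj2 k (a b : el DRm) : is_form 0 k a -> is_form 0 k b -> dDR a = dDR b -> a = b.
Proof.
move=> /is_formP [a1 a2] /is_formP [b1 b2] e.
apply/eqP; rewrite -subr_eq0; apply/eqP; apply: (d_inj hom (k := k)).
  apply/is_formP; rewrite !(caddB (Sg_cadd _ gDR)) a1 a2 b1 b2.
  by rewrite !scalerBr.
by rewrite (caddB (clin_cadd (dDR_clin hom))) e subrr.
Qed.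

Lemma symp_comm k l xi eta : symp k xi -> symp l eta ->
  symp (k + l) (vcomm k l xi eta) /\
  iDR (k + l) (vcomm k l xi eta) om = LDR k xi (iDR l eta om).
Proof.
move=> [hx dx] [he de]; have [hv iv] := i_comm hom hx he.
have L0 : LDR k xi om = 0 by apply/(L_om0 hom hx).
have e : iDR (k + l) (vcomm k l xi eta) om = LDR k xi (iDR l eta om).
  rewrite iv L0; have -> : iDR l eta (0 : el DRm) = 0.
    exact: (cadd0 (clin_cadd (iDR_clin hom he))).
  by rewrite scaler0; exact: subr0.
split; last exact: e.
split; first exact: hv.
rewrite e.
have := d_L hom (iDR l eta om) hx; rewrite de (cadd0 (clin_cadd (L_clin hom hx))).
move/(congr1 (fun t : el DRm => ksign K k *: t)).
by rewrite scaler0 scalerA ksignMK scale1r => <-.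
Qed.

(** The sign changes because the odd Lie derivative anticommutes with d. *)
Lemma pot_comm l c xi eta a : symp 1 xi -> symp l eta -> dDR a = qk K c *: iDR l eta om ->
  dDR (LDR 1 xi a) = qk K (- c) *: iDR (1 + l) (vcomm 1 l xi eta) om.
Proof.
move=> hx he ea; have [_ ->] := symp_comm hx he; have [vx _] := hx.
have := d_L hom a vx; rewrite ea (clinZ _ _ (L_clin hom vx)) /ksign expr1 scaleN1r => e.
by rewrite rmorphN scaleNr e opprK.
Qed.

Lemma sympD k xi eta : symp k xi -> symp k eta -> symp k (fun x => xi x + eta x).
Proof.
move=> [h1 d1] [h2 d2]; split; first exact: vfieldD.
rewrite (i_add hom om h1 h2); apply: etrans (caddD (clin_cadd (dDR_clin hom)) _ _) _.
exact: etrans (congr2 _ d1 d2) (addr0 _).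
Qed.

Lemma sympZ k q xi : symp k xi -> symp k (fun x => qk K q *: xi x).
Proof.
move=> [h1 d1]; split; first exact: vfieldZ.
rewrite (i_scale hom q om h1); apply: etrans (clinZ _ _ (dDR_clin hom)) _.
by rewrite d1; exact: scaler0.
Qed.

Lemma symp_sum k (I : Type) (r : seq I) (p : pred I) (F : I -> el G -> el G) :
  (forall i, p i -> symp k (F i)) -> symp k (\sum_(i <- r | p i) F i).
Proof.
move=> h; elim/big_ind: _ => [|f g hf hg|]; [|exact: sympD|exact: h].
split; first exact: der0G.
rewrite /iDR; case: (i0_ok hom k) => _ ->; rewrite der_DR0.
exact: (cadd0 (clin_cadd (dDR_clin hom))).
Qed.

Lemma symplecticP k xi : (vfield k xi /\ LDR k xi om = 0) <-> symp k xi.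
Proof. by split=> -[h1 h2]; split=> //; apply/(L_om0 hom h1). Qed.

End Symplectic.
End SymplecticFields.

(** * Pointed symplectomorphisms *)

Section Diffeomorphisms.
Variables (K : evenRing) (V : fgmod).
Notation G := (gLie K V).
Notation D1 := (desusp_pmod (Omega1 K V)).
Notation Om := (Omega K V).

Notation DRm := (DRmod K V).
Notation gO := (good_Om K V).
Notation gG := (good_G K V).
Notation gDR := (good_DR K V).

Implicit Types (xi eta f phi psi : el G -> el G) (x y : el G).

Lemma triv_DR : (forall x : el G, x = 0) -> forall z : el DRm, z = 0.
Proof.
move=> h; have hO := triv_Om h.
apply: (DR_ind (A := [set z | z = 0])).
- by split=> // a s t -> ->; rewrite scaler0 addr0.
- move=> s hs; apply: haus; first by case: gDR.
  by move=> F; have [t -> e] := hs F; rewrite subr0 in e.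
by move=> s t /=; rewrite (hO s); exact: dp0l.
Qed.

Lemma par_inO j y : par j (inO y) = inO (par j y).
Proof. exact: Sg_inO. Qed.

Lemma par_oneform j y : par j (oneform y) = ksign K j *: oneform (par j y).
Proof. by rewrite [LHS]Sg_oneform /= mul1r qk_signz. Qed.

Section Diffeo.
Variables (phi psi : el G -> el G).
Hypotheses (hinv : inverse_diffeos phi psi)
  (hdeg : has_degree (P := G) (Q := G) 0 phi) (hpt : pointed phi).

Let hphi : lie_hom (L := G) (L' := G) phi. Proof. by case: hinv. Qed.
Let hpsi : lie_hom (L := G) (L' := G) psi. Proof. by case: hinv. Qed.
Let cphi : continuous_linear phi. Proof. by case: hphi. Qed.
Let cpsi : continuous_linear psi. Proof. by case: hpsi. Qed.
Let phiK : cancel phi psi. Proof. by case: hinv. Qed.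
Let psiK : cancel psi phi. Proof. by case: hinv. Qed.

Lemma phi_SgD x : Sg (chD K) (phi x) = phi (Sg (chD K) x).
Proof.
have /(degreeP _ gG gG (clin_cadd cphi)) := hdeg.
move=> /(_ (fun q x => clinZ (qk K q) x cphi)) ->.
by rewrite expr0z rmorph1 scale1r.
Qed.

Lemma psi_degree : has_degree (P := G) (Q := G) 0 psi.
Proof.
apply/(degreeP _ gG gG (clin_cadd cpsi)); first by move=> q x; exact: clinZ.
move=> x; rewrite expr0z rmorph1 scale1r -[in RHS](psiK x) phi_SgD.
exact: esym (phiK _).
Qed.

Lemma phi_par k x : par k (phi x) = phi (par k x).
Proof. by rewrite (par_degree k _ gG gG cphi hdeg) mulr0 /ksign expr0 scale1r. Qed.
Lemma conj_vfield k xi : vfield k xi -> vfield k (phi \o xi \o psi).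
Proof.
move=> hx; have fx := full_derG hx; have [cx dx _] := hx.
have lp := proj2 hphi; have ls := proj2 hpsi.
apply: der_fullG.
- exact: (clin_comp (clin_comp cpsi cx) cphi).
- move=> i x h; have := hdeg (dx _ _ (psi_degree h)).
  by rewrite !addr0.
move=> x y /=; rewrite ls fx (caddD (clin_cadd cphi)) !lp !psiK.
by rewrite -phi_par psiK.
Qed.

Lemma pointed_raises : raises 1 (fun x => phi x - x).
Proof.
have [ff [hff hlim]] := hpt => w x e u uw; apply: (haus (proj1 gG)) => F.
have [_ cw] := wp_clin gG u; have [F' hF'] := cw F.
have [N hN] := hlim F' x; have := hF' _ (hN N (leqnn N)).
have cu := clin_cadd (wp_clin gG u).
(* The finite sum approximating phi x - x has no part of weight u: its terms have order i >= 2,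
   hence weight at least w + 1. *)
rewrite opprD addrA (caddB cu) (cadd_sum cu) big1_seq ?subr0 // => i /andP[_].
rewrite mem_index_iota => /andP[i2 _]; have [_ ho] := hff i i2.
have : shifts i.-1 (ff i) by apply/has_orderP; case: (i) i2 ho.
move=> /(_ _ _ e) e'; rewrite (wp_eig gG u e').
by have -> : (w + i.-1 == u)%N = false by lia.
Qed.

Let cphi1 : continuous_linear (fun x => phi x - x).
Proof. by apply: clin_sub => //; exact: clin_id. Qed.

(** Induction on the filtration level: phi(psi x) = x and psi x differ by terms one level higher
    than that of psi x, and x itself lies in level w. *)
Lemma psi_filt w x : Sg (chW K) x = qk K (2%:R ^+ w) *: x -> filt w (psi x).
Proof.
move=> e; have fx := filt_hom gG e.
suff h v : (v <= w)%N -> filt v (psi x) by exact: h.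
elim: v => [|v IH] vw; first exact: filt0.
have fv := IH (ltnW vw); move=> u; rewrite ltnS leq_eqVlt => /predU1P[->|]; last exact: fv.
have := raises_filt gG gG cphi1 pointed_raises fv (u := v); rewrite addn1 ltnSn psiK => /(_ isT).
rewrite (caddB (clin_cadd (wp_clin gG v))) fx // sub0r => /eqP.
by rewrite oppr_eq0 => /eqP.
Qed.

Lemma psi_raises : raises 1 (fun x => psi x - x).
Proof.
move=> w x e; have := raises_filt gG gG cphi1 pointed_raises (psi_filt e).
rewrite psiK => h u uw; have := h u uw.
rewrite -opprB -scaleN1r (clinZ _ _ (wp_clin gG u)) => h'.
have : -1 *: (-1 *: wp u (psi x - x)) = (-1 : K) *: (0 : el G) by rewrite h'.
by rewrite scalerA mulrNN mulr1 scale1r scaler0.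
Qed.

(** The difference splits into phi - 1 applied to f(psi x) and f applied to psi x - x; each gains
    one order. *)
Lemma conj_raises n f : continuous_linear f -> raises n f -> raises n.+1 (fun x => phi (f (psi x)) - f x).
Proof.
move=> cf hf w x e.
have h1 : filt (w + 1 + n) (f (psi x - x)) by exact: (raises_filt gG gG cf hf (psi_raises e)).
have h2 : filt (w + n) (f (psi x)) by exact: (raises_filt gG gG cf hf (psi_filt e)).
have h3 := raises_filt gG gG cphi1 pointed_raises h2.
have -> : phi (f (psi x)) - f x = (phi (f (psi x)) - f (psi x)) + f (psi x - x).
  by rewrite (caddB (clin_cadd cf)) addrA subrK.
apply: (filtD gG); first by apply: filtS h3; lia.
by apply: filtS h1; lia.
Qed.

Section Symplectic.
Variables (N : int) (om : DR K V).
Hypothesis hom : symplectic_form N om.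
Hypothesis hs : pullDR phi om = om.

Definition pull_ok :=
  [/\ lie_hom (L := Om) (L' := Om) (pullO phi),
    forall x, pullO phi (inO x) = inO (phi x),
    forall s : el Om, pullO phi (dO s) = dO (pullO phi s),
    @continuous_linear K DRm DRm (pullDR phi) &
    forall s t, pullDR phi (drpair s t) = drpair (pullO phi s) (pullO phi t)].

(** A zero form would be contracted to 0 by the Euler field as well as by the zero field, so the
    Euler field would vanish. *)
Lemma om0_triv : om = 0 -> forall x, x = 0.
Proof.
move=> o0 x; have e : @wmul K G = fun=> 0.
  apply: (om_inj hom (eul_der K V) (der0G K V 0)).
  rewrite o0; apply: etrans (cadd0 (clin_cadd (iDR_clin hom (eul_der K V)))) _.
  exact: esym (cadd0 (clin_cadd (iDR_clin hom (der0G K V 0)))).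
by apply: (wmul_inj gG (wp0_G x)); rewrite e.
Qed.

(* The default values of [pullO] and [pullDR] would give [om = 0]. *)
Lemma pull_cases : (forall x, x = 0) \/ pull_ok.
Proof.
have [o0|on] := pselect (om = 0); first by left; exact: om0_triv.
right.
have hD : exists E, @continuous_linear K DRm DRm E /\
    forall s t, E (drpair s t) = drpair (pullO phi s) (pullO phi t).
  apply: contrapT => nE; apply: on; rewrite -hs.
  suff -> : pullDR phi = fun=> 0 by [].
  by apply: xgetPN => E hE; apply: nE; exists E.
have [D1 D2] : @continuous_linear K DRm DRm (pullDR phi) /\
    forall s t, pullDR phi (drpair s t) = drpair (pullO phi s) (pullO phi t) by exact: (xgetPex (fun=> 0) hD).
have hP : exists F : el Om -> el Om, [/\ lie_hom (L := Om) (L' := Om) F,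
    forall x, F (inO x) = inO (phi x) & forall s, F (dO s) = dO (F s)].
  apply: contrapT => nE; apply: on; rewrite -hs.
  have e : pullO phi = fun=> 0 by apply: xgetPN => F hF; apply: nE; exists F.
  apply: (DR_uniq (E1 := pullDR phi) (E2 := fun=> 0)); first by case: gDR.
  - exact: D1.
  - exact: clin_cst0.
  by move=> s t; rewrite D2 e dp0l.
by have [P1 P2 P3] := xgetPex (fun=> 0) hP; split.
Qed.

(** Pullback intertwines contraction with a field and contraction with its conjugate, and commutes
    with d. As [om] is its own pullback, the 1-form of the conjugate is the pullback of a closed
    form. *)
Lemma conj_symp k xi : symp om k xi -> symp om k (phi \o xi \o psi).
Proof.
move=> [hx dx]; have hv := conj_vfield hx; split; first exact: hv.
have [tr|[[cF lF] Fi Fd cE hE]] := pull_cases; first exact: triv_DR.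
have [i1 i2 i3] := i_exists hom hx; have [j1 j2 j3] := i_exists hom hv.
have [ci _ _] := i1; have [cj _ _] := j1.
have fi := full_derO i1; have fj := full_derO j1.
set F := pullO phi in cF lF Fi Fd hE.
have F1 y : F (oneform y) = oneform (phi y).
  by rewrite -!(dO_in hom) Fd Fi.
(* The description of the pullback does not mention degrees. That it respects parity follows from
   uniqueness, since its conjugate by [par j] agrees with it on generators. *)
have Fpar j s : par j (F s) = F (par j s).
  have e : forall s, F s = par (- j) (F (par j s)).
    apply: Om_uniq_hom => // [|y|y].
    - split; first exact: (clin_comp (clin_comp (par_clin j gO) cF) (par_clin (- j) gO)).
      by move=> a b; rewrite par_br lF par_br.
    - rewrite par_inO !Fi par_inO -phi_par (par_par _ _ _ gG) addNr.
      by rewrite (par0 _ gG).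
    rewrite par_oneform (clinZ _ _ cF) !F1 (clinZ _ _ (par_clin _ gO)) par_oneform.
    rewrite -phi_par (par_par _ _ _ gG) addNr (par0 _ gG) scalerA -ksignM.
    by rewrite subrr /ksign expr0 scale1r.
  by rewrite [in LHS]e (par_par _ _ _ gO) subrr (par0 _ gO).
have e s : iO k (phi \o xi \o psi) (F s) = F (iO k xi s).
  apply: (Om_uniq (D1 := fun s => iO k (phi \o xi \o psi) (F s)) (D2 := fun s => F (iO k xi s))
    (F := F) (F' := fun s => F (par (k - 1) s))).
  - exact: (clin_comp cF cj).
  - exact: (clin_comp ci cF).
  - by move=> a b; rewrite lF fj Fpar.
  - by move=> a b; rewrite fi (caddD (clin_cadd cF)) !lF.
  - by move=> y; rewrite Fi j2 i2 (cadd0 (clin_cadd cF)).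
  by move=> y; rewrite F1 -!(dO_in hom) j3 i3 Fi /= phiK.
have [cI hI] := iD_ok hom hx; have [cJ hJ] := iD_ok hom hv.
have eDR z : iDR k (phi \o xi \o psi) (pullDR phi z) = pullDR phi (iDR k xi z).
  apply: (DR_uniq (E1 := fun z => iDR k (phi \o xi \o psi) (pullDR phi z))
    (E2 := fun z => pullDR phi (iDR k xi z))).
  - by case: gDR.
  - exact: (clin_comp cE cJ).
  - exact: (clin_comp cI cE).
  by move=> a b; rewrite hE hJ hI (caddD (clin_cadd cE)) !hE !e Fpar.
have [cd hd] := dDR_spec hom.
have ed z : dDR (pullDR phi z) = pullDR phi (dDR z).
  apply: (DR_uniq (E1 := fun z => dDR (pullDR phi z)) (E2 := fun z => pullDR phi (dDR z))).
  - by case: gDR.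
  - exact: (clin_comp cE cd).
  - exact: (clin_comp cd cE).
  by move=> a b; rewrite hE !hd (caddD (clin_cadd cE)) !hE !Fd Fpar.
rewrite -{1}hs eDR ed dx.
exact: (cadd0 (clin_cadd cE)).
Qed.

End Symplectic.
End Diffeo.

Section Identity.
Variables (N : int) (om : DR K V).
Hypothesis hom : symplectic_form N om.

Lemma pull_id : pullDR (fun x : el G => x) om = om.
Proof.
have hid : lie_hom (L := Om) (L' := Om) id by split=> //; exact: clin_id.
have hP : exists F : el Om -> el Om, [/\ lie_hom (L := Om) (L' := Om) F,
    forall x, F (inO x) = inO x & forall s, F (dO s) = dO (F s)] by exists id.
have [P1 P2 P3] := xgetPex (fun=> 0) hP.
have eO s : pullO (fun x : el G => x) s = s.
  apply: (Om_uniq_hom P1 hid P2) => y.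
  by rewrite -(dO_in hom) P3 P2.
have hD : exists E, @continuous_linear K DRm DRm E /\
    forall s t, E (drpair s t) = drpair (pullO (fun x : el G => x) s) (pullO (fun x : el G => x) t).
  by exists id; split=> [|s t]; [exact: clin_id | rewrite !eO].
have [D1 D2] : @continuous_linear K DRm DRm (pullDR (fun x : el G => x)) /\
    forall s t, pullDR (fun x : el G => x) (drpair s t) = drpair (pullO (fun x : el G => x) s) (pullO (fun x : el G => x) t) by exact: (xgetPex (fun=> 0) hD).
apply: (DR_uniq (E1 := pullDR (fun x : el G => x)) (E2 := id) (proj1 gDR) D1 (clin_id _)) => s t.
by rewrite D2 !eO.
Qed.

End Identity.
End Diffeomorphisms.

(** * Obstructions *)

Lemma filt_subwp (K : evenRing) (P : pmod K) v (y : el P) :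
  good P -> filt v y -> filt v.+1 (y - wp v y).
Proof.
move=> gP h u; rewrite ltnS leq_eqVlt (caddB (clin_cadd (wp_clin gP u))).
rewrite (wp_wp gP) => /predU1P[->|uv]; first by rewrite eqxx subrr.
by rewrite h // eq_sym ltn_eqF // subrr.
Qed.

Lemma wp_sum_nat (K : evenRing) (P : pmod K) (a b c v : nat) (F : nat -> el P) : good P ->
  (forall j, (a <= j < b)%N -> Sg (chW K) (F j) = qk K (2%:R ^+ (j + c)) *: F j) ->
  wp v (\sum_(a <= j < b) F j) = \sum_(a <= j < b | (j + c == v)%N) F j.
Proof.
move=> gP h; rewrite (cadd_sum (clin_cadd (wp_clin gP v))) [RHS]big_mkcond /=.
by apply: eq_big_nat => j /h /(wp_eig gP v) ->.
Qed.

Section Structures.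
Variables (K : evenRing) (A : frobAlg K).
Notation V := (fV A).
Notation N := (fN A).
Notation om := (fom A).
Notation G := (gLie K V).
Notation DRm := (DRmod K V).
Notation gG := (good_G K V).
Notation gDR := (good_DR K V).
Notation hom := (fom_symplectic A).
Notation m2 := (fm2 A).

Implicit Types (xi eta f : el G -> el G) (x y : el G) (m : cstr A).

Lemma om_weight : @Sg K (chW K) DRm om = qk K (2%:R ^+ 2) *: (om : el DRm).
Proof. by apply/(form_orderP 2 0); exact: fom_order. Qed.
Notation omW := om_weight.

Lemma Phi_invE k xi : vfield k xi -> @Phi_inv K A k (iDR k xi om) = xi.
Proof.
move=> hx; have h : exists e, vfield k e /\ iDR k e om = iDR k xi om by exists xi.
have [h1 h2] : vfield k (@Phi_inv K A k (iDR k xi om)) /\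
    iDR k (@Phi_inv K A k (iDR k xi om)) om = iDR k xi om by exact: (xgetPex (fun=> 0) h).
exact: (om_inj hom h1 hx h2).
Qed.

(** The sign of Upsilon as a rational number, so that it can be moved between a field and its
    contraction by [i_scale]. *)
Definition sgn k : rat := (-1) ^ (k + N).

Lemma sgnK k : sgn k * sgn k = 1.
Proof. by rewrite /sgn -expfzMl mulrNN mulr1 exp1rz. Qed.

Lemma UpsilonP k (a : DR K V) xi : is_form 0 (k + N) a -> vfield k xi ->
  @Upsilon K A k a = xi <-> dDR a = qk K (sgn k) *: (iDR k xi om : el DRm).
Proof.
move=> ha hx; have [eta he ee] := om_surj hom (d_form hom ha).
have eU : @Upsilon K A k a = fun x => qk K (sgn k) *: eta x.
  by rewrite /Upsilon -ee Phi_invE // -qk_signz.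
have es := i_scale hom (sgn k) om he; rewrite eU; split=> [<-|e].
  rewrite es scalerA -rmorphM /= sgnK rmorph1 scale1r; exact: esym ee.
apply: (om_inj hom (vfieldZ (sgn k) he) hx); rewrite es.
apply: etrans (congr1 (fun t : el DRm => qk K (sgn k) *: t) (etrans ee e)) _.
by rewrite scalerA -rmorphM /= sgnK rmorph1 scale1r.
Qed.

Lemma wp_dDR w (z : el DRm) : @wp K w DRm (dDR z) = dDR (wp w z).
Proof.
apply: (wp_commute gDR gDR (dDR_clin hom)) => t.
by rewrite (dDR_sig (d_exists hom)) /= mulr1 rmorph1 scale1r.
Qed.

Lemma wp_i n k xi w v (z : el DRm) : vfield k xi -> shifts n xi -> (w + n = v)%N ->
  @wp K v DRm (iDR k xi z) = iDR k xi (wp w z).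
Proof.
move=> hx hr e; apply: (wp_shift (n := n) (m := 0) gDR gDR (iDR_clin hom hx)) => [t|].
  rewrite expr0 rmorph1 scale1r.
  rewrite (@i_sig K V N om hom (chW K) (2%:R ^+ n)) //; last first.
    by move=> y; apply: shifts_sig => //; case: hx.
  by rewrite /= mulr1 divr1.
by rewrite addn0.
Qed.

Lemma i_raises n k xi : vfield k xi -> raises n xi -> raises n (iDR k xi : el DRm -> el DRm).
Proof.
move=> hx hr w z /(wp_id gDR) <- u; exact: (i_filt hom hx hr).
Qed.

Lemma i_top p k xi eta : vfield k xi -> vfield k eta -> raises p.+1 (fun x => xi x - eta x) ->
  @wp K (p + 2) DRm (iDR k xi om) = wp (p + 2) (iDR k eta om : el DRm).
Proof.
move=> hx he hr; have [hv ei] := i_sub hom om hx he.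
have := i_raises hv hr omW (u := p + 2); rewrite addnC ltnS leqnn => /(_ isT).
rewrite ei (caddB (clin_cadd (wp_clin gDR _))) => /eqP.
by rewrite subr_eq0 => /eqP.
Qed.

Lemma m_weight i k xi : (0 < i)%N -> vfield k xi -> has_order i xi ->
  @Sg K (chW K) DRm (iDR k xi om) = qk K (2%:R ^+ (i + 1)) *: iDR k xi om.
Proof.
case: i => // i _ hx /has_orderP hr; rewrite addSnnS.
exact: (i_weight hom omW hx hr).
Qed.

Lemma iDR0 k : iDR k (fun _ : el G => 0) om = 0.
Proof. by rewrite /iDR; case: (i0_ok hom k) => _ ->; rewrite der_DR0. Qed.

Lemma m2_symp : symp om 1 m2.
Proof. by apply/(symplecticP hom); split; [exact: fm2_vfield | exact: fm2_symplectic]. Qed.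

Lemma m2_shifts : shifts 1 m2.
Proof. by apply/has_orderP; exact: fm2_order. Qed.

Lemma is_form0Z k q (a : el DRm) : is_form 0 k a -> is_form 0 k (qk K q *: a).
Proof.
move=> /is_formP [a1 a2]; apply/is_formP.
by rewrite !(SgZq _ gDR) a1 a2 !scalerA ![qk K q * _]mulrC.
Qed.

(** d commutes with the weight rescaling and is injective on 0-forms, so a potential has the weight
    of its differential. *)
Lemma weight_pot k v (a : el DRm) : is_form 0 k a ->
  Sg (chW K) (dDR a) = qk K (2%:R ^+ v) *: (dDR a : el DRm) ->
  Sg (chW K) a = qk K (2%:R ^+ v) *: a.
Proof.
move=> ha e; have /is_formP [a1 a2] := ha.
apply: (d_inj2 hom (k := k)); [|exact: is_form0Z|].
  apply/is_formP; split; rewrite (Sg_comm _ _ gDR (@clW K)) ?a1 ?a2 (SgZq _ gDR) //.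
rewrite (clinZ _ _ (dDR_clin hom)) -e (dDR_sig (d_exists hom)).
by rewrite /= mulr1 rmorph1 scale1r.
Qed.

Lemma L_closed k xi (z : el DRm) : symp om k xi -> dDR z = 0 ->
  LDR k xi z = - (ksign K (k - 1) *: (dDR (iDR k xi z) : el DRm)).
Proof.
move=> [hx _] dz; have [_ ->] := LDR_spec hom hx.
by rewrite dz (cadd0 (clin_cadd (iDR_clin hom hx))); exact: sub0r.
Qed.

Lemma wp_L n k xi w v (z : el DRm) : symp om k xi -> shifts n xi -> (w + n = v)%N ->
  dDR z = 0 -> @wp K v DRm (LDR k xi z) = LDR k xi (wp w z).
Proof.
move=> hx hr e dz; have [vx _] := hx.
have dz' : dDR (wp w z) = 0 by rewrite -wp_dDR dz (cadd0 (clin_cadd (wp_clin gDR _))).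
have cw := wp_clin gDR v.
rewrite (L_closed hx dz) (L_closed hx dz') (caddN (clin_cadd cw)) (clinZ _ _ cw).
by rewrite wp_dDR (wp_i z vx hr e).
Qed.

Lemma wp_form i k w (z : el DRm) : is_form i k z -> is_form i k (wp w z).
Proof.
move=> /is_formP [h1 h2]; apply/is_formP.
by rewrite /wp !(Sg_kd _ gDR (@clW K)) h1 h2 -!/(wp _ _) !(clinZ _ _ (wp_clin gDR w)).
Qed.

Lemma double_eq0 (z : el DRm) (q : rat) : q != 0 -> qk K q *: z = 0 -> z = 0.
Proof.
move=> q0 /(congr1 (fun t : el DRm => qk K q^-1 *: t)).
by rewrite scalerA -rmorphM /= mulVf // rmorph1 scale1r scaler0.
Qed.

Lemma sgn_neq0 k : sgn k != 0.
Proof. exact: signz_neq0. Qed.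

(** Translates an equation of 1-forms into one of potentials: d(a - L b) is sgn/2 times the
    left-hand side, where the 1/2 is that of Obs and the sign from L d = - d L turns subtraction of
    L b into addition of L bt. Injectivity of d on 0-forms gives the equivalence. *)
Lemma potential_eq (a b w bt : el DRm) : is_form 0 (2 + N) a -> is_form 0 (1 + N) b ->
  dDR a = qk K (sgn 2 / 2%:R) *: w -> dDR b = qk K (sgn 2) *: bt ->
  w + (LDR 1 m2 bt + LDR 1 m2 bt) = 0 <-> LDR 1 m2 b = a.
Proof.
move=> ha hb ea eb; have [v2 _] := m2_symp.
have hL : is_form 0 (2 + N) (LDR 1 m2 b).
  by rewrite -[2](_ : 1 + 1 = _) // -addrA; exact: (L_form0 hom v2 hb).
have e : dDR (LDR 1 m2 b) = - (qk K (sgn 2) *: (LDR 1 m2 bt : el DRm)).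
  have := d_L hom b v2; rewrite eb (clinZ _ _ (L_clin hom v2)) /ksign expr1 scaleN1r => ->.
  by rewrite opprK.
set L : el DRm := LDR 1 m2 bt in e *.
have ew : qk K (sgn 2 / 2%:R) *: (w + (L + L)) = dDR a - dDR (LDR 1 m2 b).
  have h2 : qk K (sgn 2 / 2%:R) *: (L + L) = qk K (sgn 2) *: L.
    rewrite scalerDr -scalerDl -rmorphD /=; congr (qk K _ *: _).
    by field.
  by rewrite scalerDr -ea e opprK h2.
have q0 : sgn 2 / 2%:R != 0 by rewrite mulf_neq0 ?sgn_neq0.
split=> [h|h].
  apply: (d_inj2 hom hL ha); apply/eqP; rewrite eq_sym -subr_eq0.
  by apply/eqP; rewrite -[LHS]ew h scaler0.
apply: (double_eq0 q0); rewrite ew h; exact: subrr.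
Qed.

Lemma HCobP n (a : DR K V) : HCob A (n + 2) (1 + N) a <->
  exists b : el DRm, [/\ is_form 0 (1 + N) b,
    Sg (chW K) b = qk K (2%:R ^+ (n + 1)) *: b & LDR 1 m2 b = a].
Proof.
split=> [[i' [b [e [h1 h2] h3]]]|[b [h1 h2 h3]]].
  exists b; split=> //; first by move: h1; rewrite subrK.
  by have := (form_orderP 0 i' b).1 h2; have -> : (i' + 0 = n + 1)%N by lia.
exists (n + 1)%N, b; split=> //; first by lia.
split; first by rewrite subrK.
by apply/(form_orderP 0); rewrite addn0.
Qed.

Lemma HCob0 n : HCob A (n + 2) (1 + N) 0.
Proof.
apply/HCobP; exists 0; have [v2 _] := m2_symp; split.
- by apply/is_formP; rewrite !(cadd0 (Sg_cadd _ gDR)) !scaler0.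
- by rewrite (cadd0 (Sg_cadd _ gDR)) scaler0.
exact: (cadd0 (clin_cadd (L_clin hom v2))).
Qed.

Lemma HCobB n (a a' : DR K V) : HCob A (n + 2) (1 + N) a -> HCob A (n + 2) (1 + N) a' ->
  HCob A (n + 2) (1 + N) (a - a').
Proof.
move=> /HCobP [b [/is_formP [f1 f2] w1 <-]] /HCobP [b' [/is_formP [g1 g2] w2 <-]].
apply/HCobP; exists (b - b'); have [v2 _] := m2_symp.
split; last exact: (caddB (clin_cadd (L_clin hom v2))).
  by apply/is_formP; rewrite !(caddB (Sg_cadd _ gDR)) f1 f2 g1 g2 !scalerBr.
by rewrite (caddB (Sg_cadd _ gDR)) w1 w2 scalerBr.
Qed.

Lemma hclass_eqP n (a a' : DR K V) :
  HCocycle A (n + 2) (1 + N) a -> HCocycle A (n + 2) (1 + N) a' ->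
  hclass A (n + 2) (1 + N) a = hclass A (n + 2) (1 + N) a' <->
  HCob A (n + 2) (1 + N) (a - a').
Proof.
move=> ha ha'; split=> [e|h].
  have : hclass A (n + 2) (1 + N) a a by split=> //; rewrite subrr; exact: HCob0.
  by rewrite e => -[].
apply/seteqP; split=> b [hb hc]; split=> //.
  have := HCobB hc (HCobB (HCob0 n) h).
  by rewrite sub0r opprK addrA subrK.
have := HCobB hc h.
by rewrite opprB addrA subrK.
Qed.

Lemma HCocycle0 n : HCocycle A (n + 2) (1 + N) 0.
Proof.
have [v2 _] := m2_symp; split; [split|exact: (cadd0 (clin_cadd (L_clin hom v2)))].
  by apply/is_formP; rewrite !(cadd0 (Sg_cadd _ gDR)) !scaler0.
by apply/form_orderP; rewrite (cadd0 (Sg_cadd _ gDR)) scaler0.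
Qed.

(** * The obstruction cocycle of a fixed structure *)

Section Structure.
Variables (n : nat) (m : cstr A).
Hypothesis hm : Cn_over n m.

Let hC : Cn_structure n m. Proof. by case: hm. Qed.
Lemma m_2 : m 2 = m2. Proof. by case: hm. Qed.

Lemma m_vfield i : (2 <= i < n)%N -> vfield 1 (m i).
Proof. by case: hC => h _ _ /h []. Qed.

Lemma m_order i : (2 <= i < n)%N -> has_order i (m i).
Proof. by case: hC => h _ _ /h []. Qed.

Lemma m_shifts i : (2 <= i < n)%N -> shifts i.-1 (m i).
Proof. by move=> hi; have := m_order hi; case: i hi => // i _ /has_orderP. Qed.

Lemma csum_symp : symp om 1 (csum n m).
Proof. by apply/(symplecticP hom); case: hC. Qed.

Lemma i_csum : iDR 1 (csum n m) om = \sum_(2 <= i < n) iDR 1 (m i) om.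
Proof.
rewrite /csum big_seq (i_sum hom) => [|i]; last by rewrite mem_index_iota; exact: m_vfield.
by rewrite -big_seq.
Qed.

(** Only the sum is assumed symplectic. The contraction with [m i] is the part of weight i + 1 of a
    closed 1-form, and d preserves weights. *)
Lemma m_symp i : (2 <= i < n)%N -> symp om 1 (m i).
Proof.
move=> hi; split; first exact: m_vfield.
have [_ e] := csum_symp; have := wp_dDR (i + 1) (iDR 1 (csum n m) om).
rewrite e (cadd0 (clin_cadd (wp_clin gDR _))) i_csum (@wp_sum_nat K DRm 2 n 1 _ _ gDR).
  under eq_bigl => j do rewrite eqn_add2r.
  by rewrite big_nat1_eq hi => <-.
move=> j hj; apply: m_weight; [lia | exact: m_vfield | exact: m_order].
Qed.

Lemma m_comm_symp i j : (2 <= i < n)%N -> (2 <= j < n)%N ->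
  symp om (1 + 1) (vcomm 1 1 (m i) (m j)).
Proof. by move=> hi hj; have [] := symp_comm hom (m_symp hi) (m_symp hj). Qed.

Lemma obs_symp : symp om (1 + 1) (obs_field n m).
Proof.
rewrite /obs_field big_seq; apply: (symp_sum hom) => i; rewrite mem_index_iota => hi.
rewrite big_seq_cond; apply: (symp_sum hom) => j.
by rewrite mem_index_iota => /andP[hj _]; apply: m_comm_symp; lia.
Qed.

Lemma obs_shifts : shifts n (obs_field n m).
Proof.
rewrite /obs_field big_seq; apply: shifts_sum => i; rewrite mem_index_iota => hi.
rewrite big_seq_cond; apply: shifts_sum => j.
rewrite mem_index_iota => /andP[hj /eqP e]; rewrite vcomm11.
have ri : shifts i.-1 (m i) by apply: m_shifts; lia.
have rj : shifts j.-1 (m j) by apply: m_shifts; lia.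
have e1 : (i.-1 + j.-1 = n)%N by lia.
apply: shiftsD; first by rewrite -e1 addnC; exact: (shifts_comp rj ri).
by rewrite -e1; exact: (shifts_comp ri rj).
Qed.

Lemma csum_vfield : vfield 1 (csum n m). Proof. by case: csum_symp. Qed.
Lemma csum_clin : continuous_linear (csum n m). Proof. by case: csum_vfield. Qed.
Hypothesis hn : (3 <= n)%N.

Lemma csumE x : csum n m x = m2 x + \sum_(3 <= i < n) m i x.
Proof. by rewrite /csum fct_sumE big_ltn // m_2. Qed.

Lemma csum_raises2 : raises 2 (fun x => csum n m x - m2 x).
Proof.
move=> w x e; rewrite csumE addrC addKr big_seq.
apply: (filt_sum gG) => i; rewrite mem_index_iota => hi.
have ri : shifts i.-1 (m i) by apply: m_shifts; lia.
by apply: raisesS (shifts_raises ri) _ _ e; lia.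
Qed.

Lemma csum_sq : raises n (csum n m \o csum n m).
Proof. by have [_ _ /order_geP[]] := hC. Qed.

Lemma csum_sq_wp w x : Sg (chW K) x = qk K (2%:R ^+ w) *: x ->
  wp (w + n) (csum n m (csum n m x)) =
  \sum_(3 <= i < n) \sum_(3 <= j < n | (i + j == n + 2)%N) m j (m i x).
Proof.
move=> e; rewrite {2}/csum fct_sumE (cadd_sum (clin_cadd csum_clin)).
rewrite (cadd_sum (clin_cadd (wp_clin gG _))).
have h i : (2 <= i < n)%N -> wp (w + n) (csum n m (m i x)) =
    \sum_(2 <= j < n | (i + j == n + 2)%N) m j (m i x).
  move=> hi; rewrite /csum fct_sumE (wp_sum_nat (c := w + i - 2) _ gG).
    by apply: eq_bigl => j; lia.
  move=> j hj; have -> : (j + (w + i - 2) = w + i.-1 + j.-1)%N by lia.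
  by apply: m_shifts hj _ _ _; apply: m_shifts hi _ _ _.
(* For i = 2 the condition forces j = n, which is out of range; by symmetry j = 2 drops out below.
   Hence only the components of index at least 3 contribute to the lowest part. *)
rewrite big_ltn // h ?hn // [X in X + _]big_nat_cond big_pred0 ?add0r => [|j]; last by lia.
apply: eq_big_nat => i hi; have hi2 : (2 <= i < n)%N by lia.
rewrite (h _ hi2) big_ltn_cond //.
by have -> : (i + 2 == n + 2)%N = false by lia.
Qed.

(** The sum runs over ordered pairs and each bracket of odd fields contributes both compositions, so
    every product m_j m_i is counted twice. *)
Lemma obs_wp w x : Sg (chW K) x = qk K (2%:R ^+ w) *: x ->
  obs_field n m x = wp (w + n) (csum n m (csum n m x)) + wp (w + n) (csum n m (csum n m x)).
Proof.
move=> e; rewrite (csum_sq_wp e) /obs_field fct_sumE.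
under eq_bigr do rewrite fct_sumE.
under eq_bigr do under eq_bigr do rewrite vcomm11.
under eq_bigr do rewrite big_split /=.
rewrite big_split /=; congr (_ + _).
under eq_bigr do rewrite big_mkcond /=.
rewrite exchange_big /=; apply: eq_bigr => j _; rewrite [RHS]big_mkcond /=.
by apply: eq_bigr => i _; rewrite addnC.
Qed.

Lemma sq_obs : raises n.+1 (fun x => vcomm 1 1 (csum n m) (csum n m) x - obs_field n m x).
Proof.
move=> w x e; rewrite vcomm11 (obs_wp e) opprD addrACA addnS.
have h := filt_subwp gG (csum_sq e).
by apply: (filtD gG).
Qed.

(** Both sides are twice the part of weight w + n + 1 of the triple composition m m m: replacing the
    outer or the inner m by m_2 costs an error of weight at least w + n + 2, since m - m_2 has order
    at least 3 and m m has order at least n + 1. *)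
Lemma obs_m2 x : m2 (obs_field n m x) = obs_field n m (m2 x).
Proof.
have c2 : continuous_linear m2 by case: (fm2_vfield A).
have [[co _ _] _] := obs_symp; have cc := csum_clin.
have r2 : shifts 1 m2 by apply/has_orderP; exact: fm2_order.
apply: (wt_ext gG gG (f := m2 \o obs_field n m) (h := obs_field n m \o m2)).
- exact: (clin_comp co c2).
- exact: (clin_comp c2 co).
move=> w y e /=; have e1 := r2 _ _ e.
rewrite (obs_wp e) (obs_wp e1) (caddD (clin_cadd c2)).
suff -> : m2 (wp (w + n) (csum n m (csum n m y))) =
          wp (w + 1 + n) (csum n m (csum n m (m2 y))) by [].
set y2 := csum n m (csum n m y); have h2 : filt (w + n) y2 := csum_sq e.
have -> : m2 (wp (w + n) y2) = wp (w + n + 1) (m2 y2) by rewrite (shifts_wp (n := 1)).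
have -> : wp (w + n + 1) (m2 y2) = wp (w + n + 1) (csum n m y2).
  apply/eqP; rewrite eq_sym -subr_eq0 -(caddB (clin_cadd (wp_clin gG _))); apply/eqP.
  by apply: (raises_filt gG gG _ csum_raises2 h2) => [|]; [exact: clin_sub | lia].
rewrite addnAC; apply/eqP; rewrite -subr_eq0 /y2 -(caddB (clin_cadd (wp_clin gG _))).
rewrite -!(caddB (clin_cadd cc)); apply/eqP.
apply: (raises_filt gG gG (clin_comp cc cc) csum_sq (csum_raises2 e)); lia.
Qed.

Lemma obs_jacobi : vcomm 1 (1 + 1) m2 (obs_field n m) = fun=> 0.
Proof.
apply: funext => x; rewrite -[LHS]/(m2 (obs_field n m x) - ksign K (1 * (1 + 1)) *: obs_field n m (m2 x)).
by rewrite obs_m2 /ksign -signr_odd expr0 scale1r subrr.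
Qed.

Lemma Obs_spec : is_form 0 (2 + N) (Obs n m) /\
  dDR (Obs n m) = qk K (sgn 2 / 2%:R) *: (iDR 2 (obs_field n m) om : el DRm).
Proof.
have ho : symp om 2 (obs_field n m) := obs_symp.
have [vo _] := ho; have [a ha ea] := symp_pot hom (sgn 2) ho.
have h : exists a, is_form 0 (2 + N) a /\ @Upsilon K A 2 a = obs_field n m.
  by exists a; split; [exact: ha | apply/(UpsilonP ha vo)].
have [h1 /(UpsilonP h1 vo) h2] : is_form 0 (2 + N) (Upsilon_inv 2 (obs_field n m)) /\
    Upsilon 2 (Upsilon_inv 2 (obs_field n m)) = obs_field n m by exact: (xgetPex 0 h).
rewrite -[Obs n m]/(qk K 2%:R^-1 *: (Upsilon_inv 2 (obs_field n m) : el DRm)).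
split; first exact: is_form0Z.
apply: etrans (clinZ _ _ (dDR_clin hom)) _; rewrite h2 scalerA -rmorphM /=.
by rewrite mulrC.
Qed.

(** The obstruction field is symplectic, so the Poincare lemma provides the preimage; thus
    [Upsilon_inv] does not fall back on its default there. *)
Lemma Upsilon_obs : exists! a, is_form 0 (2 + N) a /\ Upsilon 2 a = obs_field n m.
Proof.
have ho : symp om 2 (obs_field n m) := obs_symp.
have [vo _] := ho; have [a ha ea] := symp_pot hom (sgn 2) ho.
exists a; split; first by split; [exact: ha | apply/(UpsilonP ha vo)].
move=> b [hb /(UpsilonP hb vo) eb]; apply: (d_inj2 hom ha hb).
exact: etrans ea (esym eb).
Qed.

Lemma Obs_cocycle : HCocycle A (n + 2) (1 + N) (Obs n m).
Proof.
have [h1 h2] := Obs_spec; have ho : symp om 2 (obs_field n m) := obs_symp.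
have [vo _] := ho; have [v2 _] := m2_symp; split; [split|].
- by rewrite addrAC; exact: h1.
- apply/(form_orderP 0); rewrite addn0; apply: (weight_pot h1).
  rewrite h2 (SgZq _ gDR) (i_weight hom omW vo obs_shifts) !scalerA.
  by rewrite [X in X *: _]mulrC.
(* The Lie derivative of Obs(m) is a 0-form, so it vanishes once its differential does; the latter
   is a multiple of the contraction with the commutator of m_2 and the obstruction field. *)
apply: (d_inj hom (k := 1 + (2 + N)) (L_form0 hom v2 h1)).
apply: etrans (pot_comm hom m2_symp ho h2) _.
have -> : vcomm 1 2 m2 (obs_field n m) = fun=> 0 := obs_jacobi.
by rewrite iDR0 scaler0.
Qed.

Definition def_field (u : el G -> el G) x :=
  obs_field n m x + (vcomm 1 1 m2 u x + vcomm 1 1 m2 u x).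

(** The lowest part of the square of a structure deformed by terms of order at least n. The
    neglected terms are m - m_2 composed with u on either side, which has order at least n + 2, and
    u u, which does because 2(n - 1) >= n + 1. *)
Lemma sq_deform u : continuous_linear u -> raises n.-1 u ->
  raises n.+1 (fun x => vcomm 1 1 (fun x => csum n m x + u x) (fun x => csum n m x + u x) x
                    - def_field u x).
Proof.
move=> cu hu w x e; have cM := clin_cadd csum_clin; have cU := clin_cadd cu.
have fD v (s s' t t' : el G) : filt v (s - s') -> filt v (t - t') -> filt v (s + t - (s' + t')).
  by move=> h1 h2; rewrite opprD addrACA; by apply: (filtD gG).
have cm2 : continuous_linear m2 by case: m2_symp => [[]].
have c12 : continuous_linear (fun y => csum n m y - m2 y) := clin_sub csum_clin cm2.
have hB : filt (w + n.+1) (csum n m (u x) - m2 (u x)).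
  by apply: filtS (raises_filt gG gG c12 csum_raises2 (hu _ _ e)); lia.
have hC' : filt (w + n.+1) (u (csum n m x) - u (m2 x)).
  by rewrite -(caddB cU); apply: filtS (raises_filt gG gG cu hu (csum_raises2 e)); lia.
have hD : filt (w + n.+1) (u (u x) - 0).
  by rewrite subr0; apply: filtS (raises_filt gG gG cu hu (hu _ _ e)); lia.
rewrite /def_field !vcomm11 !(caddD cM) !(caddD cU).
set a := csum n m (csum n m x); set s := m2 (u x); set t := u (m2 x).
have e2 (z o : el G) : z - (o + (s + t + (s + t))) =
    (z - (a + s + (t + 0) + (a + s + (t + 0)))) + (a + a - o).
  have -> : a + s + (t + 0) + (a + s + (t + 0)) = s + t + (s + t) + (a + a).
    by rewrite addr0 -(addrA a s t) addrACA addrC.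
  set q := s + t + (s + t); set p := a + a.
  have -> : z - (q + p) = z - q - p by rewrite opprD addrA.
  by rewrite subrKA opprD addrA addrAC.
rewrite e2; apply: (filtD gG); last by have := sq_obs e; rewrite vcomm11.
have hA : filt (w + n.+1) (a - a) by rewrite subrr; exact: (filt_0 gG).
by apply: (fD); apply: (fD); apply: (fD).
Qed.

End Structure.
End Structures.

(** * Extending a structure and replacing it by an equivalent one *)

Section Structures.
Variables (K : evenRing) (A : frobAlg K).
Notation V := (fV A).
Notation N := (fN A).
Notation om := (fom A).
Notation G := (gLie K V).
Notation DRm := (DRmod K V).
Notation gG := (good_G K V).
Notation gDR := (good_DR K V).
Notation hom := (fom_symplectic A).
Notation m2 := (fm2 A).

Implicit Types (xi eta f : el G -> el G) (x y : el G) (m : cstr A).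
Notation omW := (om_weight A).

Lemma def_shifts n m u : (3 <= n)%N -> Cn_over n m -> shifts n.-1 u -> shifts n (def_field n m u).
Proof.
move=> hn hm hu; apply: shiftsD; first exact: obs_shifts.
have h : shifts n (vcomm 1 1 m2 u).
  rewrite vcomm11; have r2 := @m2_shifts K A; apply: shiftsD.
    by have := shifts_comp hu r2; rewrite addn1 prednK //; lia.
  by have := shifts_comp r2 hu; rewrite add1n prednK //; lia.
exact: shiftsD.
Qed.

Lemma def_i n m u : Cn_over n m -> symp om 1 u ->
  vfield (1 + 1) (def_field n m u) /\
  iDR (1 + 1) (def_field n m u) om =
    (iDR (1 + 1) (obs_field n m) om : el DRm) +
    (LDR 1 m2 (iDR 1 u om) + LDR 1 m2 (iDR 1 u om)).
Proof.
move=> hm hu; have [[hv _] e] := symp_comm hom (@m2_symp K A) hu.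
have [ho _] := obs_symp hm; split; first exact: vfieldD ho (vfieldD hv hv).
rewrite (i_add hom om ho (vfieldD hv hv)) (i_add hom om hv hv).
by rewrite e.
Qed.

Lemma shifts_raises0 n f : continuous_linear f -> shifts n f -> raises n.+1 f -> f = fun=> 0.
Proof.
move=> cf hf hz; apply: funext; apply: (wt_ext gG gG cf (clin_cst0 _ _)) => w x e.
rewrite -((wp_id gG (w + n) _).1 (hf _ _ e)); have h := hz _ _ e.
by apply: h; rewrite addnS.
Qed.

Lemma csum_extend n m u : (3 <= n)%N ->
  csum n.+1 (extend n m u) = fun x => csum n m x + u x.
Proof.
move=> hn; rewrite /csum big_nat_recr /=; last by lia.
rewrite {2}/extend eqxx; apply: funext => x; rewrite fctE /= !fct_sumE; congr (_ + _).
by apply: eq_big_nat => i hi; rewrite /extend; case: eqP => // ei; lia.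
Qed.

Lemma weightZ (c q : rat) (z : el DRm) : Sg (chW K) z = qk K q *: z ->
  Sg (chW K) (qk K c *: z) = qk K q *: (qk K c *: z).
Proof. by move=> e; rewrite (SgZq _ gDR) e !scalerA [X in X *: _]mulrC. Qed.

(** The field [def_field n m u] has order exactly n + 1, so the square of the extension gains an
    order only if this field vanishes; by injectivity of Phi that is a condition on its
    contraction. *)
Lemma extend_structP n m u : (3 <= n)%N -> Cn_over n m -> symp om 1 u -> has_order n u ->
  Cn_structure n.+1 (extend n m u) <->
  (iDR (1 + 1) (obs_field n m) om : el DRm) +
    (LDR 1 m2 (iDR 1 u om) + LDR 1 m2 (iDR 1 u om)) = 0.
Proof.
move=> hn hm hu ho; have [vu _] := hu; have [cu _ _] := vu.
have hr : shifts n.-1 u by case: (n) hn ho => // k _ /has_orderP.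
have [vd <-] := def_i hm hu; have hd := sq_deform hm hn cu (shifts_raises hr).
have hs := sympD hom (csum_symp hm) hu.
have cs : continuous_linear (fun x => csum n m x + u x) by case: hs => [[]].
split=> [[_ _]|e0].
  rewrite (csum_extend _ _ hn) => /order_geP [cq hq].
  have hz : raises n.+1 (def_field n m u).
    move=> w x e; have h1 := hd _ _ e; have h2 := hq _ _ e.
    rewrite -[def_field n m u x](subKr (vcomm 1 1 (fun x => csum n m x + u x) (fun x => csum n m x + u x) x)).
    by apply: (filtB gG) h1; rewrite vcomm11; exact: (filtD gG).
  have [cd _ _] := vd.
  by rewrite (shifts_raises0 cd (def_shifts hn hm hr) hz) iDR0.
have hd0 : def_field n m u = fun=> 0.
  by apply: (om_inj hom vd (der0G K V (1 + 1))); rewrite e0 iDR0.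
split; rewrite ?(csum_extend _ _ hn).
- move=> i hi; rewrite /extend; case: eqP => [->|ni]; first by split.
  by split; [apply: (m_vfield hm) | apply: (m_order hm)]; lia.
- by apply/(symplecticP hom).
apply/order_geP; split; first exact: (clin_comp cs cs).
move=> w x e; have := hd _ _ e; rewrite hd0 subr0 vcomm11 => h.
by rewrite -[X in filt _ X]half2; exact: (filtZ gG).
Qed.

Lemma extendableP n m : (3 <= n)%N -> Cn_over n m ->
  extendable n m <-> HCob A (n + 2) (1 + N) (Obs n m).
Proof.
move=> hn hm; have [a1 a2] := Obs_spec hm.
split=> [[u [/(symplecticP hom) hu ho /(extend_structP hn hm hu ho) e]]|/HCobP [b [b1 b2 b3]]].
  have [b hb eb] := symp_pot hom (sgn A 2) hu.
  apply/HCobP; exists b; split=> //.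
    apply: (weight_pot hb); rewrite eb; apply: weightZ.
    by apply: m_weight ho; [lia | case: hu].
  exact: ((potential_eq a1 hb a2 eb).1 e).
(* The new component is the field whose contraction is the differential of the given cochain [b], up
   to the sign of Upsilon; the weight of [b] makes its order n. *)
have hf : is_form 1 (1 + N) (qk K (sgn A 2) *: (dDR b : el DRm)).
  by rewrite -(clinZ _ _ (dDR_clin hom)); apply: (d_form hom); exact: is_form0Z.
have [] := symp_exists hom hf.
  by rewrite (clinZ _ _ (dDR_clin hom)) (dDR_dDR (d_exists hom)) scaler0.
move=> u hu eu; have [vu _] := hu.
have eb : dDR b = qk K (sgn A 2) *: (iDR 1 u om : el DRm).
  by rewrite eu scalerA -rmorphM /= sgnK rmorph1 scale1r.
have hr : shifts n.-1 u.
  apply: (weight_shifts hom omW vu); rewrite eu; apply: weightZ.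
  have -> : (n.-1 + 2 = n + 1)%N by lia.
  rewrite (dDR_sig (d_exists hom)) b2 (clinZ _ _ (dDR_clin hom)) /= mulr1 rmorph1.
  exact: scale1r.
have ho : has_order n u by case: (n) hn hr => // k _ /has_orderP.
exists u; split=> //; first by apply/(symplecticP hom).
by apply/(extend_structP hn hm hu ho); exact: ((potential_eq a1 b1 a2 eb).2 b3).
Qed.

Lemma Obs_equiv n m m' : (3 <= n)%N -> Cn_over n m -> Cn_over n m' -> Cn_equiv n m m' ->
  HCob A (n + 2) (1 + N) (Obs n m' - Obs n m).
Proof.
move=> hn hm hm' [phi [psi [hinv hpt hs hdeg]]].
have [n1 en] : exists n1, n = n1.+1 by exists n.-1; lia.
rewrite {1}en => /order_geP [cu hu].
have hM := csum_symp hm; have hM' := csum_symp hm'.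
have hM2 := conj_symp hinv hdeg hom hs hM.
set M2 := (phi \o csum n m \o psi) in cu hu hM2.
pose u x := M2 x - csum n m' x.
have su : symp om 1 u.
  have := sympD hom hM2 (sympZ hom (-1) hM').
  by congr symp; apply: funext => x; rewrite rmorphN rmorph1 scaleN1r.
have [vu du] := su.
have hz : raises n.-1 u by rewrite en.
have eM2 : (fun x => csum n m' x + u x) = M2 by apply: funext => x; rewrite /u addrC subrK.
have h1 := sq_deform hm' hn cu hz; rewrite eM2 in h1.
have h2 := conj_raises hinv hpt (clin_comp (csum_clin hm) (csum_clin hm)) (csum_sq hm).
have [_ _ phiK _] := hinv.
(* The square of the conjugate is the conjugate of the square, and conjugation changes the square
   only in order n + 2 and beyond; hence the lowest parts computed from [m] and from [m'] deformed
   by [u] coincide. *)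
have h3 : raises n.+1 (fun x => obs_field n m x - def_field n m' u x).
  move=> w x e; have e1 := h1 _ _ e; have e2 := h2 _ _ e; have e3 := sq_obs hm hn e.
  rewrite -(subrKA (vcomm 1 1 M2 M2 x)) addrC; apply: (filtD gG) e1 _.
  rewrite -opprB -scaleN1r; apply: (filtZ gG); move: e3; rewrite !vcomm11.
  have -> : M2 (M2 x) = phi (csum n m (csum n m (psi x))) by rewrite /M2 /= phiK.
  set T := phi _; set f := csum n m (csum n m x) => e3.
  have -> : T + T - obs_field n m x = (T - f) + (T - f) + (f + f - obs_field n m x).
    by rewrite (addrACA T) -opprD subrKA.
  by apply: (filtD gG) _ e3; exact: (filtD gG).
have [vo _] := obs_symp hm; have [vo' _] := obs_symp hm'.
have [vd ed] := def_i hm' su; have := i_top vo vd h3.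
have cw := clin_cadd (wp_clin gDR (n + 2)).
have e1 := (wp_id gDR (n + 2) _).1 (i_weight hom omW vo (obs_shifts hm)).
have e2 := (wp_id gDR (n + 2) _).1 (i_weight hom omW vo' (obs_shifts hm')).
rewrite ed !(caddD cw) (wp_L (w := n + 1) (m2_symp A) (@m2_shifts K A) _ du); last by lia.
(* The field [u] is only known to have order at least n. Passing to weight n + 2 retains just the
   part of weight n + 1 of its contraction, as m_2 raises the weight by one; this part is still
   closed and so has a potential. *)
set bt := wp (n + 1) _ => eo0.
pose L : el DRm := LDR 1 m2 bt.
have eo : (iDR (1 + 1) (obs_field n m) om : el DRm) = iDR (1 + 1) (obs_field n m') om + (L + L).
  exact: (etrans (esym e1) (etrans eo0 (congr1 (fun t : el DRm => t + (L + L)) e2))).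
have dbt : dDR bt = 0 by rewrite -wp_dDR du (cadd0 (clin_cadd (wp_clin gDR _))).
have fbt : is_form 1 (1 + N) bt by apply: wp_form; exact: (om_form hom vu).
have [b hb eb] : exists2 b : el DRm, is_form 0 (1 + N) b & dDR b = qk K (sgn A 2) *: bt.
  apply: (poincare hom); last by rewrite (clinZ _ _ (dDR_clin hom)) dbt scaler0.
  move/is_formP: fbt => [f1 f2]; apply/is_formP.
  by rewrite !(SgZq _ gDR) f1 f2 !scalerA ![qk K (sgn A 2) * _]mulrC.
have [a1 a2] := Obs_spec hm; have [b1 b2] := Obs_spec hm'.
apply/HCobP; exists b; split=> //.
  by apply: (weight_pot hb); rewrite eb; apply: weightZ; exact: (Sg_wp gDR).
have ha : is_form 0 (2 + N) (Obs n m' - Obs n m : el DRm).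
  move/is_formP: a1 => [f1 f2]; move/is_formP: b1 => [g1 g2]; apply/is_formP.
  by rewrite !(caddB (Sg_cadd _ gDR)) f1 f2 g1 g2 !scalerBr.
have ea : dDR (Obs n m' - Obs n m : el DRm) = qk K (sgn A 2 / 2%:R) *:
    ((iDR (1 + 1) (obs_field n m') om : el DRm) - iDR (1 + 1) (obs_field n m) om).
  by rewrite (caddB (clin_cadd (dDR_clin hom))) a2 b2 scalerBr.
apply: (potential_eq ha hb ea eb).1.
rewrite -/L addrAC -eo; exact: subrr.
Qed.
End Structures.

(** * Passage to equivalence classes *)

Section Classes.
Variables (K : evenRing) (A : frobAlg K).
Notation V := (fV A).
Notation N := (fN A).
Notation G := (gLie K V).
Implicit Types m : cstr A.

Lemma Cn_equiv_refl n m : (3 <= n)%N -> Cn_equiv n m m.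
Proof.
move=> hn; exists (fun x => x), (fun x => x); split.
- by split=> //; split=> //; exact: clin_id.
- exists (fun _ _ => 0); split=> [i _|F x].
    by split; [exact: clin_cst0 | move=> i' j x _ _; apply/el_orderP; rewrite (cadd0 (Sg_cadd _ (good_G K V))) scaler0].
  by exists 0%N => M _; rewrite big1 // addr0 subrr; exact: nz0.
- exact: (pull_id (fom_symplectic A)).
- by move=> i x; rewrite addr0.
have -> : (fun x : el G => x) \o csum n m \o (fun x : el G => x) - csum n m = fun=> 0.
  by apply: funext => x; exact: subrr.
case: n hn => // n _; apply/order_geP; split; first exact: clin_cst0.
by move=> w x _; exact: (filt_0 (good_G K V)).
Qed.

Lemma hclass_equiv n m m' : (3 <= n)%N -> Cn_over n m -> Cn_over n m' -> Cn_equiv n m m' ->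
  hclass A (n + 2) (1 + N) (Obs n m) = hclass A (n + 2) (1 + N) (Obs n m').
Proof.
move=> hn hm hm' h; apply: esym.
apply: (proj2 (@hclass_eqP K A n _ _ (Obs_cocycle hm' hn) (Obs_cocycle hm hn))).
exact: Obs_equiv.
Qed.

Lemma extendable_hclass n m : (3 <= n)%N -> Cn_over n m -> extendable n m <->
  hclass A (n + 2) (1 + N) (Obs n m) = hclass A (n + 2) (1 + N) 0.
Proof.
move=> hn hm.
have h := hclass_eqP (Obs_cocycle hm hn) (HCocycle0 A n).
have e := extendableP hn hm; rewrite subr0 in h.
by split=> [/e /h|/h /e].
Qed.

End Classes.

(** The first clause certifies that the description behind [Obs] has exactly one solution, the
    second that Obs(m) represents a cohomology class. Extendability is stated both for each
    structure and for classes containing an extendable member. *)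
Theorem theorem12p7 (K : evenRing) (A : frobAlg K) (n : nat) (hn : (3 <= n)%N) :
  (forall m : cstr A, Cn_over n m ->
     exists! a, is_form 0 (2 + fN A) a /\ Upsilon 2 a = obs_field n m) /\
  (forall m : cstr A, Cn_over n m -> HCocycle A (n + 2) (1 + fN A) (Obs n m)) /\
  exists Obs_n : set (cstr A) -> set (DR K (fV A)),
    [/\ set_fun (SC A n) (HC A (n + 2) (1 + fN A)) Obs_n,
        forall m, Cn_over n m ->
          Obs_n (scclass n m) = hclass A (n + 2) (1 + fN A) (Obs n m),
        forall m, Cn_over n m ->
          (extendable n m <->
           Obs_n (scclass n m) = hclass A (n + 2) (1 + fN A) 0) &
        [set c | SC A n c /\ exists2 m, c m & extendable n m] =
        [set c | SC A n c /\ Obs_n c = hclass A (n + 2) (1 + fN A) 0]].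
Proof.
split; first by move=> m hm; exact: Upsilon_obs.
split; first by move=> m hm; exact: Obs_cocycle.
pose pick (c : set (cstr A)) : cstr A :=
  xget (fun _ => 0) [set m | Cn_over n m /\ scclass n m = c].
pose Obs_n c := hclass A (n + 2) (1 + fN A) (Obs n (pick c)).
(* A class of structures is a set, so a representative is chosen. Reflexivity puts [m] into its own
   class, which is also the class of the chosen structure; this yields the equivalence that makes
   the cohomology class independent of the choice. *)
have pickP m : Cn_over n m -> Cn_over n (pick (scclass n m)) /\
    Cn_equiv n (pick (scclass n m)) m.
  move=> hm; have [h1 h2] : Cn_over n (pick (scclass n m)) /\
      scclass n (pick (scclass n m)) = scclass n m.
    by apply: (xgetPex (fun _ => 0) (P := [set m' | Cn_over n m' /\ scclass n m' = scclass n m])); exists m.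
  split=> //; have : scclass n (pick (scclass n m)) m.
    by rewrite h2; split=> //; exact: Cn_equiv_refl.
  by case.
have ObsE m : Cn_over n m -> Obs_n (scclass n m) = hclass A (n + 2) (1 + fN A) (Obs n m).
  by move=> hm; have [h1 h2] := pickP m hm; exact: hclass_equiv.
have extE m : Cn_over n m ->
    (extendable n m <-> Obs_n (scclass n m) = hclass A (n + 2) (1 + fN A) 0).
  by move=> hm; rewrite ObsE //; exact: extendable_hclass.
exists Obs_n; split; [|exact: ObsE|exact: extE|].
  move=> _ [m hm <-]; have [h1 _] := pickP m hm.
  by exists (Obs n (pick (scclass n m))); first exact: Obs_cocycle.
apply/seteqP; split=> [c [[m hm <-] [m' [hm' he] ex]]|c [[m hm <-] e]]; split; try by exists m.
  have := (extE m' hm').1 ex; rewrite !ObsE // => <-; exact: hclass_equiv.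
exists m; last exact/(extE m hm).
by split=> //; exact: Cn_equiv_refl.
Qed.
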